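(* Suppose that a $2$-nondegenerate model $M$ has modified symbol $\mathfrak{g}_{\leq0}^{\mathrm{mod}}(\tilde\phi(p))$ at $\tilde\phi(p)$ given by matrices $$(H(\tilde\phi(p)),\Xi_1(\tilde\phi(p)),\dots,\Xi_{n-s}(\tilde\phi(p)),\Omega_1(\tilde\phi(p)),\dots,\Omega_{n-s}(\tilde\phi(p)))$$ with respect to any normalization condition $(O_{0,-2}^N(\tilde\phi(p)),O_{0,2}^N(\tilde\phi(p)))$ of the form $$O_{0,-2}^N(\tilde\phi(p))=0\quad\text{and}\quad O_{0,2}^N(\tilde\phi(p))\big(e_{\alpha},S^{0,2}_\beta(\tilde\phi(p))\big)=O_{0,2}^N(\tilde\phi(p))\big(e_{\beta},S^{0,2}_\alpha(\tilde\phi(p))\big)$$ for all $\alpha,\beta$, where $S^{0,2}_\alpha(\tilde\phi(p))=\Xi_\alpha(\tilde\phi(p))H(\tilde\phi(p))^{-1}$. Then each $\Omega_\alpha(\tilde\phi(p))$ belongs to the normalizer $N_{\mathfrak{csp}(\mathbb{C}\mathfrak{g}_{-1})_{0,0}}(\tilde\phi(\mathfrak{g}_{0,-2}(p)))$, and the collection $(\Omega_1(\tilde\phi(p)),\dots,\Omega_{n-s}(\tilde\phi(p)))$ belongs to $$\left\{(B_1,\dots,B_{n-s})\in\prod_{1}^{n-s}\mathfrak{csp}(\mathbb{C}\mathfrak{g}_{-1})_{0,0}\ \middle|\ \left[B_\alpha,S^{0,2}_\beta(\tilde\phi(p))\right]-\left[B_\beta,S^{0,2}_\alpha(\tilde\phi(p))\right]\in\tilde\phi(\mathfrak{g}_{0,2}(p))\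 \text{for all }\alpha,\beta\right\},$$ i.e., $\pi_{0,2}([\mathfrak{g}_{0,+}^{\mathrm{mod}}(\tilde\phi(p)),\mathfrak{g}_{0,+}^{\mathrm{mod}}(\tilde\phi(p))])\subset\pi_{0,2}(\mathfrak{g}_{0,+}^{\mathrm{mod}}(\tilde\phi(p)))$.
   Context: MODELS AND FRAME. A $2$-nondegenerate model is a real analytic hypersurface $\Re(w)=z^TH(\zeta,\overline\zeta)\overline z+\Re(\overline z^TS(\zeta,\overline\zeta)\overline z)$ near $0$ in $\mathbb C\oplus\mathbb C^s\oplus\mathbb C^{n-s}$, $H$ Hermitian and $S$ symmetric $s\times s$ matrix valued, $H(0,0)$ nondegenerate, with constant rank $s$ Levi form, $2$-nondegenerate near $0$. The adapted frame used is $g=\frac{\partial}{\partial\Im(w)}$, $f_a=\frac{\partial}{\partial z_a}-i(H_a\overline z+\overline{S_a}z)\frac{\partial}{\partial\Im(w)}$ ($H_a,S_a$ the $a$th rows), and $e_\alpha$ the section of the Levi kernel of the form $\frac{\partial}{\partial\zeta_\alpha}-i(z^TH_{\zeta_\alpha}\overline z+\Re(\overline z^TS_{\zeta_\alpha}\overline z))\frac{\partial}{\partial\Im(w)}$ plus a combination of the $f_c$; for the corresponding $\tilde\phi$ one has $e^{ih(\tilde\phi)}=1$, $H(\tilde\phi)=H(\zeta,\overline\zeta)$, $\Xi_\beta(\tilde\phi)=(H^T)^{-1}S_{\zeta_\beta}$ and the matrices along $\tilde\phi$ (before normalization) are $\Omega_\beta(\tilde\phi)=(H^T)^{-1}(H_{\zeta_\beta})^T$.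 ALGEBRA. $\mathbb C\mathfrak g_-\oplus\mathfrak{csp}(\mathbb C\mathfrak g_{-1})$, with $\mathbb{C}\mathfrak g_-=\mathfrak g_{-2,0}\oplus\mathfrak g_{-1,-1}\oplus\mathfrak g_{-1,1}$ the complex Heisenberg algebra of dimension $2s+1$ and $\mathfrak{csp}(\mathbb C\mathfrak g_{-1})=\bigoplus_{j\in\{-2,0,2\}}\mathfrak{csp}(\mathbb C\mathfrak g_{-1})_{0,j}$ its first-grading preserving derivations, is represented by $$\begin{pmatrix} c & 0 & 0 & 0 \\ v_1 & L & S^{0,2} & 0 \\ v_2 & S^{0,-2} & -L^T & 0 \\ u i & v_2^T & -v_1^T & -c \end{pmatrix}$$ with $u$ for $\mathfrak g_{-2,0}$, $v_1$ for $\mathfrak g_{-1,1}$, $v_2$ for $\mathfrak g_{-1,-1}$, symmetric $S^{0,\pm2}$ for $\mathfrak{csp}(\mathbb C\mathfrak g_{-1})_{0,\pm2}$, and $c,L$ for $\mathfrak{csp}(\mathbb C\mathfrak g_{-1})_{0,0}$; $\pi_{0,2}$ is the projection to $\mathfrak{csp}(\mathbb C\mathfrak g_{-1})_{0,2}$. $s\times s$ matrices such as $\Omega_\alpha$ are regarded as elements of $\mathfrak{csp}(\mathbb C\mathfrak g_{-1})_{0,0}$ via $L$, symmetric matrices as elements of $\mathfrak{csp}(\mathbb C\mathfrak g_{-1})_{0,\pm2}$ via $S^{0,\pm2}$, and brackets are those of $\mathfrak{csp}(\mathbb C\mathfrak g_{-1})$. SYMBOLS. For a CR hypersurface $(M,\mathcal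 H)$ with Levi kernel $\mathcal K_2$ (rank $n-s$), $\mathbb C\mathfrak g_-(p)$ has components $\mathfrak g_{-2,0}(p)=\mathbb CT_pM/(\mathcal H_p\oplus\overline{\mathcal H}_p)$, $\mathfrak g_{-1,1}(p)=\mathcal H_p/(\mathcal K_2)_p$, $\mathfrak g_{-1,-1}(p)=\overline{\mathcal H}_p/(\overline{\mathcal K_2})_p$, with bracket induced by Lie brackets. $\iota(v)(w)=0$ for $v\in(\mathcal K_2)_p$, $w\in\mathfrak g_{-1,1}(p)$ and $\iota(v)(w)=[V,W]_p\bmod(\mathcal K_2\oplus\overline{\mathcal H})$ for $w\in\mathfrak g_{-1,-1}(p)$ ($V,W$ sections of $\mathcal K_2,\overline{\mathcal H}$ extending $v,w$), extended by $\iota(\overline v)=\overline{\iota(v)}$. $\mathfrak g_{0,2}(p)=\iota(\mathcal K_2)_p$, $\mathfrak g_{0,-2}(p)=\iota(\overline{\mathcal K_2})_p$; $\mathfrak g_{0,0}(p)$ is the set of bigrading preserving elements of $\mathfrak{csp}(\mathbb C\mathfrak g_{-1}(p))$ normalizing $\mathfrak g_{0,\pm2}(p)$; $M$ is $2$-nondegenerate iff $\mathcal K_2\neq0$ and $\iota$ is injective on $\mathcal K_2$. $\mathcal F_p$ is the set of bigraded Lie algebra isomorphisms $\tilde\phi:\mathbb C\mathfrak g_-(p)\to\mathbb C\mathfrak g_-$, extended to derivations by conjugation; an adapted frame $(g,f_i,\overline{f_i},e_\alpha,\overline{e_\alpha})$ ($g$, $f_i$ representing bases of $\mathfrak g_{-2,0}(p)$,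 $\mathfrak g_{-1,1}(p)$, $e_\alpha$ a basis of $\mathcal K_2$) determines the $\tilde\phi$ sending $g$ to $u=1$ and $f_i$ to $v_1$ the $i$th standard vector; $e^{ih(\tilde\phi)}H(\tilde\phi)$ has $j$th column the $v_2$-part of $\tilde\phi(\overline{f_j})$; $\iota(e_\alpha)(\overline{f_k})=\sum_l(\Xi_\alpha(\tilde\phi))_{l,k}f_l$; and $\tilde\phi(\iota(e_\alpha))$, $\tilde\phi(\iota(\overline{e_\alpha}))$ are represented by $S^{0,2}_\alpha=e^{-ih}\Xi_\alpha H^{-1}$, $S^{0,-2}_\alpha=e^{ih}H\overline{\Xi_\alpha}$. MODIFIED SYMBOL. Let $\pi:M\to N$ be the local quotient by the foliation of $TM\cap(\mathcal K_2\oplus\overline{\mathcal K_2})$, $M_{\pi(p)}$ the leaf through $p$, $\mathscr I(\tilde\phi)=(\pi_*\circ\tilde\phi^{-1})^{-1}$. For a section $\tilde\phi:M_{\pi(p)}\to\mathcal F$ let $\iota_{\tilde\phi}$ be the complex linear extension of $\dot p(0)\mapsto\frac{d}{dt}|_{t=0}\mathscr I(\tilde\phi(p))\circ\mathscr I(\tilde\phi(p(t)))^{-1}$ for curves $p(t)$ in $M_{\pi(p)}$, $p(0)=p$. Then $\mathfrak g^{\mathrm{mod}}_{\le0}(\tilde\phi;p)=\mathbb C\mathfrak g_-\oplus\mathfrak g^{\mathrm{mod}}_{0,-}\oplus\tilde\phi(\mathfrak g_{0,0}(p))\oplus\mathfrak g^{\mathrm{mod}}_{0,+}$ with $\mathfrak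 g^{\mathrm{mod}}_{0,+}=\iota_{\tilde\phi}((\mathcal K_2)_p)$, $\mathfrak g^{\mathrm{mod}}_{0,-}=\iota_{\tilde\phi}((\overline{\mathcal K_2})_p)$; the matrices $\Omega_\alpha$ are given by $\iota_{\tilde\phi}(e_\alpha)$ having (modulo the element with only $c$ nonzero) $L=\Omega_\alpha$, $S^{0,2}=S^{0,2}_\alpha$, other blocks zero. NORMALIZATION. $O_{0,\pm2}(\tilde\phi)(p):(\mathcal K_2)_p\otimes\tilde\phi(\mathfrak g_{0,\pm2}(p))\to\mathfrak{csp}(\mathbb C\mathfrak g_{-1})_{0,\pm2}/\tilde\phi(\mathfrak g_{0,\pm2}(p))$ is $(X,S^{0,\pm2}_\alpha)\mapsto X(S^{0,\pm2}_\alpha(\tilde\phi))(p)$. A normalization condition chooses one pair $(O^N_{0,-2}(\tilde\phi(p)),O^N_{0,2}(\tilde\phi(p)))$ in each class $\{(O_{0,-2}(\tilde\phi')(p),O_{0,2}(\tilde\phi')(p)):\tilde\phi'(p)=\tilde\phi(p)\}$ (with $(0,0)$ chosen when it is in the class). The modified symbol $\mathfrak g_{\le0}^{\mathrm{mod}}(\tilde\phi(p))$ with respect to it is $\mathfrak g_{\le0}^{\mathrm{mod}}(\tilde\phi';p)$ for any section $\tilde\phi'$ with $\tilde\phi'(p)=\tilde\phi(p)$ and $O_{0,\pm2}(\tilde\phi')(p)=O^N_{0,\pm2}(\tilde\phi(p))$; $H(\tilde\phi(p)),\Xi_\alpha(\tilde\phi(p)),\Omega_\alpha(\tilde\phi(p))$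 are the corresponding matrices and $\mathfrak g^{\mathrm{mod}}_{0,\pm}(\tilde\phi(p))$ the corresponding summands. *)

(* Defs.v *)
From HB Require Import structures.
From mathcomp Require Import all_boot all_order all_algebra.
From mathcomp Require Import all_classical all_reals all_analysis.
From mathcomp Require Import complex.
Set Implicit Arguments.
Unset Strict Implicit.
Unset Printing Implicit Defensive.
Import Order.TTheory GRing.Theory Num.Theory.
Import numFieldNormedType.Exports.
Local Open Scope classical_set_scope.
Local Open Scope ring_scope.
Local Open Scope complex_scope.

Section Calculus.
Context {R : realType} {N : nat}.
Implicit Types (B : set 'rV[R]_N) (x v : 'rV[R]_N).

Definition smooth_on B (f : 'rV[R]_N -> R) : Prop :=
  forall (vs : seq 'rV[R]_N) x, B x ->
    differentiable (foldr (fun v g => 'D_v g) f vs) x.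

(* Smooth, and locally the sum of its Taylor series, whose homogeneous part of
   degree j in the increment h is (D_h^j f)(x) / j!. *)
Definition analytic_on B (f : 'rV[R]_N -> R) : Prop :=
  smooth_on B f /\
  forall x, B x -> \forall h \near (0 : 'rV[R]_N),
    (fun k : nat => \sum_(j < k) (j`!%:R)^-1 * iter j (fun g => 'D_h g) f x)
      @ \oo --> f (x + h).

Definition csmooth_on B (f : 'rV[R]_N -> R[i]) : Prop :=
  smooth_on B (fun x => complex.Re (f x)) /\
  smooth_on B (fun x => complex.Im (f x)).

Definition canalytic_on B (f : 'rV[R]_N -> R[i]) : Prop :=
  analytic_on B (fun x => complex.Re (f x)) /\
  analytic_on B (fun x => complex.Im (f x)).

Definition cpartial (f : 'rV[R]_N -> R[i]) x (j : 'I_N) : R[i] :=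
  ('D_(delta_mx 0 j) (fun y => complex.Re (f y)) x) +i*
  ('D_(delta_mx 0 j) (fun y => complex.Im (f y)) x).

(* Complexified tangent vectors at any point of R^N are elements of
   'rV[R[i]]_N; [dir f x X] is the derivative X(f) at x. *)
Definition dir (f : 'rV[R]_N -> R[i]) x (X : 'rV[R[i]]_N) : R[i] :=
  \sum_j X 0 j * cpartial f x j.

Definition conjv {k l : nat} (X : 'M[R[i]]_(k, l)) : 'M[R[i]]_(k, l) :=
  map_mx (@conjc R) X.

Definition complexify (v : 'rV[R]_N) : 'rV[R[i]]_N := map_mx (real_complex R) v.

Definition field := 'rV[R]_N -> 'rV[R[i]]_N.

Definition field_smooth_on B (V : field) : Prop :=
  forall k, csmooth_on B (fun x => V x 0 k).

Definition lie_bracket (V W : field) (x : 'rV[R]_N) : 'rV[R[i]]_N :=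
  \row_k (dir (fun y => W y 0 k) x (V x) - dir (fun y => V y 0 k) x (W x)).

Definition local_section (D : 'rV[R]_N -> set 'rV[R[i]]_N) x (V : field) : Prop :=
  exists2 B : set 'rV[R]_N, open B /\ B x &
    field_smooth_on B V /\ forall y, B y -> D y (V y).

(* Derivative at 0 of a complex valued function of a real variable. *)
Definition is_cderive0 (f : R -> R[i]) (d : R[i]) : Prop :=
  is_derive (0 : R) (1 : R) (fun t => complex.Re (f t)) (complex.Re d) /\
  is_derive (0 : R) (1 : R) (fun t => complex.Im (f t)) (complex.Im d).

Definition curve_in (L : set 'rV[R]_N) x v (c : R -> 'rV[R]_N) : Prop :=
  [/\ c 0 = x, \forall t \near (0 : R), L (c t) &
      is_derive (0 : R) (1 : R) c v].

(* [is_leaf_deriv L f x X d]: X(f) = d at x for a function f of which only the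
   values on the submanifold L matter, X being a complexified tangent vector of
   L; it is the complex linear extension of the derivative along curves in L. *)
Definition is_leaf_deriv (L : set 'rV[R]_N) (f : 'rV[R]_N -> R[i]) x
    (X : 'rV[R[i]]_N) (d : R[i]) : Prop :=
  exists a b : R[i], [/\ d = a + ('i : R[i]) * b,
    forall c, curve_in L x (map_mx (@complex.Re R) X) c ->
      is_cderive0 (fun t => f (c t)) a &
    forall c, curve_in L x (map_mx (@complex.Im R) X) c ->
      is_cderive0 (fun t => f (c t)) b].

End Calculus.

Arguments field : clear implicits.

Section Algebra.
Context {R : realType} {s : nat}.
Local Notation C := R[i].
Local Notation alg := 'M[C]_(1 + (s + (s + 1))).

(* The matrix
     [  c    0     0    0 ]
     [ v1    L    Sp    0 ]
     [ v2   Sm  -L^T    0 ]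
     [ ui  v2^T -v1^T  -c ]. *)
Definition alg_mx (c u : C) (v1 v2 : 'cV[C]_s) (L Sp Sm : 'M[C]_s) : alg :=
  block_mx (c%:M : 'M[C]_1) 0
    (col_mx v1 (col_mx v2 ((u * ('i : C))%:M : 'M[C]_1)))
    (block_mx L (row_mx Sp (0 : 'cV_s))
       (col_mx Sm v2^T)
       (block_mx (- L^T) (0 : 'cV_s) (- v1^T) ((- c)%:M : 'M[C]_1))).

Definition commutator (A B : alg) : alg := A *m B - B *m A.

Definition gminus_mx (u : C) (v1 v2 : 'cV[C]_s) : alg :=
  alg_mx 0 u v1 v2 0 0 0.

Definition gminus : set alg :=
  [set X | exists u v1 v2, X = gminus_mx u v1 v2].

Definition csp : set alg :=
  [set A | exists c L Sp Sm,
     [/\ Sp^T = Sp, Sm^T = Sm & A = alg_mx c 0 0 0 L Sp Sm]].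

Definition csp00 : set alg := [set A | exists c L, A = alg_mx c 0 0 0 L 0 0].

Definition inL (L : 'M[C]_s) : alg := alg_mx 0 0 0 0 L 0 0.

(* [inS true] and [inS false] embed symmetric matrices in the summands
   csp_{0,2} and csp_{0,-2} respectively. *)
Definition inS (sg : bool) (S : 'M[C]_s) : alg :=
  if sg then alg_mx 0 0 0 0 0 S 0 else alg_mx 0 0 0 0 0 0 S.

Definition proj02 (A : alg) : alg :=
  inS true (lsubmx (ursubmx (drsubmx A))).

Definition normalizer00 (V : set alg) : set alg :=
  [set B | csp00 B /\ forall Y, V Y -> V (commutator B Y)].

Definition bracket_span (V W : set alg) : set alg :=
  [set X | exists k (a b : 'I_k -> alg),
     [/\ forall j, V (a j), forall j, W (b j) &
         X = \sum_j commutator (a j) (b j)]].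

End Algebra.

Section Model.
Context {R : realType} {s m : nat}.
Local Notation C := R[i].

(* Real dimension of M; m stands for n - s. M is the graph of F below, so that
   the real coordinates (Im w, Re z, Im z, Re zeta, Im zeta) form a global chart
   of M. Points of M and (complexified) tangent vectors are written in it. *)
Definition dimM : nat := (1 + ((s + s) + (m + m)))%N.
Local Notation pt := 'rV[R]_dimM.
Local Notation vec := 'rV[C]_dimM.

Definition coord_y (x : pt) : R := x 0 (lshift _ ord0).
Definition coord_z (x : pt) : 'cV[C]_s :=
  \col_a (x 0 (rshift 1 (lshift _ (lshift s a))) +i*
          x 0 (rshift 1 (lshift _ (rshift s a)))).
Definition coord_zeta (x : pt) : 'cV[C]_m :=
  \col_a (x 0 (rshift 1 (rshift _ (lshift m a))) +i*
          x 0 (rshift 1 (rshift _ (rshift m a)))).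

(* H(zeta, conj zeta) and S(zeta, conj zeta) are functions of zeta that need not
   be holomorphic; dom is the neighbourhood of 0 on which M is considered. *)
Record graph := Graph {
  dom : set pt;
  graphH : 'cV[C]_m -> 'M[C]_s;
  graphS : 'cV[C]_m -> 'M[C]_s }.

Variable M : graph.

Definition graphF (x : pt) : C :=
  let z := coord_z x in let zt := coord_zeta x in
  (z^T *m graphH M zt *m conjv z) 0 0 +
  (complex.Re (((conjv z)^T *m graphS M zt *m conjv z) 0 0))%:C.

Definition coord_w (x : pt) : C := graphF x + ('i : C) * (coord_y x)%:C.

(* The CR structure: complexified tangent vectors of type (1,0) in the ambient
   complex space. *)
Definition calH (x : pt) : set vec :=
  [set X | [/\ dom M x, dir (fun y => (coord_w y)^*) x X = 0,
     forall a, dir (fun y => (coord_z y a 0)^*) x X = 0 &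
     forall a, dir (fun y => (coord_zeta y a 0)^*) x X = 0]].

Definition conj_dist (D : pt -> set vec) (x : pt) : set vec :=
  [set X | D x (conjv X)].

Local Notation Hbar := (conj_dist calH).

Definition sum_dist (D D' : pt -> set vec) (x : pt) : set vec :=
  [set X | exists Y Z, [/\ D x Y, D' x Z & X = Y + Z]].

(* The Levi kernel. *)
Definition K2 (x : pt) : set vec :=
  [set v | calH x v /\
     forall V W, local_section calH x V -> local_section Hbar x W ->
       V x = v -> sum_dist calH Hbar x (lie_bracket V W x)].

Local Notation K2bar := (conj_dist K2).

(* The Hermitian Levi form on the (s + m)-dimensional space calH x has rank s
   when its kernel has dimension m. *)
Definition levi_rank_s (x : pt) : Prop :=
  exists2 K : 'M[C]_(m, dimM), row_free K & forall v, K2 x v <-> (v <= K)%MS.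

(* [iota_val x v w u]: u in calH represents iota(v)(w) in calH / K2, where v is
   in K2 and w in the conjugate of calH represents an element of g_{-1,-1}. *)
Definition iota_val (x : pt) (v w u : vec) : Prop :=
  exists V W, [/\ local_section K2 x V, local_section Hbar x W, V x = v, W x = w &
    calH x u /\ sum_dist K2 Hbar x (lie_bracket V W x - u)].

Definition two_nondegenerate (x : pt) : Prop :=
  (exists2 v, K2 x v & v != 0) /\
  (forall v, K2 x v -> (forall w u, iota_val x v w u -> K2 x u) -> v = 0).

Definition two_nondegenerate_model : Prop :=
  [/\ open (dom M), dom M 0, graphH M 0 \in unitmx &
  [/\ forall x, dom M x -> (graphH M (coord_zeta x))^T = conjv (graphH M (coord_zeta x)),
      forall x, dom M x -> (graphS M (coord_zeta x))^T = graphS M (coord_zeta x),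
      forall a b, canalytic_on (dom M) (fun x => graphH M (coord_zeta x) a b),
      forall a b, canalytic_on (dom M) (fun x => graphS M (coord_zeta x) a b) &
      forall x, dom M x -> levi_rank_s x /\ two_nondegenerate x]].

(* Bigraded maps from Cg_-(x) to Cg_-. The components with source g_{-2,0}(x),
   g_{-1,1}(x) and g_{-1,-1}(x), which are quotients of the complexified tangent
   space, of calH x and of its conjugate, are given by their lifts to these
   spaces. In [isF], the last two lifts vanish outside of them by convention,
   so that a point of F is determined by its three lifts. *)
Record symmap := Symmap {
  s20 : vec -> C;
  s11 : vec -> 'cV[C]_s;
  s1m : vec -> 'cV[C]_s }.

Definition isF (x : pt) (phi : symmap) : Prop :=
  [/\ [/\ forall (a : C) v w, s20 phi (a *: v + w) = a * s20 phi v + s20 phi w,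
          forall a, exists v, s20 phi v = a &
          forall v, s20 phi v = 0 <-> sum_dist calH Hbar x v],
      [/\ forall (a : C) v w, calH x v -> calH x w ->
            s11 phi (a *: v + w) = a *: s11 phi v + s11 phi w,
          forall a, exists2 v, calH x v & s11 phi v = a,
          forall v, calH x v -> (s11 phi v = 0 <-> K2 x v) &
          forall v, ~ calH x v -> s11 phi v = 0],
      [/\ forall (a : C) v w, Hbar x v -> Hbar x w ->
            s1m phi (a *: v + w) = a *: s1m phi v + s1m phi w,
          forall a, exists2 v, Hbar x v & s1m phi v = a,
          forall v, Hbar x v -> (s1m phi v = 0 <-> K2bar x v) &
          forall v, ~ Hbar x v -> s1m phi v = 0] &
      forall V W V' W', local_section calH x V -> local_section Hbar x W ->
        local_section calH x V' -> local_section Hbar x W' ->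
        gminus_mx (s20 phi (lie_bracket (V \+ W) (V' \+ W') x)) 0 0 =
        commutator (gminus_mx 0 (s11 phi (V x)) (s1m phi (W x)))
                   (gminus_mx 0 (s11 phi (V' x)) (s1m phi (W' x)))].

(* The matrix of phi(iota(v)) for [sg = true], of phi(iota(conj v)) for
   [sg = false], where v is in K2. *)
Definition Smat (sg : bool) (x : pt) (phi : symmap) (v : vec) : 'M[C]_s :=
  xget 0 [set S | forall w u, iota_val x v w u ->
    if sg then s11 phi u = S *m s1m phi w
          else s1m phi (conjv u) = S *m s11 phi (conjv w)].

(* phi(g_{0,2}(x)) and phi(g_{0,-2}(x)), as sets of s x s matrices *)
Definition phi_g02 (sg : bool) (x : pt) (phi : symmap) : set 'M[C]_s :=
  [set Smat sg x phi v | v in K2 x].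

(* Vectors f_i in calH representing the basis of g_{-1,1} that phi sends to the
   standard basis. *)
Definition rep_basis (x : pt) (phi : symmap) (f : 'I_s -> vec) : Prop :=
  forall j, calH x (f j) /\ s11 phi (f j) = delta_mx j 0.

Definition expi (h : R) : C := cos h +i* sin h.

Definition is_Hmat (x : pt) (phi : symmap) (h : R) (Hp : 'M[C]_s) : Prop :=
  Hp^T = conjv Hp /\
  forall f, rep_basis x phi f -> forall j, s1m phi (conjv (f j)) = expi h *: col j Hp.

Definition is_Xi (x : pt) (phi : symmap) (v : vec) (Xi : 'M[C]_s) : Prop :=
  forall f, rep_basis x phi f -> forall k u, iota_val x v (conjv (f k)) u ->
    K2 x (u - \sum_l Xi l k *: f l).

Definition kernel_frame (e : 'I_m -> field R dimM) : Prop :=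
  (forall a, field_smooth_on (dom M) (e a)) /\
  forall x, dom M x ->
    let K := \matrix_a e a x in
    row_free K /\ forall v, K2 x v <-> (v <= K)%MS.

(* The local leaf space N is identified with an open subset of R^(2s+1). *)
Local Notation npt := 'rV[R]_(1 + (s + s)).
Variable pi : pt -> npt.

(* Complexified differential of pi. *)
Definition dpi (x : pt) (X : vec) : 'rV[C]_(1 + (s + s)) :=
  \row_k dir (fun y => (pi y 0 k)%:C) x X.

Definition leaf (p : pt) : set pt := [set x | dom M x /\ pi x = pi p].

Definition local_quotient : Prop :=
  [/\ forall k, smooth_on (dom M) (fun x => pi x 0 k),
      forall x, dom M x -> forall c : npt, exists v : pt, dpi x (complexify v) = complexify c,
      forall x, dom M x -> forall v : pt,
        dpi x (complexify v) = 0 <-> sum_dist K2 K2bar x (complexify v) &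
      forall p, dom M p -> connected (leaf p)].

(* Smooth sections of F over the leaf through p: near each point of the leaf, phi
   is determined by the restriction of a smooth adapted frame. *)
Definition leaf_section (p : pt) (phi : pt -> symmap) : Prop :=
  (forall x, leaf p x -> isF x (phi x)) /\
  forall x, leaf p x -> exists2 B : set pt, open B /\ B x &
    exists (g : field R dimM) (f : 'I_s -> field R dimM),
      [/\ field_smooth_on B g, forall j, field_smooth_on B (f j),
          forall y j, B y -> dom M y -> calH y (f j y) &
          forall y, B y -> leaf p y ->
            s20 (phi y) (g y) = 1 /\ rep_basis y (phi y) (f ^~ y)].

(* [calI phi x n2 n1 A]: the map I(phi) at x sends to A the element of the
   graded tangent space of N at pi x with component in CTN / D represented by n2
   and component in D equal to n1, where D is the image of calH + conj calH. *)
Definition calI (phi : pt -> symmap) (x : pt) (n2 n1 : 'rV[C]_(1 + (s + s)))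
    (A : 'M[C]_(1 + (s + (s + 1)))) : Prop :=
  exists t v w, [/\ calH x v, Hbar x w, dpi x t = n2, dpi x (v + w) = n1 &
    A = gminus_mx (s20 (phi x) t) (s11 (phi x) v) (s1m (phi x) w)].

(* I(phi(p)) o I(phi(x))^-1, for x on the leaf through p *)
Definition calI_transition (phi : pt -> symmap) (p x : pt)
    (A : 'M[C]_(1 + (s + (s + 1)))) : 'M[C]_(1 + (s + (s + 1))) :=
  xget 0 [set B | exists n2 n1, calI phi x n2 n1 A /\ calI phi p n2 n1 B].

(* [is_iota_mod phi p v A]: the element A of csp, acting on Cg_- by commutators,
   is iota_phi(v). *)
Definition is_iota_mod (phi : pt -> symmap) (p : pt) (v : vec)
    (A : 'M[C]_(1 + (s + (s + 1)))) : Prop :=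
  csp A /\ forall X, gminus X -> forall j k,
    is_leaf_deriv (leaf p) (fun x => calI_transition phi p x X j k) p v
      (commutator A X j k).

Definition gmod_plus (phi : pt -> symmap) (p : pt) : set 'M[C]_(1 + (s + (s + 1))) :=
  [set A | exists2 v, K2 p v & is_iota_mod phi p v A].

Definition is_Omega (phi : pt -> symmap) (p : pt) (v : vec) (Om : 'M[C]_s) : Prop :=
  exists c Sp Sm, is_iota_mod phi p v (alg_mx c 0 0 0 Om Sp Sm).

Variable e : 'I_m -> field R dimM.

(* Bilinear maps K2 x phi(g_{0,+-2}) -> csp_{0,+-2} / phi(g_{0,+-2}) are given by
   representatives of their values, to be read modulo phi(g_{0,+-2}). *)
Definition tensor := vec -> 'M[C]_s -> 'M[C]_s.

(* [is_O sg phi p o]: o represents O_{0,2}(phi)(p) for [sg = true], and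
   O_{0,-2}(phi)(p) for [sg = false]. *)
Definition is_O (sg : bool) (phi : pt -> symmap) (p : pt) (o : tensor) : Prop :=
  forall X, K2 p X -> exists D : 'I_m -> 'M[C]_s,
    (forall b j k,
       is_leaf_deriv (leaf p) (fun x => Smat sg x (phi x) (e b x) j k) p X (D b j k)) /\
    forall t : 'I_m -> C,
      phi_g02 sg p (phi p)
        (o X (\sum_b t b *: Smat sg p (phi p) (e b p)) - \sum_b t b *: D b).

Definition is_zero_tensor (sg : bool) (p : pt) (phi : symmap) (o : tensor) : Prop :=
  forall X T, K2 p X -> phi_g02 sg p phi T -> phi_g02 sg p phi (o X T).

(* Pairs are ordered as (O_{0,-2}, O_{0,2}). *)
Definition has_O (phi : pt -> symmap) (p : pt) (o : tensor * tensor) : Prop :=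
  [/\ leaf_section p phi, is_O false phi p o.1 & is_O true phi p o.2].

Definition in_O_class (p : pt) (phi0 : symmap) (o : tensor * tensor) : Prop :=
  exists2 phi, phi p = phi0 & has_O phi p o.

Definition normalization_condition (ON : pt -> symmap -> tensor * tensor) : Prop :=
  forall p phi0, dom M p -> isF p phi0 ->
    in_O_class p phi0 (ON p phi0) /\
    (in_O_class p phi0 (fun _ _ => 0, fun _ _ => 0) ->
     is_zero_tensor false p phi0 (ON p phi0).1 /\
     is_zero_tensor true p phi0 (ON p phi0).2).

End Model.

Arguments graph : clear implicits.
Arguments symmap : clear implicits.
Arguments tensor : clear implicits.
Arguments dimM : clear implicits.

(* Main.v *)
Require Import Defs.
From HB Require Import structures.
From mathcomp Require Import all_boot all_order all_algebra.
From mathcomp Require Import all_classical all_reals all_analysis.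
From mathcomp Require Import complex.
From mathcomp Require Import ring lra.
Import Order.TTheory GRing.Theory Num.Theory.
Import numFieldNormedType.Exports.
Set Implicit Arguments.
Unset Strict Implicit.
Unset Printing Implicit Defensive.
Local Open Scope classical_set_scope.
Local Open Scope ring_scope.
Local Open Scope complex_scope.

(** Everything is read on the leaf space N. Kernel fields are tangent to the
    leaves, so for a section V of the Levi kernel and any field W the image
    dpi([V, W]) is the derivative of dpi(W) along V. Let U10 and U01 be the
    matrices whose rows are the images in CTN of the frame fields f_j and of their
    conjugates. Along the leaf through p, for v in the Levi kernel,
      v(U10) = conn10(v) U10   and   v(U01) = iota10(v) U10 + conn01(v) U01
    ([mdir_U10], [mdir_U01]): the (1,0) fields are closed under brackets, and the
    kernel annihilates the Levi form. The block iota10(v) is the matrix of iota(v),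
    so that with the matrix [levi] of the Levi form it determines S^{0,2} and
    S^{0,-2} ([Smat_trueE], [Smat_falseE]). The identifications of the leaf space
    with the Heisenberg algebra at two points of a leaf differ by an explicit matrix
    ([transitionE]); its derivative gives the modified symbol ([iota_modE]): up to
    the scaling element, the block L of iota_phi(v) is the transpose of conn10(v),
    and the requirement that iota_phi(v) be a derivation also expresses L by
    conn01(v) and the derivative of [levi].

    The theorem is then the Jacobi identity. For kernel fields V, W the brackets
    [V, W] and [V, conj W] are again tangent to the leaves, hence are sums of
    elements of the Levi kernel and of its conjugate at each point. Applying the
    first to U01 and the second to U10 and comparing components gives
    ([jacobi_Smx_plus], [jacobi_Smx_minus])
      V(S_W) - W(S_V) + [Omega_V, S_W] - [Omega_W, S_V]   in g_{0,2},
      V(S^-_W) + [Omega_V, S^-_W]                         in g_{0,-2}.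
    The condition on the tensor of type (0,-2) says that V(S^-_W) lies in
    g_{0,-2}, and the symmetry of the tensor of type (0,2) that
    V(S_W) - W(S_V) lies in g_{0,2}. What remains are the two assertions on the
    Omega_alpha. The one on brackets of the modified symbol follows because
    iota_phi(v), hence the (0,2) part of [iota_phi(v), iota_phi(w)], is linear in
    each of v and w ([bracket02_K2]).

    The hypotheses speak of derivatives of functions that are defined on a leaf
    only. Two facts reduce them to ordinary calculus. Every direction in the kernel
    of dpi is the velocity of a curve in the leaf ([level_curve]), so a derivative
    along the leaf may be computed on any differentiable extension
    ([leaf_deriv_K2]). And a function all of whose derivatives along the leaf vanish
    is locally constant on it ([level_const]); applied to the annihilator of the
    image of the CR structure, it shows that this image is the same hyperplane at
    all points of the leaf near p ([leaf_rho]). Both rest on a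
    Lipschitz retraction onto the level sets of a submersion, obtained from the
    contraction principle ([level_retraction]). *)

(** * Differential calculus of real functions on row vectors *)

Section RealCalculus.
Context {R : realType} {N : nat}.
Implicit Types (f : 'rV[R]_N -> R) (x p u v : 'rV[R]_N).

Lemma normv_ge m (w : 'rV[R]_m) j : `|w 0 j| <= `|w|.
Proof. by rewrite [leRHS]/Num.Def.normr /= mx_normrE; apply/bigmax_geP; right; exists (0, j). Qed.

Lemma normv_le m (w : 'rV[R]_m) e : 0 <= e -> (forall j, `|w 0 j| <= e) -> `|w| <= e.
Proof.
move=> e0 H; rewrite [leLHS]/Num.Def.normr /= mx_normrE; apply: bigmax_le => // -[i j] _ /=.
by rewrite ord1.
Qed.

Lemma diff_sum f x v : differentiable f x ->
  'd f x v = \sum_j v 0 j * 'D_(delta_mx 0 j) f x.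
Proof.
move=> df; rewrite {1}[v]row_sum_delta linear_sum; apply: eq_bigr => j _.
by rewrite linearZ /= deriveE.
Qed.

Lemma diff_eps f x (e : R) : differentiable f x -> 0 < e ->
  \forall h \near (0 : 'rV[R]_N), `|f (x + h) - f x - 'd f x h| <= e * `|h|.
Proof.
move=> df e0; have [_ /eqaddoP /(_ e e0)] := (diff_locallyP x f).1 df.
apply: filterS => h /=; rewrite -![(_ + _ : _ -> _) _]/(_ + _) /cst /= /shift /=.
by rewrite opprD addrA [h + x]addrC.
Qed.

Lemma is_derive_line f x v (s : R) : differentiable f (x + s *: v) ->
  is_derive s (1 : R) (fun t => f (x + t *: v)) ('d f (x + s *: v) v).
Proof.
move=> df.
have dd := diff_derivable df (v := v).
rewrite -(deriveE v df).
have E : (fun h : R => h^-1 *: (((fun t => f (x + t *: v)) \o shift s) (h *: (1 : R)) -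
    f (x + s *: v))) =
  (fun h : R => h^-1 *: ((f \o shift (x + s *: v)) (h *: v) - f (x + s *: v))).
  apply/funext => h /=; congr (_ *: (f _ - _)).
  by rewrite [h *: (1 : R)](mulr1 h) scalerDl addrCA.
by split; [rewrite /derivable E|rewrite /derive E].
Qed.

Lemma mvt_segment f p (r : R) (x y : 'rV[R]_N) :
  (forall z : 'rV[R]_N, `|z - p| < r -> differentiable f z) ->
  `|x - p| < r -> `|y - p| < r ->
  exists2 z : 'rV[R]_N, `|z - p| < r & f x - f y = 'd f z (x - y).
Proof.
move=> df xr yr.
have seg (s : R) : 0 <= s -> s <= 1 -> `|y + s *: (x - y) - p| < r.
  move=> s0 s1.
  have -> : y + s *: (x - y) - p = (1 - s) *: (y - p) + s *: (x - p).
    by apply/rowP => j; rewrite !mxE; ring.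
  apply: le_lt_trans (ler_normD _ _) _.
  rewrite !normrZ (ger0_norm s0) ger0_norm ?subr_ge0 //.
  have [->|sn0] := eqVneq s 0; first by rewrite subr0 mul1r mul0r addr0.
  have -> : r = (1 - s) * r + s * r by ring.
  apply: ler_ltD.
    by rewrite ler_wpM2l ?subr_ge0 // ltW.
  by rewrite ltr_pM2l // lt_neqAle eq_sym sn0.
pose g := fun s : R => f (y + s *: (x - y)).
have dg (s : R) : 0 <= s -> s <= 1 ->
    is_derive s (1 : R) g ('d f (y + s *: (x - y)) (x - y)).
  by move=> s0 s1; apply: is_derive_line; apply: df; apply: seg.
have [||s] := @MVT_segment R g (fun s => 'd f (y + s *: (x - y)) (x - y)) 0 1 ler01.
- by move=> s; rewrite in_itv /= => /andP[s0 s1]; apply: dg; exact: ltW.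
- apply: derivable_within_continuous => s; rewrite in_itv /= => /andP[s0 s1].
  by have [] := dg s s0 s1.
- rewrite in_itv /= => /andP[s0 s1]; rewrite subr0 mulr1 /g scale1r scale0r addr0 [y + _]addrC subrK.
move=> E; by exists (y + s *: (x - y)) => //; apply: seg.
Qed.

Lemma near_ballN m (P : 'rV[R]_m -> Prop) (c : 'rV[R]_m) : (\forall z \near c, P z) ->
  exists2 r : R, 0 < r & forall z : 'rV[R]_m, `|z - c| < r -> P z.
Proof.
move=> /nbhs_normP [r /= r0 H]; exists r => // z zr; apply: H => /=.
by rewrite distrC.
Qed.

Lemma ballN_near m (P : 'rV[R]_m -> Prop) (c : 'rV[R]_m) (r : R) : 0 < r ->
  (forall z : 'rV[R]_m, `|z - c| < r -> P z) -> \forall z \near c, P z.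
Proof.
move=> r0 H; apply/nbhs_normP; exists r => //= z zr; apply: H.
by rewrite distrC.
Qed.

Lemma le_refl_min (a b : R) : Num.min a b <= a.
Proof. by rewrite ge_min lexx. Qed.

(** Strict differentiability: this estimate, uniform in both points, is what
    makes the contraction argument below work. *)
Lemma strict_diff f p (e : R) : 0 < e ->
  (\forall x \near p, differentiable f x) ->
  (forall j : 'I_N, {for p, continuous (fun x => 'D_(delta_mx 0 j) f x)}) ->
  exists2 r : R, 0 < r & forall x y : 'rV[R]_N, `|x - p| < r -> `|y - p| < r ->
    `|f x - f y - 'd f p (x - y)| <= e * `|x - y|.
Proof.
move=> e0 /near_ballN [r1 r10 df] cf.
have e10 : 0 < e / N.+1%:R by rewrite divr_gt0.
have /near_ballN [r2 r20 c2] : \forall x \near p, forall j : 'I_N,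
    `|'D_(delta_mx 0 j) f x - 'D_(delta_mx 0 j) f p| <= e / N.+1%:R.
  apply: (@filter_forall _ 'I_N _ _ (nbhs_filter p)) => j; have /cvgrPdist_le := cf j => /(_ _ e10).
  by apply: filterS => x; rewrite distrC.
exists (Num.min r1 r2); first by rewrite lt_min r10 r20.
move=> x y xr yr.
have [z zr ->] := @mvt_segment f p (Num.min r1 r2) x y
  (fun z zr => df z (lt_le_trans zr (le_refl_min r1 r2))) xr yr.
have dz : differentiable f z by apply: df; apply: lt_le_trans zr _; rewrite ge_min lexx.
have dp : differentiable f p by apply: df; rewrite subrr normr0.
have E : 'd f z (x - y) - 'd f p (x - y) =
    \sum_j (x - y) 0 j * ('D_(delta_mx 0 j) f z - 'D_(delta_mx 0 j) f p) :> R.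
  transitivity (\sum_j (x - y) 0 j * 'D_(delta_mx 0 j) f z -
                \sum_j (x - y) 0 j * 'D_(delta_mx 0 j) f p : R).
    by congr (_ - _); exact: diff_sum.
  by rewrite -sumrB; apply: eq_bigr => j _; rewrite mulrBr.
rewrite E; apply: le_trans (ler_norm_sum _ _ _) _.
apply: (@le_trans _ _ (\sum_(j < N) `|x - y| * (e / N.+1%:R))).
  apply: ler_sum => j _; rewrite normrM; apply: ler_pM => //.
    exact: normv_ge.
  by apply: c2; apply: lt_le_trans zr _; rewrite ge_min lexx orbT.
rewrite sumr_const card_ord -mulrnAr mulrC ler_wpM2r // -[X in X <= _]mulr_natr.
by rewrite mulrAC ler_pdivrMr ?ltr0n // ler_wpM2l ?(ltW e0) // ler_nat leqnSn.
Qed.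

(** Second difference quotient: applying the mean value theorem first in the
    direction [u] shows that it tends to the iterated derivative. *)
Lemma second_difference f x u v (e : R) : 0 < e ->
  (\forall y \near x, differentiable f y) ->
  differentiable (fun y => 'D_u f y) x ->
  \forall t \near (0 : R), 0 < t ->
   `|f (x + t *: u + t *: v) - f (x + t *: u) - f (x + t *: v) + f x
       - t ^+ 2 * 'D_v (fun y => 'D_u f y) x| <= e * t ^+ 2.
Proof.
move=> e0 /near_ballN [r1 r10 df] dg.
pose L := 2 * `|u| + `|v| + 1.
have L0 : 0 < L by rewrite /L; have := normr_ge0 u; have := normr_ge0 v; lra.
have eL0 : 0 < e / L by rewrite divr_gt0.
have /near_ballN [r2 r20 Hg] := diff_eps dg eL0.
have dr : 0 < Num.min r1 r2 / L by rewrite divr_gt0 // lt_min r10.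
apply/nbhs_normP; exists (Num.min r1 r2 / L) => // t /=; rewrite sub0r normrN => tr t0.
rewrite gtr0_norm // ltr_pdivlMr // in tr.
have small (a b : R) : 0 <= a -> a <= t -> 0 <= b -> b <= t ->
    `|a *: u + b *: v| <= t * (`|u| + `|v|).
  move=> a0 at_ b0 bt; apply: le_trans (ler_normD _ _) _.
  rewrite !normrZ !ger0_norm // mulrDr lerD // ler_wpM2r //.
have smallr (a b : R) : 0 <= a -> a <= t -> 0 <= b -> b <= t ->
    `|a *: u + b *: v| < Num.min r1 r2.
  move=> a0 at_ b0 bt; apply: le_lt_trans (small a b a0 at_ b0 bt) _.
  apply: le_lt_trans tr; rewrite ler_wpM2l ?ltW // /L.
  by have := normr_ge0 u; lra.
have small1 a b (a0 : 0 <= a) (at_ : a <= t) (b0 : 0 <= b) (bt : b <= t) :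
    `|a *: u + b *: v| < r1.
  by apply: lt_le_trans (smallr a b a0 at_ b0 bt) _; rewrite ge_min lexx.
have small2 a b (a0 : 0 <= a) (at_ : a <= t) (b0 : 0 <= b) (bt : b <= t) :
    `|a *: u + b *: v - 0| < r2.
  by rewrite subr0; apply: lt_le_trans (smallr a b a0 at_ b0 bt) _; rewrite ge_min lexx orbT.
have dfab a b (a0 : 0 <= a) (at_ : a <= t) (b0 : 0 <= b) (bt : b <= t) :
    differentiable f (x + b *: v + a *: u).
  apply: df; have -> : x + b *: v + a *: u - x = a *: u + b *: v.
    by apply/rowP => j; rewrite !mxE; ring.
  exact: small1.
pose phi := fun s : R => f (x + t *: v + s *: u) - f (x + 0 *: v + s *: u).
have dphi (s : R) : 0 <= s -> s <= t -> is_derive s (1 : R) phi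
    ('D_u f (x + t *: v + s *: u) - 'D_u f (x + 0 *: v + s *: u)).
  move=> s0 st; rewrite !deriveE; [|apply: dfab => //; exact: ltW..].
  by apply: is_deriveB; apply: is_derive_line; apply: dfab => //; exact: ltW.
have [||s] := @MVT_segment R phi
   (fun s => 'D_u f (x + t *: v + s *: u) - 'D_u f (x + 0 *: v + s *: u)) 0 t (ltW t0).
- by move=> s; rewrite in_itv /= => /andP[s0 s1]; apply: dphi; exact: ltW.
- apply: derivable_within_continuous => s; rewrite in_itv /= => /andP[s0 s1].
  by have [] := dphi s s0 s1.
rewrite in_itv /= => /andP[s0 s1]; rewrite subr0 /phi !scale0r !addr0 => E.
have -> : f (x + t *: u + t *: v) - f (x + t *: u) - f (x + t *: v) + f x =
    f (x + t *: v + t *: u) - f (x + t *: u) - (f (x + t *: v) - f x).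
  by rewrite -[x + t *: u + _]addrA [t *: u + _]addrC addrA; ring.
rewrite E.
have -> : x + t *: v + s *: u = x + (s *: u + t *: v) by rewrite -addrA [t *: v + _]addrC.
have H1 := Hg _ (small2 s t s0 s1 (ltW t0) (lexx _)).
have H2 := Hg _ (small2 s 0 s0 s1 (lexx _) (ltW t0)).
rewrite scale0r addr0 in H2.
have B1 := small s t s0 s1 (ltW t0) (lexx _).
have B2 := small s 0 s0 s1 (lexx _) (ltW t0).
rewrite scale0r addr0 in B2.
have B2' : `|s *: u| <= t * `|u| by rewrite normrZ ger0_norm // ler_wpM2r.
rewrite (deriveE v dg); set D := 'd _ x v.
have lD : 'd (fun y => 'D_u f y) x (s *: u + t *: v) = 'd (fun y => 'D_u f y) x (s *: u) + t * D.
  by rewrite linearD [X in _ + X]linearZ.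
rewrite lD in H1; move: H1 H2.
set A := 'D_u f (x + (s *: u + t *: v)); set B := 'D_u f (x + s *: u).
set D0 := 'D_u f x; set D1 := 'd _ x (s *: u) => H1 H2.
have -> : (A - B) * t - t ^+ 2 * D =
   t * ((A - D0 - (D1 + t * D)) - (B - D0 - D1)) by ring.
rewrite normrM gtr0_norm // expr2 mulrCA ler_wpM2l ?(ltW t0) //.
apply: le_trans (ler_normB _ _) _; apply: le_trans (lerD H1 H2) _.
rewrite -mulrDr -mulrA ler_wpM2l ?(ltW e0) // mulrC ler_pdivrMr //.
apply: le_trans (lerD B1 B2') _.
by rewrite -mulrDr ler_wpM2l ?(ltW t0) // /L; lra.
Qed.

Lemma cancel_differences (A B C D X Y t2 e : R) : 0 < t2 ->
  `|A - B - C + D - t2 * X| <= e / 2 * t2 ->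
  `|A - C - B + D - t2 * Y| <= e / 2 * t2 -> `|X - Y| <= e.
Proof.
move=> p2 h1 h2; rewrite -(ler_pM2l p2) -[X in X * `|_|](gtr0_norm p2) -normrM mulrBr.
have -> : t2 * X - t2 * Y =
  (A - C - B + D - t2 * Y) - (A - B - C + D - t2 * X) by ring.
apply: le_trans (ler_normB _ _) _; apply: le_trans (lerD h2 h1) _.
by rewrite -mulrDl -splitr mulrC.
Qed.

(** Both iterated derivatives are the limit of the same second difference
    quotient. *)
Lemma schwarz f x u v :
  (\forall y \near x, differentiable f y) ->
  differentiable (fun y => 'D_u f y) x -> differentiable (fun y => 'D_v f y) x ->
  'D_v (fun y => 'D_u f y) x = 'D_u (fun y => 'D_v f y) x.
Proof.
move=> df du dv; apply/eqP; rewrite -subr_eq0 -normr_le0; apply/ler_addgt0Pl => e e0.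
set Dvu := 'D_v _ x; set Duv := 'D_u _ x; rewrite addr0.
have e20 : 0 < e / 2 by rewrite divr_gt0.
have /nbhs_normP [r1 /= r10 H1] := second_difference v e20 df du.
have /nbhs_normP [r2 /= r20 H2] := second_difference u e20 df dv.
pose t := Num.min r1 r2 / 2.
have m0 : 0 < Num.min r1 r2 by rewrite lt_min r10.
have t0 : 0 < t by rewrite divr_gt0.
have tm : t < Num.min r1 r2 by rewrite /t; lra.
have [tr1 tr2] : t < r1 /\ t < r2 by move: tm; rewrite lt_min => /andP.
have := H1 t; rewrite /= sub0r normrN gtr0_norm // => /(_ tr1 t0) {}H1.
have := H2 t; rewrite /= sub0r normrN gtr0_norm // => /(_ tr2 t0) {}H2.
have t20 : 0 < t ^+ 2 by rewrite exprn_gt0.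
apply: cancel_differences t20 H1 _; move: H2.
by rewrite -[x + t *: v + _]addrA [t *: v + _]addrC addrA.
Qed.

End RealCalculus.

(** * Level sets of a submersion *)

(** The contraction principle is applied on row vectors. *)
HB.instance Definition _ (R : realType) (d : nat) := Complete.on 'rV[R]_d.

Lemma mulmx_lip (R : realType) (d N : nat) (A : 'M[R]_(d, N)) :
  exists2 a : R, 0 < a & forall k : 'rV_d, `|k *m A| <= a * `|k|.
Proof.
pose a : R := \sum_i \sum_j `|A i j| + 1.
have s0 : 0 <= \sum_i \sum_j `|A i j| by apply: sumr_ge0 => i _; apply: sumr_ge0.
have a0 : 0 < a by rewrite /a ltr_pwDr.
exists a => // k; apply: normv_le => [|j]; first by rewrite mulr_ge0 ?(ltW a0).
rewrite mxE; apply: le_trans (ler_norm_sum _ _ _) _.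
apply: (@le_trans _ _ ((\sum_i \sum_j `|A i j|) * `|k|)); last first.
  by rewrite ler_wpM2r // /a lerDl.
rewrite mulr_suml; apply: ler_sum => i _; rewrite normrM mulrC ler_pM //.
  by rewrite (bigD1 j) //= lerDl sumr_ge0.
exact: normv_ge.
Qed.

Section LevelSets.
Context {R : realType} {N d : nat}.
Variables (P : 'rV[R]_N -> 'rV[R]_d) (p : 'rV[R]_N) (A : 'M[R]_(d, N)).

Definition Dmap (x v : 'rV[R]_N) : 'rV[R]_d := \row_k 'd (fun y => P y 0 k) x v.

Hypothesis dP : \forall x \near p, forall k, differentiable (fun y => P y 0 k) x.
Hypothesis cP : forall k j, {for p, continuous (fun x => 'D_(delta_mx 0 j) (fun y => P y 0 k) x)}.
Hypothesis DA : forall k, Dmap p (k *m A) = k.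

Lemma Dmap_lin x : exists J : 'M[R]_(N, d),
  (forall k, differentiable (fun y => P y 0 k) x) -> forall v, Dmap x v = v *m J.
Proof.
exists (\matrix_(j, k) 'D_(delta_mx 0 j) (fun y => P y 0 k) x) => dk v.
apply/rowP => k; rewrite !mxE; have -> := diff_sum v (dk k).
by apply: eq_bigr => j _; rewrite mxE.
Qed.

Lemma strict_map (e : R) : 0 < e -> exists2 r : R, 0 < r &
  forall x y : 'rV[R]_N, `|x - p| < r -> `|y - p| < r ->
    `|P x - P y - Dmap p (x - y)| <= e * `|x - y|.
Proof.
move=> e0.
have H (k : 'I_d) : exists r : R, 0 < r /\
    forall x y : 'rV[R]_N, `|x - p| < r -> `|y - p| < r ->
    `|P x 0 k - P y 0 k - 'd (fun y => P y 0 k) p (x - y)| <= e * `|x - y|.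
  have [] := @strict_diff R N (fun y => P y 0 k) p e e0.
  - by move: dP; apply: filterS.
  - exact: cP.
  - by move=> r r0 Hr; exists r.
have [r Hr] := choice H.
exists (\big[Num.min/1]_k r k).
  by apply: (@big_ind R (fun z => 0 < z)) => // [a b a0 b0|k _]; [rewrite lt_min a0|case: (Hr k)].
move=> x y xr yr; apply: normv_le => [|k]; first by rewrite mulr_ge0 // ltW.
have rk : \big[Num.min/1]_k r k <= r k by exact: bigmin_le_cond.
rewrite !mxE; apply: (Hr k).2.
  exact: lt_le_trans rk.
exact: lt_le_trans rk.
Qed.

(** Quantitative implicit function theorem: near [p] there is a Lipschitz
    retraction onto the level set through [p].  The correction [k *m A] of a point
    [x] is the fixed point of a contraction. *)
Lemma level_retraction : exists (rho : 'rV[R]_N -> 'rV[R]_N) (r C : R),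
  [/\ 0 < r, 0 < C,
   forall x : 'rV[R]_N, `|x - p| < r -> P (rho x) = P p /\ `|rho x - x| <= C * `|P x - P p| &
   forall x y : 'rV[R]_N, `|x - p| < r -> `|y - p| < r -> `|rho x - rho y| <= C * `|x - y| ].
Proof.
have [a a0 Ha] := mulmx_lip A.
have dPp : forall k, differentiable (fun y => P y 0 k) p by exact: nbhs_singleton dP.
have [J HJ] := Dmap_lin p; have {}HJ := HJ dPp.
have [b b0 Hb] := mulmx_lip J.
have e0 : 0 < (2 * a)^-1 by rewrite invr_gt0 mulr_gt0.
have [r1 r10 Hr] := strict_map e0.
set e := (2 * a)^-1 in e0 Hr.
have ea : e * a = 2^-1 by rewrite /e invfM -mulrA mulVf ?mulr1 // gt_eqF.
(* as A inverts the differential at p, k - P (x + k A) contracts in k, uniformly in x *)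
have est (x y : 'rV[R]_N) (k l : 'rV[R]_d) : `|x + k *m A - p| < r1 -> `|y + l *m A - p| < r1 ->
    `|(k - l) - (P (x + k *m A) - P (y + l *m A))| <= (b + e) * `|x - y| + 2^-1 * `|k - l|.
  move=> xr yr; have := Hr _ _ xr yr.
  have -> : x + k *m A - (y + l *m A) = x - y + (k - l) *m A.
    by rewrite mulmxBl opprD addrACA.
  have -> : Dmap p (x - y + (k - l) *m A) = Dmap p (x - y) + (k - l).
    by rewrite HJ mulmxDl -!HJ DA.
  set Q := P _ - P _ => h.
  have -> : (k - l) - Q = - (Q - (Dmap p (x - y) + (k - l))) - Dmap p (x - y).
    by apply/rowP => i; rewrite !mxE; ring.
  apply: le_trans (ler_normB _ _) _; rewrite normrN.
  have h2 : `|Dmap p (x - y)| <= b * `|x - y| by rewrite HJ.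
  apply: le_trans (lerD h h2) _.
  have h3 : `|x - y + (k - l) *m A| <= `|x - y| + a * `|k - l|.
    by apply: le_trans (ler_normD _ _) _; rewrite lerD2l.
  have h4 : e * `|x - y + (k - l) *m A| <= e * (`|x - y| + a * `|k - l|).
    by rewrite ler_wpM2l ?(ltW e0).
  apply: le_trans (lerD h4 (lexx _)) _.
  by rewrite mulrDr mulrA ea; lra.
pose r := r1 / (1 + 2 * a * (b + e)).
have D0 : 0 < 1 + 2 * a * (b + e) by rewrite ltr_wpDr // mulr_ge0 ?mulr_ge0 ?addr_ge0 // ltW.
have r0 : 0 < r by rewrite divr_gt0.
have rr1 : r <= r1.
  by rewrite /r ler_pdivrMr // ler_peMr ?(ltW r10) // lerDl mulr_ge0 ?mulr_ge0 ?addr_ge0 // ltW.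
have Pb (x : 'rV[R]_N) : `|x - p| < r -> `|P x - P p| <= (b + e) * `|x - p|.
  move=> xr; have pp : `|p - p| < r1 by rewrite subrr normr0.
  have := Hr _ _ (lt_le_trans xr rr1) pp => h.
  rewrite -[P x - P p](subrK (Dmap p (x - p))); apply: le_trans (ler_normD _ _) _.
  rewrite mulrDl addrC lerD //; by rewrite HJ.
have inball (x : 'rV[R]_N) (k : 'rV[R]_d) : `|x - p| < r -> `|k| <= 2 * `|P x - P p| ->
    `|x + k *m A - p| < r1.
  move=> xr kr; rewrite addrAC; apply: le_lt_trans (ler_normD _ _) _.
  apply: (@le_lt_trans _ _ (`|x - p| * (1 + 2 * a * (b + e)))); last first.
    by rewrite -ltr_pdivlMr.
  rewrite mulrDr mulr1 lerD2l; apply: le_trans (Ha k) _.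
  apply: (@le_trans _ _ (a * (2 * `|P x - P p|))); first by rewrite ler_wpM2l ?(ltW a0).
  apply: (@le_trans _ _ (a * (2 * ((b + e) * `|x - p|)))).
    by rewrite ler_wpM2l ?(ltW a0) // ler_wpM2l // Pb.
  by rewrite le_eqVlt; apply/orP; left; apply/eqP; ring.
have sol (x : 'rV[R]_N) : exists k : 'rV[R]_d, `|x - p| < r ->
    `|k| <= 2 * `|P x - P p| /\ P (x + k *m A) = P p.
  have [xr|xr] := boolP (`|x - p| < r); last by exists 0.
  pose U : set 'rV[R]_d := [set k | `|k| <= 2 * `|P x - P p|].
  pose G (k : 'rV[R]_d) := k - (P (x + k *m A) - P p).
  have Glip k l : U k -> U l -> `|G k - G l| <= 2^-1 * `|k - l|.
    move=> Uk Ul; have := est x x k l (inball x k xr Uk) (inball x l xr Ul).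
    rewrite subrr normr0 mulr0 add0r; apply: le_trans.
    by rewrite le_eqVlt; apply/orP; left; apply/eqP; congr `|_|; rewrite /G;
       apply/rowP => i; rewrite !mxE; ring.
  have U0 : U 0 by rewrite /U /= normr0 mulr_ge0.
  have GU : {homo G : k / U k >-> U k}.
    move=> k Uk; rewrite /U /=.
    have -> : G k = (G k - G 0) + G 0 by rewrite subrK.
    apply: le_trans (ler_normD _ _) _.
    have h1 := Glip k 0 Uk U0; rewrite subr0 in h1.
    have h2 : `|G 0| = `|P x - P p| by rewrite /G mul0mx addr0 sub0r normrN.
    rewrite h2; move: Uk; rewrite /U /= => Uk.
    by lra.
  have [|||k Uk Gk] := @banach_fixed_point R 'rV[R]_d U (mkfun_fun GU).
  - have h0 : (0 : R) <= 2^-1 by [].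
    exists (NngNum h0); split => /=; first by lra.
    by move=> [k l] [/= Uk Ul]; apply: Glip.
  - apply: (@preimage_closed _ _ (fun k : 'rV[R]_d => `|k|) [set y | y <= _]) => [k _|].
      exact: norm_continuous.
    exact: closed_le.
  - by exists 0.
  exists k => _; split => //; move: Gk; rewrite /= /mkfun /G => /eqP.
  by rewrite -subr_eq0 opprB addrCA subrr addr0 subr_eq0 => /eqP.
have [kap Hk] := choice sol.
exists (fun x => x + kap x *m A), r, (2 * a + (1 + a * (2 * (b + e)))).
have C2 : 0 <= a * (2 * (b + e)) by rewrite !mulr_ge0 ?addr_ge0 ?(ltW a0) ?(ltW b0) ?(ltW e0).
split => //.
- by have := a0; lra.
- move=> x xr; have [h1 h2] := Hk x xr; split => //.
  rewrite addrC addKr; apply: le_trans (Ha _) _.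
  apply: (@le_trans _ _ (a * (2 * `|P x - P p|))); first by rewrite ler_wpM2l ?(ltW a0).
  have -> : a * (2 * `|P x - P p|) = 2 * a * `|P x - P p| by ring.
  by rewrite ler_wpM2r // lerDl addr_ge0.
- move=> x y xr yr; have [h1 h2] := Hk x xr; have [h3 h4] := Hk y yr.
  have := est x y (kap x) (kap y) (inball _ _ xr h1) (inball _ _ yr h3).
  rewrite h2 h4 subrr subr0 => h5.
  have h6 : `|kap x - kap y| <= 2 * (b + e) * `|x - y| by lra.
  have -> : x + kap x *m A - (y + kap y *m A) = x - y + (kap x - kap y) *m A.
    by rewrite mulmxBl opprD addrACA.
  apply: le_trans (ler_normD _ _) _.
  apply: (@le_trans _ _ (`|x - y| + a * (2 * (b + e) * `|x - y|))).
    rewrite lerD2l; apply: le_trans (Ha _) _; by rewrite ler_wpM2l ?(ltW a0).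
  rewrite [X in _ <= X]mulrDl -[X in X <= _]add0r lerD //; first by rewrite mulr_ge0 ?mulr_ge0 ?(ltW a0).
  have -> : `|x - y| + a * (2 * (b + e) * `|x - y|) =
    (1 + a * (2 * (b + e))) * `|x - y| by ring.
  exact: lexx.
Qed.

(** Retract the straight line with velocity v: its distance to the level set is
    negligible to first order. *)
Lemma level_curve (v : 'rV[R]_N) : Dmap p v = 0 ->
  exists c : R -> 'rV[R]_N, [/\ c 0 = p, \forall t \near (0 : R), P (c t) = P p &
    is_derive (0 : R) (1 : R) c v].
Proof.
move=> Dv; have [rho [r [C [r0 C0 rhoP _]]]] := level_retraction.
have rhop : rho p = p.
  have [] := rhoP p; first by rewrite subrr normr0.
  by move=> _; rewrite subrr normr0 mulr0 normr_le0 subr_eq0 => /eqP.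
have v1 : 0 < `|v| + 1 by rewrite ltr_pwDr.
have near_r (s : R) : 0 < s -> \forall t \near (0 : R), `|p + t *: v - p| < s.
  move=> s0; apply/nbhs_normP; exists (s / (`|v| + 1)) => /=; first by rewrite divr_gt0.
  move=> t /=; rewrite sub0r normrN ltr_pdivlMr // [p + _]addrC addrK normrZ; apply: le_lt_trans.
  by rewrite ler_wpM2l // lerDl.
exists (fun t => rho (p + t *: v)); split.
- by rewrite scale0r addr0.
- by apply: filterS (near_r r r0) => t tr; case: (rhoP _ tr).
suff cv : (fun h : R => h^-1 *: (((fun t => rho (p + t *: v)) \o shift 0) (h *: (1 : R)) -
    rho (p + 0 *: v))) @ 0^' --> v.
  by split; [apply/cvg_ex; exists v|apply: cvg_lim].
apply/cvgrPdist_le => e e0.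
have e10 : 0 < e / (C * (`|v| + 1)) by rewrite divr_gt0 // mulr_gt0.
have [r1 r10 Hr1] := strict_map e10.
have nr : \forall t \near (0 : R)^', `|p + t *: v - p| < r /\ `|p + t *: v - p| < r1.
  apply: nbhs_dnbhs; near=> t; split; near: t; exact: near_r.
have n0 : \forall t \near (0 : R)^', t != 0 by exact: nbhs_dnbhs_neq.
apply: filterS2 nr n0 => h [hr hr1] h0.
rewrite /= /shift /= addr0 [h *: (1 : R)](mulr1 h) scale0r addr0 rhop.
have [_ hb] := rhoP _ hr.
have -> : v - h^-1 *: (rho (p + h *: v) - p) = - (h^-1 *: (rho (p + h *: v) - (p + h *: v))).
  by apply/rowP => i; rewrite !mxE; field.
rewrite normrN normrZ normfV ler_pdivrMl ?normr_gt0 //.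
apply: le_trans hb _.
have pp : `|p - p| < r1 by rewrite subrr normr0.
have := Hr1 _ _ hr1 pp; rewrite [p + _ - p]addrC addKr.
have -> : Dmap p (h *: v) = 0.
  apply/rowP => k; rewrite !mxE linearZ /=; move/rowP/(_ k): Dv; rewrite !mxE => ->.
  exact: mulr0.
rewrite subr0 normrZ => hb2.
apply: le_trans (_ : C * (e / (C * (`|v| + 1)) * (`|h| * `|v|)) <= _).
  by rewrite ler_wpM2l ?(ltW C0).
have -> : C * (e / (C * (`|v| + 1)) * (`|h| * `|v|)) = (`|h| * e) * (`|v| / (`|v| + 1)).
  by field; rewrite !gt_eqF.
rewrite ler_piMr ?mulr_ge0 ?(ltW e0) // ler_pdivrMr // mul1r lerDl.
exact: ler01.
Unshelve. all: by end_near. Qed.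

(** The point y is joined to p by the retraction of a segment.  This curve is merely
    Lipschitz, but its increments are tangent to the level set up to negligible terms,
    so [lam] is differentiable along it with derivative zero. *)
Lemma level_const (lam : 'rV[R]_N -> R) (r0 : R) : 0 < r0 ->
  (forall y : 'rV[R]_N, `|y - p| < r0 -> P y = P p ->
    [/\ differentiable lam y, forall k, differentiable (fun z => P z 0 k) y,
     exists A' : 'M[R]_(d, N), forall k, Dmap y (k *m A') = k &
     forall v, Dmap y v = 0 -> 'd lam y v = 0]) ->
  exists2 r : R, 0 < r & forall y : 'rV[R]_N, `|y - p| < r -> P y = P p -> lam y = lam p.
Proof.
move=> r00 Hlam; have [rho [r1 [C [r10 C0 rhoP rhoL]]]] := level_retraction.
have rhoE (x : 'rV[R]_N) : `|x - p| < r1 -> P x = P p -> rho x = x.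
  move=> xr Px; have [_] := rhoP x xr.
  by rewrite Px subrr normr0 mulr0 normr_le0 subr_eq0 => /eqP.
have pr : `|p - p| < r1 by rewrite subrr normr0.
pose r := Num.min (r1 / 2) (r0 / C).
have r_0 : 0 < r by rewrite lt_min !divr_gt0.
exists r => // y; rewrite lt_min => /andP[yr1 yr0] Py.
(* beyond [0, 1], so that the derivatives at the end points are two-sided *)
have xin (t : R) : -1 < t < 2 -> `|p + t *: (y - p) - p| < r1.
  move=> /andP[t1 t2]; rewrite [p + _]addrC addrK normrZ.
  have : `|t| <= 2 by rewrite ler_norml; lra.
  move=> tt; apply: le_lt_trans (_ : 2 * `|y - p| < _); first by rewrite ler_wpM2r.
  by rewrite mulrC -ltr_pdivlMr.
pose c t := rho (p + t *: (y - p)).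
have cL (s t : R) : -1 < s < 2 -> -1 < t < 2 -> `|c s - c t| <= C * `|y - p| * `|s - t|.
  move=> hs ht; apply: le_trans (rhoL _ _ (xin s hs) (xin t ht)) _.
  have -> : p + s *: (y - p) - (p + t *: (y - p)) = (s - t) *: (y - p).
    by rewrite opprD addrACA subrr add0r -scalerBl.
  by rewrite normrZ -mulrA [`|y - p| * _]mulrC.
have cP' (t : R) : -1 < t < 2 -> P (c t) = P p by move=> ht; case: (rhoP _ (xin t ht)).
have c0 : c 0 = p by rewrite /c scale0r addr0 rhoE.
have c1 : c 1 = y.
  rewrite /c scale1r addrC subrK rhoE //; apply: lt_le_trans yr1 _.
  by rewrite ler_pdivrMr // ler_peMr ?(ltW r10) //; lra.
have cin (t : R) : 0 <= t <= 1 -> `|c t - p| < r0.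
  move=> /andP[t0 t1]; rewrite -{1}c0; apply: le_lt_trans (cL _ _ _ _) _; [lra..|].
  rewrite subr0 ger0_norm //; apply: le_lt_trans (_ : C * `|y - p| < _).
    by rewrite ler_piMr // mulr_ge0 ?(ltW C0).
  by rewrite mulrC -ltr_pdivlMr.
have dmu (t : R) : 0 <= t <= 1 -> is_derive t (1 : R) (fun s => lam (c s)) 0.
  move=> ht; have ht' : -1 < t < 2 by move: ht; lra.
  have [dl dPk [A' HA'] ker] := Hlam _ (cin t ht) (cP' t ht').
  pose G : 'cV[R]_N := \col_j 'D_(delta_mx 0 j) lam (c t).
  have HG v : 'd lam (c t) v = (v *m G) 0 0.
    by have -> := diff_sum v dl; rewrite mxE; apply: eq_bigr => j _; rewrite mxE.
  have [L L0 HL] := mulmx_lip (A' *m G).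
  have [J HJ] := Dmap_lin (c t); have {}HJ := HJ dPk.
  have dlam w : 'd lam (c t) w = (Dmap (c t) w *m (A' *m G)) 0 0.
    apply/eqP; rewrite mulmxA -HG -subr_eq0.
    have -> : 'd lam (c t) w - 'd lam (c t) (Dmap (c t) w *m A') =
      'd lam (c t) (w - Dmap (c t) w *m A') by rewrite linearB.
    by apply/eqP; apply: ker; rewrite HJ mulmxBl -!HJ HA' subrr.
  suff cv : (fun h : R => h^-1 *: (((fun s => lam (c s)) \o shift t) (h *: (1 : R)) -
      lam (c t))) @ 0^' --> (0 : R).
    by split; [apply/cvg_ex; exists 0|apply: cvg_lim].
  apply/cvgrPdist_le => e e0.
  pose K := C * `|y - p| + 1.
  have K0 : 0 < K by rewrite /K ltr_wpDl // mulr_ge0 // ltW.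
  have e10 : 0 < e / (K * (1 + L)) by rewrite divr_gt0 // mulr_gt0 // addr_gt0.
  set e1 := e / _ in e10.
  have n1 := diff_eps dl e10.
  have n2 : \forall w \near (0 : 'rV[R]_N), forall k : 'I_d,
     `|P (c t + w) 0 k - P (c t) 0 k - 'd (fun z => P z 0 k) (c t) w| <= e1 * `|w|.
    by apply: (@filter_forall _ 'I_d _ _ (nbhs_filter (0 : 'rV[R]_N))) => k; apply: diff_eps.
  have [s s0 Hs] := near_ballN (filterI n1 n2).
  apply: nbhs_dnbhs; apply/nbhs_normP; exists (Num.min (s / K) (Num.min (t + 1) (2 - t))) => /=.
    by rewrite !lt_min divr_gt0 //=; move: ht'; lra.
  move=> h /=; rewrite sub0r normrN !lt_min => /and3P[hs h1 h2].
  rewrite sub0r normrN [h *: (1 : R)](mulr1 h) /shift /=.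
  have ht1 : -1 < h + t < 2 by move: h1 h2; rewrite !ltr_norml; lra.
  pose w := c (h + t) - c t.
  have wK : `|w| <= K * `|h|.
    have := cL _ _ ht1 ht'; rewrite addrK => /le_trans; apply.
    by rewrite ler_wpM2r // /K lerDl.
  have ws : `|w - 0| < s.
    by rewrite subr0; apply: le_lt_trans wK _; rewrite mulrC -ltr_pdivlMr.
  have [l1 l2] := Hs w ws.
  have cw : c t + w = c (h + t) by rewrite /w addrC subrK.
  rewrite cw in l1 l2.
  have D1 : `|Dmap (c t) w| <= e1 * `|w|.
    apply: normv_le => [|k]; first by rewrite mulr_ge0 // ltW.
    have := l2 k; rewrite cP' // cP' // subrr sub0r normrN => h3.
    by rewrite mxE.
  have D2 : `|'d lam (c t) w| <= L * (e1 * `|w|).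
    rewrite dlam; apply: le_trans (normv_ge _ _) _; apply: le_trans (HL _) _.
    by rewrite ler_wpM2l // ltW.
  have D3 : `|lam (c (h + t)) - lam (c t)| <= e1 * `|w| + L * (e1 * `|w|).
    rewrite -[lam _ - _](subrK ('d lam (c t) w)); apply: le_trans (ler_normD _ _) _.
    exact: lerD.
  rewrite normrZ; have [->|hn0] := eqVneq h 0; first by rewrite invr0 normr0 mul0r ltW.
  rewrite normfV ler_pdivrMl ?normr_gt0 //; apply: le_trans D3 _.
  have -> : e1 * `|w| + L * (e1 * `|w|) = e1 * (1 + L) * `|w| by ring.
  apply: le_trans (_ : e1 * (1 + L) * (K * `|h|) <= _).
    by rewrite ler_wpM2l // mulr_ge0 ?addr_ge0 // ltW.
  rewrite le_eqVlt; apply/orP; left; apply/eqP; rewrite /e1; field.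
  by rewrite !gt_eqF // addr_gt0.
have [||t _] := @MVT_segment R (fun s => lam (c s)) (fun=> 0) 0 1 ler01.
- by move=> t; rewrite in_itv /= => /andP[t0 t1]; apply: dmu; rewrite !ltW.
- apply: derivable_within_continuous => t; rewrite in_itv /= => ht.
  by have [] := dmu t ht.
by rewrite c0 c1 mul0r => /eqP; rewrite subr_eq0 => /eqP.
Qed.

End LevelSets.

(** * Complex-valued functions of real variables *)

Section ComplexCalculus.
Context {R : realType} {N : nat}.
Local Notation C := R[i].
Implicit Types (f g : 'rV[R]_N -> C) (x v : 'rV[R]_N) (X Y : 'rV[C]_N).

Definition cdiff f x : Prop :=
  differentiable (fun y => complex.Re (f y)) x /\
  differentiable (fun y => complex.Im (f y)) x.

Lemma near_eq_differentiable (f g : 'rV[R]_N -> R) x :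
  (\forall y \near x, f y = g y) -> differentiable f x -> differentiable g x.
Proof.
move=> fg df; have [dc /eqaddoP ho] := (diff_locallyP x f).1 df.
have E : g \o shift x = cst (g x) + 'd f x +o_ (0 : 'rV[R]_N) id.
  apply/eqaddoP => e e0; have := ho e e0.
  have fg' : \forall h \near (0 : 'rV[R]_N), f (h + x) = g (h + x).
    have [r r0 Hr] := near_ballN fg; apply: (ballN_near r0) => h; rewrite subr0 => hr.
    by apply: Hr; rewrite addrK.
  apply: filterS2 fg' => h /= e1; rewrite -![(_ + _ : _ -> _) _]/(_ + _) /cst /= /shift /=.
  by rewrite -e1 -(nbhs_singleton fg).
apply/diff_locallyP; split; first by rewrite (diff_unique dc E).
by rewrite (diff_unique dc E).
Qed.

Lemma near_eq_cdiff f g x : (\forall y \near x, f y = g y) -> cdiff f x -> cdiff g x.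
Proof.
move=> fg [d1 d2]; split; [apply: near_eq_differentiable d1|apply: near_eq_differentiable d2];
  by apply: filterS fg => y ->.
Qed.

Lemma near_eq_cpartial f g x j : (\forall y \near x, f y = g y) -> cpartial f x j = cpartial g x j.
Proof.
by move=> fg; rewrite /cpartial; congr (_ +i* _); apply: near_eq_derive; apply: filterS fg => y ->.
Qed.

Lemma near_eq_dir f g x X : (\forall y \near x, f y = g y) -> dir f x X = dir g x X.
Proof. by move=> fg; apply: eq_bigr => j _; rewrite (near_eq_cpartial j fg). Qed.

Lemma cdiff_cst (c : C) x : cdiff (fun=> c) x.
Proof. by split; apply: differentiable_cst. Qed.

Lemma cdiffD f g x : cdiff f x -> cdiff g x -> cdiff (fun y => f y + g y) x.
Proof.
move=> [f1 f2] [g1 g2]; split.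
  rewrite (_ : (fun y => _) = (fun y => complex.Re (f y)) + (fun y => complex.Re (g y))).
    exact: differentiableD.
  by apply/funext => y; rewrite raddfD.
rewrite (_ : (fun y => _) = (fun y => complex.Im (f y)) + (fun y => complex.Im (g y))).
  exact: differentiableD.
by apply/funext => y; rewrite raddfD.
Qed.

Lemma ReM (a b : C) : complex.Re (a * b) = complex.Re a * complex.Re b - complex.Im a * complex.Im b.
Proof. by case: a b => [a1 a2] [b1 b2]. Qed.
Lemma ImM (a b : C) : complex.Im (a * b) = complex.Re a * complex.Im b + complex.Im a * complex.Re b.
Proof. by case: a b => [a1 a2] [b1 b2]. Qed.

Lemma cdiffM f g x : cdiff f x -> cdiff g x -> cdiff (fun y => f y * g y) x.
Proof.
move=> [f1 f2] [g1 g2]; split.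
  rewrite (_ : (fun y => _) = (fun y => complex.Re (f y)) * (fun y => complex.Re (g y))
     - (fun y => complex.Im (f y)) * (fun y => complex.Im (g y))).
    by apply: differentiableB; apply: differentiableM.
  by apply/funext => y; rewrite ReM.
rewrite (_ : (fun y => _) = (fun y => complex.Re (f y)) * (fun y => complex.Im (g y))
     + (fun y => complex.Im (f y)) * (fun y => complex.Re (g y))).
  by apply: differentiableD; apply: differentiableM.
by apply/funext => y; rewrite ImM.
Qed.

Lemma cdiff_conj f x : cdiff f x -> cdiff (fun y => (f y)^*) x.
Proof.
move=> [f1 f2]; split.
  by rewrite (_ : (fun y => _) = (fun y => complex.Re (f y))) //; apply/funext => y; case: (f y).
rewrite (_ : (fun y => _) = - (fun y => complex.Im (f y))); first exact: differentiableN.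
by apply/funext => y; rewrite -[(- _ : _ -> _) _]/(- _); case: (f y).
Qed.

Lemma cdiffN f x : cdiff f x -> cdiff (fun y => - f y) x.
Proof.
move=> df; rewrite (_ : (fun y => _) = (fun y => -1 * f y)).
  by apply: cdiffM => //; apply: cdiff_cst.
by apply/funext => y; rewrite mulN1r.
Qed.

Lemma cdiff_sum (I : Type) (r : seq I) (Q : pred I) (F : I -> 'rV[R]_N -> C) x :
  (forall i, cdiff (F i) x) -> cdiff (fun y => \sum_(i <- r | Q i) F i y) x.
Proof.
move=> dF; elim: r => [|i r IH].
  rewrite (_ : (fun y => _) = (fun=> 0)); first exact: cdiff_cst.
  by apply/funext => y; rewrite big_nil.
case E : (Q i).
  rewrite (_ : (fun y => _) = (fun y => F i y + \sum_(i <- r | Q i) F i y)).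
    exact: cdiffD.
  by apply/funext => y; rewrite big_cons E.
rewrite (_ : (fun y => _) = (fun y => \sum_(i <- r | Q i) F i y)) //.
by apply/funext => y; rewrite big_cons E.
Qed.

Lemma cdiff_prod (I : Type) (r : seq I) (F : I -> 'rV[R]_N -> C) x :
  (forall i, cdiff (F i) x) -> cdiff (fun y => \prod_(i <- r) F i y) x.
Proof.
move=> dF; elim: r => [|i r IH].
  rewrite (_ : (fun y => _) = (fun=> 1)); first exact: cdiff_cst.
  by apply/funext => y; rewrite big_nil.
rewrite (_ : (fun y => _) = (fun y => F i y * \prod_(i <- r) F i y)).
  exact: cdiffM.
by apply/funext => y; rewrite big_cons.
Qed.

Lemma cdiffV f x : cdiff f x -> f x != 0 -> cdiff (fun y => (f y)^-1) x.
Proof.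
move=> [f1 f2] fx.
pose q y := complex.Re (f y) * complex.Re (f y) + complex.Im (f y) * complex.Im (f y).
have dq : differentiable q x.
  exact: differentiableD (differentiableM f1 f1) (differentiableM f2 f2).
have qx : q x != 0.
  rewrite /q -!expr2 paddr_eq0 ?sqr_ge0 // !sqrf_eq0.
  by move: fx; rewrite eq_complex /=.
have dqi := differentiableV dq qx.
split.
  rewrite (_ : (fun y => _) = (fun y => complex.Re (f y)) * (fun y => (q y)^-1)).
    exact: differentiableM.
  apply/funext => y; rewrite -[(_ * _ : _ -> _) _]/(_ * _) /q.
  by case: (f y) => a b; rewrite /= !expr2.
rewrite (_ : (fun y => _) = - ((fun y => complex.Im (f y)) * (fun y => (q y)^-1))).
  by apply: differentiableN; apply: differentiableM.
apply/funext => y; rewrite -[(- _ : _ -> _) _]/(- (_ * _)) /q.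
by case: (f y) => a b; rewrite /= !expr2.
Qed.

Lemma cpartial_cst (c : C) x j : cpartial (fun=> c) x j = 0.
Proof. by rewrite /cpartial !derive_cst. Qed.

Lemma cpartialD f g x j : cdiff f x -> cdiff g x ->
  cpartial (fun y => f y + g y) x j = cpartial f x j + cpartial g x j.
Proof.
move=> [f1 f2] [g1 g2]; rewrite /cpartial.
rewrite (_ : (fun y => complex.Re (f y + g y)) = (fun y => complex.Re (f y)) + (fun y => complex.Re (g y))); last by apply/funext => y; rewrite raddfD.
rewrite (_ : (fun y => complex.Im (f y + g y)) = (fun y => complex.Im (f y)) + (fun y => complex.Im (g y))); last by apply/funext => y; rewrite raddfD.
by rewrite !deriveD //; exact: diff_derivable.
Qed.

Lemma cpartialM f g x j : cdiff f x -> cdiff g x ->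
  cpartial (fun y => f y * g y) x j = cpartial f x j * g x + f x * cpartial g x j.
Proof.
move=> [f1 f2] [g1 g2]; rewrite /cpartial.
have D (a b c d : 'rV[R]_N -> R) : differentiable a x -> differentiable b x ->
  differentiable c x -> differentiable d x ->
  'D_(delta_mx 0 j) (a * b + c * d) x =
   a x * 'D_(delta_mx 0 j) b x + b x * 'D_(delta_mx 0 j) a x +
   (c x * 'D_(delta_mx 0 j) d x + d x * 'D_(delta_mx 0 j) c x).
  move=> da db dc dd; rewrite deriveD; [|by apply: diff_derivable; apply: differentiableM..].
  by rewrite !deriveM //; exact: diff_derivable.
rewrite (_ : (fun y => complex.Re (f y * g y)) = (fun y => complex.Re (f y)) * (fun y => complex.Re (g y)) + (- (fun y => complex.Im (f y))) * (fun y => complex.Im (g y))); last first.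
  by apply/funext => y; rewrite ReM -[(_ + _ : _ -> _) _]/(_ + _) -![(_ * _ : _ -> _) _]/(_ * _) mulNr.
rewrite (_ : (fun y => complex.Im (f y * g y)) = (fun y => complex.Re (f y)) * (fun y => complex.Im (g y)) + (fun y => complex.Im (f y)) * (fun y => complex.Re (g y))); last first.
  by apply/funext => y; rewrite ImM.
rewrite !D //; last exact: differentiableN.
rewrite deriveN; last exact: diff_derivable.
rewrite -[(- _ : _ -> _) _]/(- _).
case: (f x) => a b; case: (g x) => c d.
by apply/eqP; rewrite eq_complex /=; apply/andP; split; apply/eqP; ring.
Qed.

Lemma cpartial_conj f x j : cdiff f x -> cpartial (fun y => (f y)^*) x j = (cpartial f x j)^*.
Proof.
move=> [f1 f2]; rewrite /cpartial.
rewrite (_ : (fun y => complex.Re (f y)^*) = (fun y => complex.Re (f y))); last by apply/funext => y; case: (f y).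
rewrite (_ : (fun y => complex.Im (f y)^*) = - (fun y => complex.Im (f y))); last first.
  by apply/funext => y; rewrite -[(- _ : _ -> _) _]/(- _); case: (f y).
by rewrite deriveN //; exact: diff_derivable.
Qed.

Lemma cpartial_sum (I : Type) (r : seq I) (Q : pred I) (F : I -> 'rV[R]_N -> C) x j :
  (forall i, cdiff (F i) x) ->
  cpartial (fun y => \sum_(i <- r | Q i) F i y) x j = \sum_(i <- r | Q i) cpartial (F i) x j.
Proof.
move=> dF; elim: r => [|i r IH].
  rewrite big_nil (_ : (fun y => _) = (fun=> 0)) ?cpartial_cst //.
  by apply/funext => y; rewrite big_nil.
rewrite big_cons; case E : (Q i).
  rewrite (_ : (fun y => _) = (fun y => F i y + \sum_(i <- r | Q i) F i y)).
    by rewrite cpartialD // ?IH //; apply: cdiff_sum.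
  by apply/funext => y; rewrite big_cons E.
rewrite (_ : (fun y => _) = (fun y => \sum_(i <- r | Q i) F i y)) //.
by apply/funext => y; rewrite big_cons E.
Qed.

Lemma dir_cst (c : C) x X : dir (fun=> c) x X = 0.
Proof. by rewrite /dir big1 // => j _; rewrite cpartial_cst mulr0. Qed.

Lemma dirD f g x X : cdiff f x -> cdiff g x ->
  dir (fun y => f y + g y) x X = dir f x X + dir g x X.
Proof.
by move=> df dg; rewrite /dir -big_split; apply: eq_bigr => j _; rewrite cpartialD // mulrDr.
Qed.

Lemma dirM f g x X : cdiff f x -> cdiff g x ->
  dir (fun y => f y * g y) x X = dir f x X * g x + f x * dir g x X.
Proof.
move=> df dg; rewrite /dir mulr_suml mulr_sumr -big_split; apply: eq_bigr => j _.
by rewrite cpartialM // mulrDr mulrA mulrCA.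
Qed.

Lemma dir_sum (I : Type) (r : seq I) (Q : pred I) (F : I -> 'rV[R]_N -> C) x X :
  (forall i, cdiff (F i) x) ->
  dir (fun y => \sum_(i <- r | Q i) F i y) x X = \sum_(i <- r | Q i) dir (F i) x X.
Proof.
move=> dF; rewrite /dir exchange_big /=; apply: eq_bigr => j _.
by rewrite cpartial_sum // mulr_sumr.
Qed.

Lemma dir_conj f x X : cdiff f x -> dir (fun y => (f y)^*) x X = (dir f x (conjv X))^*.
Proof.
move=> df; rewrite /dir rmorph_sum; apply: eq_bigr => j _.
by rewrite cpartial_conj // rmorphM mxE /= conjcK.
Qed.

Lemma dir_lin f x (a : C) X Y : dir f x (a *: X + Y) = a * dir f x X + dir f x Y.
Proof.
by rewrite /dir mulr_sumr -big_split; apply: eq_bigr => j _; rewrite !mxE mulrDl mulrA.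
Qed.

Lemma dir0 f x : dir f x 0 = 0.
Proof. by rewrite /dir big1 // => j _; rewrite mxE mul0r. Qed.

(** A counted form of [csmooth_on], stable under products and vector fields by
    induction on [k]: each application of a vector field costs one unit. *)
Fixpoint CK (B : set 'rV[R]_N) (k : nat) f : Prop :=
  (forall x, B x -> cdiff f x) /\
  if k is k'.+1 then forall j, CK B k' (fun x => cpartial f x j) else True.

Lemma CK_cdiff B k f x : CK B k f -> B x -> cdiff f x.
Proof. by case: k => [|k] [H _] Bx; apply: H. Qed.

Lemma CK_cpartial B k f j : CK B k.+1 f -> CK B k (fun x => cpartial f x j).
Proof. by case=> _; apply. Qed.

Lemma CKW B k f : CK B k.+1 f -> CK B k f.
Proof.
elim: k f => [|k IH] f [H1 H2]; first by split.
by split=> // j; apply: IH; apply: H2.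
Qed.

Lemma CK_sub B B' k f : B' `<=` B -> CK B k f -> CK B' k f.
Proof.
move=> BB; elim: k f => [|k IH] f [H1 H2]; split; try by move=> x /BB; exact: H1.
  by [].
by move=> j; apply: IH; exact: H2.
Qed.

Section OpenSet.
Variable B : set 'rV[R]_N.
Hypothesis oB : open B.

Lemma CK_congr k f g : (forall x, B x -> f x = g x) -> CK B k f -> CK B k g.
Proof.
have nB x : B x -> \forall y \near x, B y by move=> Bx; apply: open_nbhs_nbhs.
elim: k f g => [|k IH] f g fg [H1 H2].
  split=> // x Bx; apply: near_eq_cdiff (H1 x Bx).
  by apply: filterS (nB x Bx) => y; apply: fg.
split=> [x Bx|j].
  apply: near_eq_cdiff (H1 x Bx).
  by apply: filterS (nB x Bx) => y; apply: fg.
apply: IH (H2 j) => x Bx; apply: near_eq_cpartial.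
by apply: filterS (nB x Bx) => y; apply: fg.
Qed.

Lemma CK_cst k c : CK B k (fun=> c).
Proof.
elim: k c => [|k IH] c; split; try by move=> x _; exact: cdiff_cst.
  by [].
by move=> j; apply: CK_congr (IH 0) => x _; rewrite cpartial_cst.
Qed.

Lemma CK_add k f g : CK B k f -> CK B k g -> CK B k (fun x => f x + g x).
Proof.
elim: k f g => [|k IH] f g [f1 f2] [g1 g2];
  split; try by move=> x Bx; apply: cdiffD; [apply: f1|apply: g1].
  by [].
move=> j; apply: CK_congr (IH _ _ (f2 j) (g2 j)) => x Bx.
by rewrite cpartialD //; [exact: f1|exact: g1].
Qed.

Lemma CK_mul k f g : CK B k f -> CK B k g -> CK B k (fun x => f x * g x).
Proof.
elim: k f g => [|k IH] f g Hf Hg; move: (Hf) (Hg) => [f1 f2] [g1 g2];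
  split; try by move=> x Bx; apply: cdiffM; [apply: f1|apply: g1].
  by [].
move=> j; have H1 := IH _ _ (f2 j) (CKW Hg); have H2 := IH _ _ (CKW Hf) (g2 j).
apply: CK_congr (CK_add H1 H2) => x Bx.
by rewrite cpartialM //; [exact: f1|exact: g1].
Qed.

Lemma CK_conj k f : CK B k f -> CK B k (fun x => (f x)^*).
Proof.
elim: k f => [|k IH] f [f1 f2]; split; try by move=> x Bx; apply: cdiff_conj; apply: f1.
  by [].
move=> j; apply: CK_congr (IH _ (f2 j)) => x Bx.
by rewrite cpartial_conj //; apply: f1.
Qed.

Lemma CK_sum k (I : Type) (r : seq I) (F : I -> 'rV[R]_N -> C) :
  (forall i, CK B k (F i)) -> CK B k (fun x => \sum_(i <- r) F i x).
Proof.
move=> dF; elim: r => [|i r IH].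
  by apply: CK_congr (CK_cst k 0) => x _; rewrite big_nil.
by apply: CK_congr (CK_add (dF i) IH) => x _; rewrite big_cons.
Qed.

Lemma CK_dir k f (V : field R N) : CK B k.+1 f -> (forall j, CK B k (fun x => V x 0 j)) ->
  CK B k (fun x => dir f x (V x)).
Proof. by move=> df dV; apply: CK_sum => j; apply: CK_mul => //; apply: CK_cpartial. Qed.

Lemma CK_smooth k f : csmooth_on B f -> CK B k f.
Proof.
elim: k f => [|k IH] f [f1 f2].
  by split=> // x Bx; split; [apply: (f1 [::] x Bx)|apply: (f2 [::] x Bx)].
split=> [x Bx|j]; first by split; [apply: (f1 [::] x Bx)|apply: (f2 [::] x Bx)].
apply: IH; split=> vs x Bx.
  by have := f1 (rcons vs (delta_mx 0 j)) x Bx; rewrite foldr_rcons.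
by have := f2 (rcons vs (delta_mx 0 j)) x Bx; rewrite foldr_rcons.
Qed.

Lemma CK_coord k i : CK B k (fun x : 'rV[R]_N => (x 0 i)%:C).
Proof.
have dc x : cdiff (fun x : 'rV[R]_N => (x 0 i)%:C) x.
  by split; [exact: differentiable_coord|exact: differentiable_cst].
case: k => [|k]; split; try by move=> x _; exact: dc.
  by [].
move=> j; apply: CK_congr (CK_cst k ((delta_mx 0 j : 'rV[R]_N) 0 i)%:C) => x _.
rewrite /cpartial /= derive_cst; congr (_ +i* _).
have := derive_mx (@derivable_id _ _ x (delta_mx 0 j : 'rV[R]_N)).
by rewrite derive_id => /rowP/(_ i) ->; rewrite !mxE.
Qed.

Lemma cpartial_sym k f x i j : CK B k.+1 f -> B x ->
  cpartial (fun y => cpartial f y i) x j = cpartial (fun y => cpartial f y j) x i.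
Proof.
move=> Hf Bx; have nB : \forall y \near x, B y by apply: open_nbhs_nbhs.
have dfi i0 := CK_cdiff (CK_cpartial i0 Hf) Bx.
have S1 : 'D_(delta_mx 0 j) (fun y => complex.Re (cpartial f y i)) x =
          'D_(delta_mx 0 i) (fun y => complex.Re (cpartial f y j)) x.
  apply: (@schwarz _ _ (fun y => complex.Re (f y))); [|by case: (dfi i)|by case: (dfi j)].
  by apply: filterS nB => y By; case: (CK_cdiff Hf By).
have S2 : 'D_(delta_mx 0 j) (fun y => complex.Im (cpartial f y i)) x =
          'D_(delta_mx 0 i) (fun y => complex.Im (cpartial f y j)) x.
  apply: (@schwarz _ _ (fun y => complex.Im (f y))); [|by case: (dfi i)|by case: (dfi j)].
  by apply: filterS nB => y By; case: (CK_cdiff Hf By).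
by rewrite {1}/cpartial S1 S2.
Qed.

(** The Lie bracket is the commutator of derivations: this is where the symmetry
    of second derivatives enters. *)
Lemma dir_lie k f (V W : field R N) x : CK B k.+1 f -> B x ->
  (forall j, cdiff (fun y => V y 0 j) x) -> (forall j, cdiff (fun y => W y 0 j) x) ->
  dir f x (lie_bracket V W x) =
  dir (fun y => dir f y (W y)) x (V x) - dir (fun y => dir f y (V y)) x (W x).
Proof.
move=> Hf Bx dV dW.
have dp i := CK_cdiff (CK_cpartial i Hf) Bx.
have E (U T : field R N) : (forall j, cdiff (fun y => U y 0 j) x) ->
   dir (fun y => dir f y (U y)) x (T x) =
   \sum_i dir (fun y => U y 0 i) x (T x) * cpartial f x i +
   \sum_i \sum_j U x 0 i * T x 0 j * cpartial (fun y => cpartial f y i) x j.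
  move=> dU; rewrite /dir; under eq_bigr => j _.
    rewrite cpartial_sum; last by move=> i; apply: cdiffM.
    under eq_bigr => i _ do rewrite cpartialM //.
    rewrite big_split /= mulrDr; over.
  rewrite big_split /=; congr (_ + _).
    under eq_bigr => j _ do rewrite mulr_sumr; rewrite exchange_big /=.
    by apply: eq_bigr => i _; rewrite mulr_suml; apply: eq_bigr => j _; rewrite mulrA.
  under eq_bigr => j _ do rewrite mulr_sumr; rewrite exchange_big /=.
  by apply: eq_bigr => i _; apply: eq_bigr => j _; rewrite mulrCA mulrA.
rewrite (E W V dW) (E V W dV) opprD addrACA -sumrB.
have -> : \sum_i \sum_j W x 0 i * V x 0 j * cpartial (fun y => cpartial f y i) x j =
   \sum_i \sum_j V x 0 i * W x 0 j * cpartial (fun y => cpartial f y i) x j.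
  rewrite exchange_big; apply: eq_bigr => i _; apply: eq_bigr => j _.
  by rewrite (cpartial_sym j i Hf Bx) [W x 0 j * _]mulrC.
rewrite subrr addr0 {1}/dir; apply: eq_bigr => i _; rewrite mxE mulrBl.
by [].
Qed.

End OpenSet.

End ComplexCalculus.

(** * Derivatives along curves and of matrix-valued functions *)

Section Curves.
Context {R : realType} {N : nat}.
Local Notation C := R[i].
Implicit Types (f g : 'rV[R]_N -> C) (p v : 'rV[R]_N) (X : 'rV[C]_N).

Lemma complex_eq (a b : C) : complex.Re a = complex.Re b -> complex.Im a = complex.Im b -> a = b.
Proof. by case: a b => [a1 a2] [b1 b2] /= -> ->. Qed.

Lemma imE : ('i%R : C) = 0 +i* 1.
Proof. by []. Qed.

Lemma dir_complexify f p v : cdiff f p ->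
  dir f p (complexify v) = 'd (fun y => complex.Re (f y)) p v +i* 'd (fun y => complex.Im (f y)) p v.
Proof.
move=> [f1 f2]; apply: complex_eq; rewrite /dir raddf_sum /=.
  have -> := diff_sum v f1; apply: eq_bigr => j _; rewrite mxE ReM /=.
  by rewrite mul0r subr0.
have -> := diff_sum v f2; apply: eq_bigr => j _; rewrite mxE ImM /=.
by rewrite mul0r addr0.
Qed.

Lemma ReIm_vec X : X = complexify (map_mx (@complex.Re R) X) +
  ('i : C) *: complexify (map_mx (@complex.Im R) X).
Proof.
apply/rowP => j; rewrite !mxE; apply: complex_eq; rewrite imE raddfD /=.
  by rewrite mul0r mulr0 subrr addr0.
by rewrite mul0r mul1r !add0r.
Qed.

Lemma curve_continuous (c : R -> 'rV[R]_N) v : is_derive (0 : R) (1 : R) c v ->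
  {for (0 : R), continuous c}.
Proof.
by move=> [dc _]; apply: differentiable_continuous; apply/derivable1_diffP.
Qed.

Lemma chain_rule (g : 'rV[R]_N -> R) p v (c : R -> 'rV[R]_N) : differentiable g p ->
  c 0 = p -> is_derive (0 : R) (1 : R) c v ->
  is_derive (0 : R) (1 : R) (fun t => g (c t)) ('d g p v).
Proof.
move=> dg c0 [dc vE].
have dc' : differentiable c 0 by apply/derivable1_diffP.
have dg' : differentiable g (c 0) by rewrite c0.
have dgc : differentiable (g \o c) 0 by apply: differentiable_comp.
split; first by apply/derivable1_diffP.
rewrite deriveE //; have -> := diff_comp dc' dg'.
by rewrite /= c0 -vE deriveE.
Qed.

Lemma curve_cderive f p v (c : R -> 'rV[R]_N) : cdiff f p -> c 0 = p ->
  is_derive (0 : R) (1 : R) c v -> is_cderive0 (fun t => f (c t)) (dir f p (complexify v)).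
Proof.
move=> df c0 dc; rewrite dir_complexify //; case: df => f1 f2.
by split => /=; apply: (chain_rule _ c0).
Qed.

Lemma cderive_unique (u : R -> C) (a b : C) : is_cderive0 u a -> is_cderive0 u b -> a = b.
Proof.
by move=> [[_ a1] [_ a2]] [[_ b1] [_ b2]]; apply: complex_eq; rewrite -?a1 -?a2 ?b1 ?b2.
Qed.

Lemma near_eq_cderive (u w : R -> C) (a : C) : (\forall t \near (0 : R), u t = w t) ->
  is_cderive0 u a -> is_cderive0 w a.
Proof.
move=> uw [h1 h2]; split; [apply: near_eq_is_derive h1|apply: near_eq_is_derive h2];
  by apply: filterS uw => t ->.
Qed.

(** Along a curve in the subset, the function and its extension agree, and the chain
    rule applies to the extension; the hypotheses provide a curve for the real and
    for the imaginary part of the direction. *)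
Lemma leaf_derivP (L : set 'rV[R]_N) f f' p X (d : C) :
  cdiff f' p -> (\forall y \near p, L y -> f y = f' y) ->
  (exists c, curve_in L p (map_mx (@complex.Re R) X) c) ->
  (exists c, curve_in L p (map_mx (@complex.Im R) X) c) ->
  is_leaf_deriv L f p X d <-> d = dir f' p X.
Proof.
move=> df ff' [c1 Hc1] [c2 Hc2].
have along v c : curve_in L p v c -> is_cderive0 (fun t => f (c t)) (dir f' p (complexify v)).
  move=> [c0 cL dc]; apply: near_eq_cderive (curve_cderive df c0 dc).
  have cc := curve_continuous dc.
  have nf : \forall t \near (0 : R), L (c t) -> f (c t) = f' (c t).
    by move: ff'; rewrite -c0 => ff'; exact: (cc _ ff').
  by apply: filterS2 cL nf => t Lt /(_ Lt) ->.
split=> [[a [b [-> Ha Hb]]]|->].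
  rewrite (cderive_unique (Ha _ Hc1) (along _ _ Hc1)) (cderive_unique (Hb _ Hc2) (along _ _ Hc2)).
  by rewrite addrC -dir_lin addrC -ReIm_vec.
exists (dir f' p (complexify (map_mx (@complex.Re R) X))),
       (dir f' p (complexify (map_mx (@complex.Im R) X))); split.
- by rewrite [RHS]addrC -dir_lin addrC -ReIm_vec.
- by move=> c; apply: along.
- by move=> c; apply: along.
Qed.

End Curves.

Section MatrixCalculus.
Context {R : realType} {N : nat}.
Local Notation C := R[i].
Implicit Types (x : 'rV[R]_N) (X Y : 'rV[C]_N).

Definition mcdiff m n (F : 'rV[R]_N -> 'M[C]_(m, n)) x := forall i j, cdiff (fun y => F y i j) x.

Definition mdir m n (F : 'rV[R]_N -> 'M[C]_(m, n)) x X : 'M[C]_(m, n) :=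
  \matrix_(i, j) dir (fun y => F y i j) x X.

Lemma eq_dir (f g : 'rV[R]_N -> C) x X : f =1 g -> dir f x X = dir g x X.
Proof. by move=> /funext ->. Qed.

Lemma near_eq_mcdiff m n (F G : 'rV[R]_N -> 'M[C]_(m, n)) x :
  (\forall y \near x, F y = G y) -> mcdiff F x -> mcdiff G x.
Proof. by move=> FG dF i j; apply: near_eq_cdiff (dF i j); apply: filterS FG => y ->. Qed.

Lemma near_eq_mdir m n (F G : 'rV[R]_N -> 'M[C]_(m, n)) x X :
  (\forall y \near x, F y = G y) -> mdir F x X = mdir G x X.
Proof.
by move=> FG; apply/matrixP => i j; rewrite !mxE; apply: near_eq_dir; apply: filterS FG => y ->.
Qed.

Lemma mcdiff_cst m n (A : 'M[C]_(m, n)) x : mcdiff (fun=> A) x.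
Proof. by move=> i j; apply: cdiff_cst. Qed.

Lemma mcdiffD m n (F G : 'rV[R]_N -> 'M[C]_(m, n)) x : mcdiff F x -> mcdiff G x ->
  mcdiff (fun y => F y + G y) x.
Proof.
move=> dF dG i j; rewrite (_ : (fun y => _) = (fun y => F y i j + G y i j)); first exact: cdiffD.
by apply/funext => y; rewrite mxE.
Qed.

Lemma mcdiffM m n k (F : 'rV[R]_N -> 'M[C]_(m, n)) (G : 'rV[R]_N -> 'M[C]_(n, k)) x :
  mcdiff F x -> mcdiff G x -> mcdiff (fun y => F y *m G y) x.
Proof.
move=> dF dG i j.
rewrite (_ : (fun y => _) = (fun y => \sum_l F y i l * G y l j)).
  by apply: cdiff_sum => l; apply: cdiffM.
by apply/funext => y; rewrite mxE.
Qed.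

Lemma mcdiff_conj m n (F : 'rV[R]_N -> 'M[C]_(m, n)) x : mcdiff F x -> mcdiff (fun y => conjv (F y)) x.
Proof.
move=> dF i j; rewrite (_ : (fun y => _) = (fun y => (F y i j)^*)); first exact: cdiff_conj.
by apply/funext => y; rewrite mxE.
Qed.

Lemma mcdiff_tr m n (F : 'rV[R]_N -> 'M[C]_(m, n)) x : mcdiff F x -> mcdiff (fun y => (F y)^T) x.
Proof.
move=> dF i j; rewrite (_ : (fun y => _) = (fun y => F y j i)) //.
by apply/funext => y; rewrite mxE.
Qed.

Lemma mcdiff_lsub m n1 n2 (F : 'rV[R]_N -> 'M[C]_(m, n1 + n2)) x :
  mcdiff F x -> mcdiff (fun y => lsubmx (F y)) x.
Proof.
move=> dF i j; rewrite (_ : (fun y => _) = (fun y => F y i (lshift n2 j))) //.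
by apply/funext => y; rewrite mxE.
Qed.

Lemma mcdiff_rsub m n1 n2 (F : 'rV[R]_N -> 'M[C]_(m, n1 + n2)) x :
  mcdiff F x -> mcdiff (fun y => rsubmx (F y)) x.
Proof.
move=> dF i j; rewrite (_ : (fun y => _) = (fun y => F y i (rshift n1 j))) //.
by apply/funext => y; rewrite mxE.
Qed.

Lemma mcdiff_col m1 m2 n (F : 'rV[R]_N -> 'M[C]_(m1, n)) (G : 'rV[R]_N -> 'M[C]_(m2, n)) x :
  mcdiff F x -> mcdiff G x -> mcdiff (fun y => col_mx (F y) (G y)) x.
Proof.
move=> dF dG i j; case: (splitP i) => k ik.
  have -> : i = lshift m2 k by apply: val_inj.
  rewrite (_ : (fun y => _) = (fun y => F y k j)) //.
  by apply/funext => y; rewrite col_mxEu.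
have -> : i = rshift m1 k by apply: val_inj.
rewrite (_ : (fun y => _) = (fun y => G y k j)) //.
by apply/funext => y; rewrite col_mxEd.
Qed.

Lemma cdiff_det n (F : 'rV[R]_N -> 'M[C]_n) x : mcdiff F x -> cdiff (fun y => \det (F y)) x.
Proof.
move=> dF; apply: cdiff_sum => s; apply: cdiffM; first exact: cdiff_cst.
by apply: cdiff_prod => i; apply: dF.
Qed.

Lemma cdiff_neq0 (f : 'rV[R]_N -> C) x : cdiff f x -> f x != 0 -> \forall y \near x, f y != 0.
Proof.
move=> [/differentiable_continuous f1 /differentiable_continuous f2].
rewrite eq_complex negb_and => /orP[h|h].
  apply: filterS (cvgr_neq0 _ f1 h) => y /= hy.
  by rewrite eq_complex negb_and hy.
apply: filterS (cvgr_neq0 _ f2 h) => y /= hy.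
by rewrite eq_complex negb_and hy orbT.
Qed.

Lemma near_unitmx n (F : 'rV[R]_N -> 'M[C]_n) x : mcdiff F x -> F x \in unitmx ->
  \forall y \near x, F y \in unitmx.
Proof.
move=> dF; rewrite unitmxE unitfE => Fx.
by apply: filterS (cdiff_neq0 (cdiff_det dF) Fx) => y; rewrite unitmxE unitfE.
Qed.

Lemma mcdiff_inv n (F : 'rV[R]_N -> 'M[C]_n) x : mcdiff F x -> F x \in unitmx ->
  mcdiff (fun y => invmx (F y)) x.
Proof.
move=> dF Fx; apply: (@near_eq_mcdiff _ _ (fun y => (\det (F y))^-1 *: \adj (F y))).
  by apply: filterS (near_unitmx dF Fx) => y Fy; rewrite /invmx Fy.
move=> i j; rewrite (_ : (fun y => _) =
  (fun y => (\det (F y))^-1 * ((-1) ^+ (j + i) * \det (row' j (col' i (F y)))))); last first.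
  by apply/funext => y; rewrite !mxE.
apply: cdiffM.
  by apply: cdiffV; [exact: cdiff_det|rewrite -unitfE -unitmxE].
apply: cdiffM; first exact: cdiff_cst.
apply: cdiff_det => a b; rewrite (_ : (fun y => _) = (fun y => F y (lift j a) (lift i b))) //.
by apply/funext => y; rewrite !mxE.
Qed.

Lemma mdir_cst m n (A : 'M[C]_(m, n)) x X : mdir (fun=> A) x X = 0.
Proof. by apply/matrixP => i j; rewrite !mxE dir_cst. Qed.

Lemma mdirD m n (F G : 'rV[R]_N -> 'M[C]_(m, n)) x X : mcdiff F x -> mcdiff G x ->
  mdir (fun y => F y + G y) x X = mdir F x X + mdir G x X.
Proof.
move=> dF dG; apply/matrixP => i j; rewrite !mxE -dirD //.
by apply: eq_dir => y; rewrite mxE.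
Qed.

Lemma mdirM m n k (F : 'rV[R]_N -> 'M[C]_(m, n)) (G : 'rV[R]_N -> 'M[C]_(n, k)) x X :
  mcdiff F x -> mcdiff G x ->
  mdir (fun y => F y *m G y) x X = mdir F x X *m G x + F x *m mdir G x X.
Proof.
move=> dF dG; apply/matrixP => i j; rewrite !mxE.
rewrite (@eq_dir _ (fun y => \sum_l F y i l * G y l j)); last by move=> y; rewrite mxE.
rewrite dir_sum; last by move=> l; apply: cdiffM.
rewrite -big_split; apply: eq_bigr => l _.
by rewrite dirM // !mxE.
Qed.

Lemma mdirMl m n k (A : 'M[C]_(m, n)) (G : 'rV[R]_N -> 'M[C]_(n, k)) x X :
  mcdiff G x -> mdir (fun y => A *m G y) x X = A *m mdir G x X.
Proof. by move=> dG; rewrite (mdirM _ (mcdiff_cst A x) dG) mdir_cst mul0mx add0r. Qed.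

Lemma mdirMr m n k (F : 'rV[R]_N -> 'M[C]_(m, n)) (A : 'M[C]_(n, k)) x X :
  mcdiff F x -> mdir (fun y => F y *m A) x X = mdir F x X *m A.
Proof. by move=> dF; rewrite (mdirM _ dF (mcdiff_cst A x)) mdir_cst mulmx0 addr0. Qed.

(** Differentiate F F^{-1} = 1. *)
Lemma mdir_inv n (F : 'rV[R]_N -> 'M[C]_n) x X : mcdiff F x -> F x \in unitmx ->
  mdir (fun y => invmx (F y)) x X = - (invmx (F x) *m mdir F x X *m invmx (F x)).
Proof.
move=> dF Fx; have dI := mcdiff_inv dF Fx.
have : mdir (fun y => F y *m invmx (F y)) x X = 0.
  rewrite -(mdir_cst (1%:M : 'M[C]_n) x X); apply: near_eq_mdir.
  by apply: filterS (near_unitmx dF Fx) => y Fy; rewrite mulmxV.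
rewrite mdirM // => /(congr1 (fun A => invmx (F x) *m A)).
rewrite mulmxDr mulKmx // mulmx0 mulmxA => /eqP; rewrite addrC addr_eq0 => /eqP ->.
by [].
Qed.

Lemma mdir_conj m n (F : 'rV[R]_N -> 'M[C]_(m, n)) x X : mcdiff F x ->
  mdir (fun y => conjv (F y)) x X = conjv (mdir F x (conjv X)).
Proof.
move=> dF; apply/matrixP => i j; rewrite !mxE -dir_conj //.
by apply: eq_dir => y; rewrite mxE.
Qed.

Lemma mdir_tr m n (F : 'rV[R]_N -> 'M[C]_(m, n)) x X : mdir (fun y => (F y)^T) x X = (mdir F x X)^T.
Proof.
by apply/matrixP => i j; rewrite !mxE; apply: eq_dir => y; rewrite mxE.
Qed.

Lemma mdir_lsub m n1 n2 (F : 'rV[R]_N -> 'M[C]_(m, n1 + n2)) x X :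
  mdir (fun y => lsubmx (F y)) x X = lsubmx (mdir F x X).
Proof.
by apply/matrixP => i j; rewrite !mxE; apply: eq_dir => y; rewrite mxE.
Qed.

Lemma mdir_rsub m n1 n2 (F : 'rV[R]_N -> 'M[C]_(m, n1 + n2)) x X :
  mdir (fun y => rsubmx (F y)) x X = rsubmx (mdir F x X).
Proof.
by apply/matrixP => i j; rewrite !mxE; apply: eq_dir => y; rewrite mxE.
Qed.

Lemma mdir_lin m n (F : 'rV[R]_N -> 'M[C]_(m, n)) x (a : C) X Y :
  mdir F x (a *: X + Y) = a *: mdir F x X + mdir F x Y.
Proof. by apply/matrixP => i j; rewrite !mxE dir_lin. Qed.

Lemma mdir0 m n (F : 'rV[R]_N -> 'M[C]_(m, n)) x : mdir F x 0 = 0.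
Proof. by apply/matrixP => i j; rewrite !mxE dir0. Qed.

End MatrixCalculus.

(** * Matrix identities *)

Lemma lin_sum (K : pzRingType) (U V : lmodType K) (F : U -> V) k (t : 'I_k -> K) (X : 'I_k -> U) :
  (forall a v w, F (a *: v + w) = a *: F v + F w) ->
  F (\sum_b t b *: X b) = \sum_b t b *: F (X b).
Proof.
move=> HF; have F0 : F 0 = 0.
  by have := HF (-1) 0 0; rewrite scaler0 addr0 scaleN1r addNr.
elim: k t X => [|k IH] t X; first by rewrite !big_ord0.
by rewrite !big_ord_recl HF IH.
Qed.

Section MatrixIdentities.
Context {F : comUnitRingType} {s d : nat}.

Lemma mulmx_eq0l a b c k (A : 'M[F]_(a, b)) (X : 'M[F]_(b, c)) (Y : 'M[F]_(c, k)) :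
  A *m X = 0 -> A *m (X *m Y) = 0.
Proof. by move=> E; rewrite mulmxA E mul0mx. Qed.

Lemma opp_cancel_mx k (A : 'M[F]_(k, 1)) (q w : 'M[F]_1) :
  - (A *m q) *m w + A *m - (- q *m w) = 0.
Proof. by rewrite (mulNmx q) opprK mulNmx mulmxA addNr. Qed.

Lemma cV_eq (A1 A2 : 'M[F]_s) : (forall x : 'cV[F]_s, A1 *m x = A2 *m x) -> A1 = A2.
Proof. move=> H; apply/trmx_inj/row_matrixP => j; apply: trmx_inj.
by rewrite !tr_row !trmxK !colE. Qed.

Lemma regroup_mx (x1 x2 : 'rV[F]_s) (gv k K a b : 'M[F]_s) (U V : 'M[F]_(s, d)) :
  x1 *m (gv *m U) + (x2 *m k *m V + x2 *m K *m (a *m U + b *m V)) =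
  (x1 *m gv + x2 *m (K *m a)) *m U + x2 *m (k + K *m b) *m V.
Proof.
rewrite [_ *m (_ + b *m V)]mulmxDr [x2 *m (k + _)]mulmxDr !mulmxDl !mulmxA.
by rewrite -addrA; congr (_ + _); rewrite addrCA.
Qed.

Lemma comb_jacobi (P Q : 'M[F]_(s, d)) (aY bY cZ A1 A2 B1 B2 aV aW bV bW gV gW : 'M[F]_s) :
  aY *m P + bY *m Q + cZ *m Q =
    A1 *m P + aW *m (gV *m P) + (B1 *m Q + bW *m (aV *m P + bV *m Q)) -
    (A2 *m P + aV *m (gW *m P) + (B2 *m Q + bV *m (aW *m P + bW *m Q))) ->
  (A1 + aW *m gV + bW *m aV - (A2 + aV *m gW + bV *m aW)) *m P +
  (B1 + bW *m bV - (B2 + bV *m bW)) *m Q = aY *m P + (bY + cZ) *m Q.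
Proof.
rewrite !mulmxDr !mulmxA => H; rewrite [(bY + cZ) *m Q]mulmxDl addrA H !mulmxBl !mulmxDl.
move: (A1 *m P) (A2 *m P) (B1 *m Q) (B2 *m Q) (aW *m gV *m P) (bW *m aV *m P) (bW *m bV *m Q)
  (aV *m gW *m P) (bV *m aW *m P) (bV *m bW *m Q) => *.
by apply/matrixP => i j; rewrite !mxE; ring.
Qed.

Lemma comb_jacobi_mixed (P Q : 'M[F]_(s, d)) (gY aZ bZ A1 B1 A2 aV aW bV bW gV : 'M[F]_s) :
  gY *m P + (aZ *m Q + bZ *m P) =
    A1 *m Q + aW *m (aV *m P + bV *m Q) + (B1 *m P + bW *m (gV *m P)) -
    (A2 *m P + gV *m (aW *m Q + bW *m P)) ->
  (aW *m aV + B1 + bW *m gV - A2 - gV *m bW) *m P + (A1 + aW *m bV - gV *m aW) *m Q =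
  (gY + bZ) *m P + aZ *m Q.
Proof.
rewrite !mulmxDr !mulmxA => H; rewrite [(gY + bZ) *m P]mulmxDl -[_ + bZ *m P + _]addrA [bZ *m P + _]addrC H.
rewrite !mulmxBl !mulmxDl.
move: (A1 *m Q) (A2 *m P) (B1 *m P) (aW *m aV *m P) (aW *m bV *m Q) (bW *m gV *m P)
  (gV *m aW *m Q) (gV *m bW *m P) => *.
by apply/matrixP => i j; rewrite !mxE; ring.
Qed.

Lemma symbol_action_mx (N aw gv X Y k : 'M[F]_s) :
  N *m aw *m gv - X + (X - (k + N *m Y)) = N *m (aw *m gv - Y) - k.
Proof. by rewrite addrA subrK mulmxBr mulmxA opprD addrA addrAC. Qed.

Lemma antisym_mx (k1 k2 N X1 X2 Y1 Y2 Z1 Z2 : 'M[F]_s) :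
  (k1 + N *m X1)^T - (k2 + N *m X2)^T + ((N *m (Y1 - Z1) - k1)^T - (N *m (Y2 - Z2) - k2)^T) =
  (N *m (X1 + Y1 + Z2 - (X2 + Y2 + Z1)))^T.
Proof.
rewrite !mulmxBr !mulmxDr.
move: (N *m X1) (N *m X2) (N *m Y1) (N *m Y2) (N *m Z1) (N *m Z2) => *.
by apply/matrixP => i j; rewrite !mxE; ring.
Qed.

Lemma normal_mx (A K k b L X gv : 'M[F]_s) (t : F) : K \in unitmx ->
  L = gv^T - t%:M -> L = t%:M - (k + invmx K *m b) *m K ->
  (X *m K - A *m (K *m k *m K))^T - (L^T *m (A *m K)^T + (A *m K)^T *m L) =
  ((X + A *m b - gv *m A) *m K)^T.
Proof.
move=> U L1 L2; apply: trmx_inj; rewrite [RHS]trmxK.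
have T1 : (L^T *m (A *m K)^T)^T = A *m K *m L by rewrite trmx_mul !trmxK.
have T2 : ((A *m K)^T *m L)^T = L^T *m (A *m K) by rewrite trmx_mul trmxK.
rewrite [LHS]linearB /= trmxK linearD /= T1 T2.
have -> : A *m K *m L = t *: (A *m K) - A *m (K *m k *m K) - A *m b *m K.
  rewrite L2 mulmxBr mul_mx_scalar mulmxDl mulmxDr opprD addrA !mulmxA.
  by rewrite mulmxK.
have -> : L^T *m (A *m K) = gv *m A *m K - t *: (A *m K).
  by rewrite L1 linearB /= trmxK tr_scalar_mx mulmxBl mul_scalar_mx mulmxA.
rewrite !mulmxBl !mulmxDl.
move: (X *m K) (A *m (K *m k *m K)) (t *: (A *m K)) (A *m b *m K) (gv *m A *m K) => *.
by apply/matrixP => i j; rewrite !mxE; ring.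
Qed.

Lemma antisym_sum (D1 D2 o1 o2 b : 'M[F]_s) :
  D1 - D2 + b + (o1 - D1 - (o2 - D2)) - (o1 - o2) = b.
Proof. by apply/matrixP => i j; rewrite !mxE; ring. Qed.

Lemma normal_sum (D o b : 'M[F]_s) : D - b + (o - D) - o = - b.
Proof. by apply/matrixP => i j; rewrite !mxE; ring. Qed.

Definition symact (Z S : 'M[F]_s) := Z *m S + S *m Z^T.

Lemma symact_linl S a Z1 Z2 : symact (a *: Z1 + Z2) S = a *: symact Z1 S + symact Z2 S.
Proof.
rewrite /symact linearP /= mulmxDl mulmxDr -scalemxAl -scalemxAr scalerDr.
by rewrite addrACA.
Qed.

Lemma symact_linr Z a S1 S2 : symact Z (a *: S1 + S2) = a *: symact Z S1 + symact Z S2.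
Proof.
rewrite /symact mulmxDl mulmxDr -scalemxAl -scalemxAr scalerDr.
by rewrite addrACA.
Qed.

End MatrixIdentities.

(** * The graded algebra in block form *)

Section Blocks.
Context {R : realType} {s : nat}.
Local Notation C := R[i].
Implicit Types (c u : C) (x y : 'cV[C]_s) (L P Q : 'M[C]_s).

Lemma i_neq0 : ('i%R : C) != 0.
Proof. by rewrite imE eq_complex /= oner_eq0 andbF. Qed.

Lemma alg_mxD c1 u1 x1 y1 L1 P1 Q1 c2 u2 x2 y2 L2 P2 Q2 :
  alg_mx c1 u1 x1 y1 L1 P1 Q1 + alg_mx c2 u2 x2 y2 L2 P2 Q2 =
  alg_mx (c1 + c2) (u1 + u2) (x1 + x2) (y1 + y2) (L1 + L2) (P1 + P2) (Q1 + Q2).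
Proof.
rewrite /alg_mx !add_block_mx !add_col_mx !add_row_mx !addr0.
by rewrite ![(_ + _)^T]linearD /= !opprD mulrDl ![(_ + _)%:M]raddfD.
Qed.

Lemma alg_mxZ a c u x y L P Q :
  a *: alg_mx c u x y L P Q =
  alg_mx (a * c) (a * u) (a *: x) (a *: y) (a *: L) (a *: P) (a *: Q).
Proof.
rewrite /alg_mx !scale_block_mx !scale_col_mx !scale_row_mx !scaler0.
by rewrite !scale_scalar_mx !linearZ /= !scalerN mulrA mulrN.
Qed.

Lemma alg_mxN c u x y L P Q :
  - alg_mx c u x y L P Q = alg_mx (- c) (- u) (- x) (- y) (- L) (- P) (- Q).
Proof. by rewrite -scaleN1r alg_mxZ !scaleN1r !mulN1r. Qed.

Lemma alg_mx_inj c1 u1 x1 y1 L1 P1 Q1 c2 u2 x2 y2 L2 P2 Q2 :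
  alg_mx c1 u1 x1 y1 L1 P1 Q1 = alg_mx c2 u2 x2 y2 L2 P2 Q2 ->
  [/\ c1 = c2, u1 = u2, x1 = x2 & y1 = y2] /\ [/\ L1 = L2, P1 = P2 & Q1 = Q2].
Proof.
rewrite /alg_mx; case/eq_block_mx => /matrixP/(_ 0 0); rewrite !mxE /= !mulr1n => -> _.
case/eq_col_mx => -> /eq_col_mx[-> /matrixP/(_ 0 0)]; rewrite !mxE /= !mulr1n => hu.
case/eq_block_mx => -> /eq_row_mx[-> _] /eq_col_mx[-> _] _; split; split => //.
exact: (mulIf i_neq0 hu).
Qed.

(** The shape shared by the matrices of the algebra and by their products; unlike
    [alg_mx] it is closed under multiplication, so that both terms of a commutator
    can be subtracted blockwise. *)
Definition blk (a : C) (p q : 'cV[C]_s) (w : 'M[C]_1) (A1 A2 A3 A4 : 'M[C]_s) (r t : 'rV[C]_s)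
    (e : 'M[C]_1) :=
  block_mx (a%:M : 'M[C]_1) 0 (col_mx p (col_mx q w))
    (block_mx A1 (row_mx A2 (0 : 'cV[C]_s)) (col_mx A3 r)
       (block_mx A4 (0 : 'cV[C]_s) t e)).

Lemma blkB a1 p1 q1 w1 A1 A2 A3 A4 r1 t1 e1 a2 p2 q2 w2 B1 B2 B3 B4 r2 t2 e2 :
  blk a1 p1 q1 w1 A1 A2 A3 A4 r1 t1 e1 - blk a2 p2 q2 w2 B1 B2 B3 B4 r2 t2 e2 =
  blk (a1 - a2) (p1 - p2) (q1 - q2) (w1 - w2) (A1 - B1) (A2 - B2) (A3 - B3) (A4 - B4)
    (r1 - r2) (t1 - t2) (e1 - e2).
Proof.
rewrite /blk !opp_block_mx !opp_col_mx !opp_row_mx !oppr0.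
by rewrite !add_block_mx !add_col_mx !add_row_mx !addr0 raddfB.
Qed.

Lemma eq_blk a1 p1 q1 w1 A1 A2 A3 A4 r1 t1 e1 a2 p2 q2 w2 B1 B2 B3 B4 r2 t2 e2 :
  a1 = a2 -> p1 = p2 -> q1 = q2 -> w1 = w2 -> A1 = B1 -> A2 = B2 -> A3 = B3 -> A4 = B4 ->
  r1 = r2 -> t1 = t2 -> e1 = e2 ->
  blk a1 p1 q1 w1 A1 A2 A3 A4 r1 t1 e1 = blk a2 p2 q2 w2 B1 B2 B3 B4 r2 t2 e2.
Proof. by do 11!move=> ->. Qed.

Lemma alg_blk c u x y L P Q :
  alg_mx c u x y L P Q =
  blk c x y (u * ('i : C))%:M L P Q (- L^T) y^T (- x^T) ((- c)%:M).
Proof. by []. Qed.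

Lemma mul_alg_mx c1 u1 x1 y1 L1 P1 Q1 c2 u2 x2 y2 L2 P2 Q2 :
  alg_mx c1 u1 x1 y1 L1 P1 Q1 *m alg_mx c2 u2 x2 y2 L2 P2 Q2 =
  blk (c1 * c2) (c2 *: x1 + (L1 *m x2 + P1 *m y2)) (c2 *: y1 + (Q1 *m x2 - L1^T *m y2))
      ((c2 * (u1 * ('i : C)))%:M + (y1^T *m x2 - (x1^T *m y2 + (c1 * (u2 * ('i : C)))%:M)))
    (L1 *m L2 + P1 *m Q2) (L1 *m P2 - P1 *m L2^T)
    (Q1 *m L2 - L1^T *m Q2) (Q1 *m P2 + L1^T *m L2^T)
    (y1^T *m L2 - (x1^T *m Q2 + c1 *: y2^T))
    (y1^T *m P2 + (x1^T *m L2^T + c1 *: x2^T)) ((c1 * c2)%:M : 'M[C]_1).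
Proof.
rewrite /alg_mx /blk !mulmx_block !mul_row_block !mul_row_col !mul_col_mx !mul_mx_row.
rewrite !mulmx0 !mul0mx !add0r !addr0 !mul_mx_scalar !mul_scalar_mx !mulNmx !mulmxN !opprK.
rewrite !mul_row_col !mul_col_mx ?mul_block_col !mul_row_col !col_mx0 !add0r.
rewrite !mul0mx ?addr0 ?add0r !mul_mx_scalar !mul_scalar_mx !mulNmx ?mulmxN.
congr (block_mx _ _ _ _).
- by rewrite scale_scalar_mx mulrC.
- rewrite !add_col_mx !scale_scalar_mx; congr (col_mx _ (col_mx _ _)).
  by rewrite mulrN [(- _)%:M]raddfN /= [u2 * 'i * c1]mulrC opprD.
congr (block_mx _ _ _ _).
- by rewrite add_row_mx addr0.
- by rewrite add_col_mx opprD scaleNr.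
rewrite !block_mxEv add_col_mx !add_row_mx !addr0 add0r scale_scalar_mx.
by rewrite mulrNN [c2 * c1]mulrC scaleNr scalerN opprK.
Qed.

Lemma sc0 : (0 : C)%:M = 0 :> 'M[C]_1.
Proof. exact: raddf0. Qed.

Ltac mx0 := rewrite ?trmx0 ?mulmx0 ?mul0mx ?scaler0 ?scale0r;
  rewrite ?mul0r ?mulr0 ?sc0 ?oppr0 ?addr0 ?add0r ?oppr0 ?addr0 ?add0r ?sc0 //.

Lemma commutator_csp_gminus c u x y L P Q : P^T = P -> Q^T = Q ->
  commutator (alg_mx c 0 0 0 L P Q) (gminus_mx u x y) =
  gminus_mx (- (2 * c) * u) (L *m x - c *: x + P *m y) (Q *m x - L^T *m y - c *: y).
Proof.
move=> hp hq; rewrite /commutator /gminus_mx !mul_alg_mx blkB [RHS]alg_blk.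
apply: eq_blk; mx0.
- by rewrite addrAC.
- by rewrite -!raddfN -raddfD /=; congr _%:M; ring.
- have -> : (Q *m x - L^T *m y - c *: y)^T = x^T *m Q - y^T *m L - c *: y^T.
    by rewrite !linearD !linearN /= linearZ /= !trmx_mul trmxK hq.
  by move: (c *: y^T) (x^T *m Q) (y^T *m L) => a b d; apply/rowP => k; rewrite !mxE; ring.
- have -> : (L *m x - c *: x + P *m y)^T = x^T *m L^T - c *: x^T + y^T *m P.
    by rewrite !linearD !linearN /= linearZ /= !trmx_mul hp.
  by move: (c *: x^T) (x^T *m L^T) (y^T *m P) => a b d; apply/rowP => k; rewrite !mxE; ring.
Qed.

Lemma commutator_gminus x y :
  commutator (gminus_mx 0 x 0) (gminus_mx 0 0 y) = gminus_mx (2 * ('i : C) * (x^T *m y) 0 0) 0 0.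
Proof.
rewrite /commutator /gminus_mx !mul_alg_mx blkB [RHS]alg_blk.
apply: eq_blk; mx0.
have -> : y^T *m x = x^T *m y.
  by rewrite [x^T *m y]mx11_scalar -[x^T *m y]trmxK trmx_mul trmxK mxE -mx11_scalar.
rewrite {1 2}[x^T *m y]mx11_scalar -!raddfN -raddfD /=; congr _%:M.
have hi : ('i%R : C) * 'i%R = -1 by rewrite imE; apply: complex_eq => /=; ring.
by rewrite mulrAC -[2 * 'i * 'i]mulrA hi; ring.
Qed.

Lemma commutator_csp c1 L1 P1 c2 L2 P2 :
  commutator (alg_mx c1 0 0 0 L1 P1 0) (alg_mx c2 0 0 0 L2 P2 0) =
  alg_mx 0 0 0 0 (L1 *m L2 - L2 *m L1) (L1 *m P2 + P2 *m L1^T - (L2 *m P1 + P1 *m L2^T)) 0.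
Proof.
rewrite /commutator !mul_alg_mx blkB [RHS]alg_blk.
apply: eq_blk; mx0.
- by rewrite mulrC subrr.
- move: (L1 *m P2) (P1 *m L2^T) (L2 *m P1) (P2 *m L1^T) => a b d f.
  by apply/matrixP => i j; rewrite !mxE; ring.
- by rewrite linearB /= !trmx_mul opprB.
- by rewrite mulrC subrr.
Qed.

Lemma commutator_inS_true L S :
  commutator (inL L) (inS true S) = inS true (L *m S + S *m L^T).
Proof.
rewrite /inL /inS commutator_csp.
by mx0; rewrite subrr.
Qed.

Lemma commutator_inS_false L S :
  commutator (inL L) (inS false S) = inS false (- (L^T *m S + S *m L)).
Proof.
rewrite /commutator !mul_alg_mx blkB [RHS]alg_blk.
apply: eq_blk; mx0.
by rewrite opprD.
Qed.

Lemma proj02_alg_mx c u x y L P Q : proj02 (alg_mx c u x y L P Q) = inS true P.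
Proof.
by rewrite /proj02 /alg_mx block_mxKdr block_mxKur row_mxKl.
Qed.

End Blocks.

Section BlockDerivatives.
Context {R : realType} {N s : nat}.
Local Notation C := R[i].
Implicit Types (x : 'rV[R]_N) (X : 'rV[C]_N).

Lemma mcdiff_row m n1 n2 (F : 'rV[R]_N -> 'M[C]_(m, n1)) (G : 'rV[R]_N -> 'M[C]_(m, n2)) x :
  mcdiff F x -> mcdiff G x -> mcdiff (fun y => row_mx (F y) (G y)) x.
Proof.
move=> dF dG i j; case: (splitP j) => k jk.
  have -> : j = lshift n2 k by apply: val_inj.
  rewrite (_ : (fun y => _) = (fun y => F y i k)) //.
  by apply/funext => y; rewrite row_mxEl.
have -> : j = rshift n1 k by apply: val_inj.
rewrite (_ : (fun y => _) = (fun y => G y i k)) //.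
by apply/funext => y; rewrite row_mxEr.
Qed.

Lemma mdir_col m1 m2 n (F : 'rV[R]_N -> 'M[C]_(m1, n)) (G : 'rV[R]_N -> 'M[C]_(m2, n)) x X :
  mdir (fun y => col_mx (F y) (G y)) x X = col_mx (mdir F x X) (mdir G x X).
Proof.
apply/matrixP => i j; rewrite !mxE; case: splitP => k ik; rewrite mxE; apply: eq_dir => y.
  by rewrite (_ : i = lshift m2 k) ?col_mxEu //; apply: val_inj.
by rewrite (_ : i = rshift m1 k) ?col_mxEd //; apply: val_inj.
Qed.

Lemma mdir_row m n1 n2 (F : 'rV[R]_N -> 'M[C]_(m, n1)) (G : 'rV[R]_N -> 'M[C]_(m, n2)) x X :
  mdir (fun y => row_mx (F y) (G y)) x X = row_mx (mdir F x X) (mdir G x X).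
Proof.
apply/matrixP => i j; rewrite !mxE; case: splitP => k jk; rewrite mxE; apply: eq_dir => y.
  by rewrite (_ : j = lshift n2 k) ?row_mxEl //; apply: val_inj.
by rewrite (_ : j = rshift n1 k) ?row_mxEr //; apply: val_inj.
Qed.

Lemma mcdiffN m n (F : 'rV[R]_N -> 'M[C]_(m, n)) x : mcdiff F x -> mcdiff (fun y => - F y) x.
Proof.
move=> dF i j; rewrite (_ : (fun y => _) = (fun y => - F y i j)); first exact: cdiffN.
by apply/funext => y; rewrite mxE.
Qed.

Lemma mdirN m n (F : 'rV[R]_N -> 'M[C]_(m, n)) x X : mcdiff F x ->
  mdir (fun y => - F y) x X = - mdir F x X.
Proof.
move=> dF; apply/eqP; rewrite -addr_eq0 -mdirD //; last exact: mcdiffN.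
rewrite (_ : (fun y => _) = (fun=> 0)) ?mdir_cst //.
by apply/funext => y; rewrite addNr.
Qed.

Lemma mcdiff_scalar (u : 'rV[R]_N -> C) x : cdiff u x -> mcdiff (fun y => (u y)%:M : 'M[C]_1) x.
Proof.
move=> du i j; rewrite (_ : (fun y => _) = u) //.
by apply/funext => y; rewrite !ord1 mxE eqxx mulr1n.
Qed.

Lemma mdir_scalar (u : 'rV[R]_N -> C) x X :
  mdir (fun y => (u y)%:M : 'M[C]_1) x X = (dir u x X)%:M.
Proof.
apply/matrixP => i j; rewrite !ord1 !mxE eqxx mulr1n; apply: eq_dir => y.
by rewrite !mxE eqxx mulr1n.
Qed.

Lemma gminus_blocks (u : C) (x y : 'cV[C]_s) :
  gminus_mx u x y = block_mx 0 0 (col_mx x (col_mx y ((u * ('i : C))%:M : 'M[C]_1)))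
   (block_mx 0 0 (col_mx (0 : 'M[C]_s) y^T) (block_mx 0 0 (- x^T) 0)).
Proof.
by rewrite /gminus_mx /alg_mx row_mx0 trmx0 !oppr0 !sc0.
Qed.

Lemma mdir_gminus (u : 'rV[R]_N -> C) (a b : 'rV[R]_N -> 'cV[C]_s) x X :
  cdiff u x -> mcdiff a x -> mcdiff b x ->
  mcdiff (fun y => gminus_mx (u y) (a y) (b y)) x /\
  mdir (fun y => gminus_mx (u y) (a y) (b y)) x X =
  gminus_mx (dir u x X) (mdir a x X) (mdir b x X).
Proof.
move=> du da db.
have dui : cdiff (fun y => u y * ('i : C)) x by apply: cdiffM => //; exact: cdiff_cst.
have -> : (fun y => gminus_mx (u y) (a y) (b y)) = (fun y =>
   col_mx (row_mx 0 0) (row_mx (col_mx (a y) (col_mx (b y) ((u y * ('i : C))%:M : 'M[C]_1)))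
   (col_mx (row_mx 0 0) (row_mx (col_mx (0 : 'M[C]_s) (b y)^T)
      (col_mx (row_mx 0 0) (row_mx (- (a y)^T) 0)))))).
  by apply/funext => y; rewrite gminus_blocks !block_mxEv.
split.
  do ![apply: mcdiff_col|apply: mcdiff_row|apply: mcdiff_cst|apply: mcdiff_scalar|
       apply: mcdiffN|apply: mcdiff_tr|exact: da|exact: db|exact: dui].
rewrite gminus_blocks !block_mxEv.
rewrite !(mdir_col, mdir_row, mdir_cst, mdir_scalar) mdirN ?mdir_tr; last exact: mcdiff_tr.
have -> : dir (fun y => u y * ('i : C)) x X = dir u x X * ('i : C).
  by rewrite (dirM X du (cdiff_cst _ x)) dir_cst mulr0 addr0.
by rewrite !row_mx0.
Qed.

End BlockDerivatives.

(** * The CR structure and its Levi foliation *)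

Section Conjugation.
Context {R : realType}.
Local Notation C := R[i].

Lemma conjvK k l (X : 'M[C]_(k, l)) : conjv (conjv X) = X.
Proof. by apply/matrixP => i j; rewrite !mxE /= conjcK. Qed.

Lemma conjvM k l q (X : 'M[C]_(k, l)) (Y : 'M[C]_(l, q)) : conjv (X *m Y) = conjv X *m conjv Y.
Proof. exact: map_mxM. Qed.

Lemma conjvD k l (X Y : 'M[C]_(k, l)) : conjv (X + Y) = conjv X + conjv Y.
Proof. exact: map_mxD. Qed.

Lemma conjvN k l (X : 'M[C]_(k, l)) : conjv (- X) = - conjv X.
Proof. exact: map_mxN. Qed.

Lemma conjvZ k l (a : C) (X : 'M[C]_(k, l)) : conjv (a *: X) = conjc a *: conjv X.
Proof. exact: map_mxZ. Qed.

Lemma conjv0 k l : conjv (0 : 'M[C]_(k, l)) = 0.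
Proof. exact: map_mx0. Qed.

Lemma conjv_sum k l (I : Type) (r : seq I) (F : I -> 'M[C]_(k, l)) :
  conjv (\sum_(i <- r) F i) = \sum_(i <- r) conjv (F i).
Proof.
elim: r => [|i r IH]; first by rewrite !big_nil conjv0.
by rewrite !big_cons conjvD IH.
Qed.

Lemma conjv_tr k l (X : 'M[C]_(k, l)) : conjv X^T = (conjv X)^T.
Proof. by apply/matrixP => i j; rewrite !mxE. Qed.

End Conjugation.

Section Smoothness.
Context {R : realType} {N : nat}.
Local Notation C := R[i].
Variable B : set 'rV[R]_N.
Hypothesis oB : open B.

(** The iterated derivatives in the definition of smoothness stay, up to equality on
    the open set, in the class of functions satisfying [CK] for all orders. *)
Lemma CK_csmooth (f : 'rV[R]_N -> C) : (forall k, CK B k f) -> csmooth_on B f.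
Proof.
have H vs : forall f : 'rV[R]_N -> C, (forall k, CK B k f) ->
    exists2 f' : 'rV[R]_N -> C, forall k, CK B k f' & forall x, B x ->
      foldr (fun v g => 'D_v g) (fun y => complex.Re (f y)) vs x = complex.Re (f' x) /\
      foldr (fun v g => 'D_v g) (fun y => complex.Im (f y)) vs x = complex.Im (f' x).
  elim: vs => [|v vs IH] g Hg; first by exists g.
  have [g' Hg' E] := IH g Hg.
  exists (fun x => dir g' x (complexify v)).
    by move=> k; apply: (CK_dir oB (Hg' k.+1)) => j; apply: CK_cst.
  move=> x Bx; have nB : \forall y \near x, B y by apply: open_nbhs_nbhs.
  have dg := CK_cdiff (Hg' 0) Bx.
  rewrite dir_complexify //; case: (dg) => d1 d2.
  by split => /=; rewrite -(deriveE _ _) //; apply: near_eq_derive;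
    apply: filterS nB => y By; case: (E y By).
move=> Hf; split=> vs x Bx; have [f' Hf' E] := H vs f Hf;
  have nB : (\forall y \near x, B y) by [apply: open_nbhs_nbhs];
  have [d1 d2] := CK_cdiff (Hf' 0) Bx.
  by apply: near_eq_differentiable d1; apply: filterS nB => y By; case: (E y By).
by apply: near_eq_differentiable d2; apply: filterS nB => y By; case: (E y By).
Qed.

Lemma smooth_real (f : 'rV[R]_N -> R) : smooth_on B f -> csmooth_on B (fun x => (f x)%:C).
Proof.
move=> Hf; split => //= vs x Bx.
have -> : foldr (fun v g => 'D_v g) (fun=> 0 : R) vs = (fun=> 0) :> ('rV[R]_N -> R).
  elim: vs => [//|v vs IH] /=; rewrite IH; apply/funext => y; exact: derive_cst.
exact: differentiable_cst.
Qed.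

Lemma field_smooth_lin (a : C) (V W : field R N) : field_smooth_on B V -> field_smooth_on B W ->
  field_smooth_on B (fun x => a *: V x + W x).
Proof.
move=> HV HW j; apply: CK_csmooth => k.
apply: (@CK_congr _ _ _ oB k (fun x => a * V x 0 j + W x 0 j)); first by move=> x _; rewrite !mxE.
apply: (CK_add oB); last exact: CK_smooth.
by apply: (CK_mul oB); [exact: CK_cst|exact: CK_smooth].
Qed.

Lemma field_smooth_conj (V : field R N) : field_smooth_on B V ->
  field_smooth_on B (fun x => conjv (V x)).
Proof.
move=> HV j; apply: CK_csmooth => k.
apply: (@CK_congr _ _ _ oB k (fun x => (V x 0 j)^*)); first by move=> x _; rewrite !mxE.
by apply: CK_conj => //; apply: CK_smooth.
Qed.

Lemma field_smooth0 : field_smooth_on B (fun=> 0).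
Proof.
move=> j; apply: CK_csmooth => k; apply: (@CK_congr _ _ _ oB k (fun=> 0)).
  by move=> x _; rewrite mxE.
exact: CK_cst.
Qed.

Lemma field_smooth_sum (n : nat) (t : 'I_n -> C) (V : 'I_n -> field R N) :
  (forall i, field_smooth_on B (V i)) -> field_smooth_on B (fun x => \sum_i t i *: V i x).
Proof.
move=> HV.
have H (r : seq 'I_n) : field_smooth_on B (fun x => \sum_(i <- r) t i *: V i x).
  elim: r => [|i r IH].
    rewrite (_ : (fun x => _) = (fun=> 0)); first exact: field_smooth0.
    by apply/funext => x; rewrite big_nil.
  rewrite (_ : (fun x => _) = (fun x => t i *: V i x + \sum_(i <- r) t i *: V i x)).
    exact: field_smooth_lin.
  by apply/funext => x; rewrite big_cons.
exact: H.
Qed.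

End Smoothness.

Lemma csmooth_sub (R : realType) N (B B' : set 'rV[R]_N) (f : 'rV[R]_N -> R[i]) :
  B' `<=` B -> csmooth_on B f -> csmooth_on B' f.
Proof. by move=> BB [h1 h2]; split=> vs x /BB Bx; [apply: h1|apply: h2]. Qed.

Lemma field_smooth_sub (R : realType) N (B B' : set 'rV[R]_N) (V : field R N) :
  B' `<=` B -> field_smooth_on B V -> field_smooth_on B' V.
Proof. by move=> BB H k; apply: csmooth_sub (H k). Qed.

Section Model.
Context {R : realType} {s m : nat}.
Local Notation C := R[i].
Local Notation pt := 'rV[R]_(dimM s m).
Local Notation vec := 'rV[C]_(dimM s m).
Variable M : graph R s m.
Hypothesis hM : two_nondegenerate_model M.

Lemma dom_open : open (dom M).
Proof. by case: hM. Qed.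

Lemma coord_z_CK k a : CK (dom M) k (fun x => coord_z x a 0).
Proof.
apply: (@CK_congr _ _ _ dom_open k (fun x : pt => (x 0 (rshift 1 (lshift _ (lshift s a))))%:C +
   ('i : C) * (x 0 (rshift 1 (lshift _ (rshift s a))))%:C)).
  move=> x _; rewrite mxE imE; apply: complex_eq => /=; ring.
apply: (CK_add dom_open); first exact: CK_coord dom_open _ _.
apply: (CK_mul dom_open); first exact: CK_cst dom_open _ _.
exact: CK_coord dom_open _ _.
Qed.

Lemma coord_zeta_CK k a : CK (dom M) k (fun x => coord_zeta x a 0).
Proof.
apply: (@CK_congr _ _ _ dom_open k (fun x : pt => (x 0 (rshift 1 (rshift _ (lshift m a))))%:C +
   ('i : C) * (x 0 (rshift 1 (rshift _ (rshift m a))))%:C)).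
  move=> x _; rewrite mxE imE; apply: complex_eq => /=; ring.
apply: (CK_add dom_open); first exact: CK_coord dom_open _ _.
apply: (CK_mul dom_open); first exact: CK_cst dom_open _ _.
exact: CK_coord dom_open _ _.
Qed.

(** The defining function of the hypersurface is polynomial in z and its conjugate, with
    coefficients that are analytic on the domain. *)
Lemma coord_w_CK k : CK (dom M) k (coord_w M).
Proof.
have oM := dom_open; case: hM => _ _ _ [_ _ aH aS _].
have smH a b : CK (dom M) k (fun x => graphH M (coord_zeta x) a b).
  by apply: CK_smooth; case: (aH a b) => -[h1 _] [h2 _].
have smS a b : CK (dom M) k (fun x => graphS M (coord_zeta x) a b).
  by apply: CK_smooth; case: (aS a b) => -[h1 _] [h2 _].
have form (u v : pt -> 'cV[C]_s) (A : pt -> 'M[C]_s) :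
    (forall a, CK (dom M) k (fun x => u x a 0)) -> (forall a, CK (dom M) k (fun x => v x a 0)) ->
    (forall a b, CK (dom M) k (fun x => A x a b)) ->
    CK (dom M) k (fun x => ((u x)^T *m A x *m v x) 0 0).
  move=> hu hv hA.
  apply: (@CK_congr _ _ _ oM k (fun x => \sum_b (\sum_a u x a 0 * A x a b) * v x b 0)).
    move=> x _; rewrite mxE; apply: eq_bigr => b _; rewrite mxE; congr (_ * _).
    by apply: eq_bigr => a _; rewrite mxE.
  by apply: (CK_sum oM) => b; apply: (CK_mul oM) => //; apply: (CK_sum oM) => a; apply: (CK_mul oM).
have cz a : CK (dom M) k (fun x => (conjv (coord_z x)) a 0).
  apply: (@CK_congr _ _ _ oM k (fun x => (coord_z x a 0)^*)); first by move=> x _; rewrite !mxE.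
  by apply: (CK_conj oM); exact: coord_z_CK.
apply: (CK_add oM); last first.
  apply: (CK_mul oM); first exact: CK_cst oM _ _.
  exact: CK_coord oM _ _.
apply: (CK_add oM); first by apply: form => // a; exact: coord_z_CK.
have hq := form _ _ _ cz cz smS.
apply: (@CK_congr _ _ _ oM k (fun x => 2^-1 *
   (((conjv (coord_z x))^T *m graphS M (coord_zeta x) *m conjv (coord_z x)) 0 0 +
    (((conjv (coord_z x))^T *m graphS M (coord_zeta x) *m conjv (coord_z x)) 0 0)^*))).
  by move=> x _; case: (_ 0 0) => a b; apply: complex_eq; rewrite ?ReM ?ImM /=; field.
apply: (CK_mul oM); first exact: CK_cst oM _ _.
by apply: (CK_add oM) => //; apply: (CK_conj oM).
Qed.

(** The restrictions to the hypersurface of the ambient holomorphic coordinates; their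
    conjugates are the equations of the (1,0) bundle. *)
Definition cr_function (f : pt -> C) : Prop :=
  [\/ f = coord_w M, exists a, f = (fun y => coord_z y a 0) | exists a, f = (fun y => coord_zeta y a 0)].

Lemma calHP x X : calH M x X <->
  dom M x /\ forall f, cr_function f -> dir (fun y => (f y)^*) x X = 0.
Proof.
split=> [[dx h1 h2 h3]|[dx H]]; first by split=> // f [->|[a ->]|[a ->]].
split=> // [|a|a]; apply: H; [exact: Or31|apply: Or32; by exists a|apply: Or33; by exists a].
Qed.

Lemma cr_CK k f : cr_function f -> CK (dom M) k (fun y => (f y)^*).
Proof.
move=> hf; apply: (CK_conj dom_open); case: hf => [->|[a ->]|[a ->]];
  [exact: coord_w_CK|exact: coord_z_CK|exact: coord_zeta_CK].
Qed.

Lemma calH_dom x X : calH M x X -> dom M x.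
Proof. by case. Qed.

Lemma calH_lin x a X Y : calH M x X -> calH M x Y -> calH M x (a *: X + Y).
Proof.
move=> /calHP[dx hX] /calHP[_ hY]; apply/calHP; split=> // f hf.
by rewrite dir_lin hX // hY // mulr0 addr0.
Qed.

Lemma calH0 x : dom M x -> calH M x 0.
Proof. by move=> dx; apply/calHP; split=> // f hf; rewrite dir0. Qed.

Lemma calHZ x a X : calH M x X -> calH M x (a *: X).
Proof. by move=> hX; rewrite -[_ *: _]addr0; apply: calH_lin => //; apply: calH0 (calH_dom hX). Qed.

Lemma calHD x X Y : calH M x X -> calH M x Y -> calH M x (X + Y).
Proof. by move=> hX hY; rewrite -[X]scale1r; apply: calH_lin. Qed.

Lemma calHB x X Y : calH M x X -> calH M x Y -> calH M x (X - Y).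
Proof. by move=> hX hY; rewrite addrC -scaleN1r; apply: calH_lin. Qed.

Lemma calH_sum x (n : nat) (F : 'I_n -> vec) : dom M x -> (forall i, calH M x (F i)) ->
  calH M x (\sum_i F i).
Proof. by move=> dx hF; apply: big_ind => // [|X Y]; [exact: calH0|exact: calHD]. Qed.

Lemma K2_calH x v : K2 M x v -> calH M x v.
Proof. by case. Qed.

Lemma K2_dom x v : K2 M x v -> dom M x.
Proof. by case=> /calH_dom. Qed.

(** The bundle K2 is defined by quantifying over local sections; the rank hypothesis,
    which presents it as a row space, is what makes it linear. *)
Lemma K2_lin x a v w : K2 M x v -> K2 M x w -> K2 M x (a *: v + w).
Proof.
move=> hv hw; have dx := K2_dom hv; case: hM => _ _ _ [_ _ _ _ /(_ x dx) [[K _ HK] _]].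
by apply/HK; apply: addmx_sub; [apply: scalemx_sub|]; apply/HK.
Qed.

Lemma K20 x : dom M x -> K2 M x 0.
Proof.
move=> dx; case: hM => _ _ _ [_ _ _ _ /(_ x dx) [[K _ HK] _]].
by apply/HK; apply: sub0mx.
Qed.

Lemma K2Z x a v : K2 M x v -> K2 M x (a *: v).
Proof. by move=> hX; rewrite -[_ *: _]addr0; apply: K2_lin => //; apply: K20 (K2_dom hX). Qed.

Lemma K2D x v w : K2 M x v -> K2 M x w -> K2 M x (v + w).
Proof. by move=> hX hY; rewrite -[v]scale1r; apply: K2_lin. Qed.

Lemma K2_sum x (n : nat) (F : 'I_n -> vec) : dom M x -> (forall i, K2 M x (F i)) ->
  K2 M x (\sum_i F i).
Proof. by move=> dx hF; apply: big_ind => // [|X Y]; [exact: K20|exact: K2D]. Qed.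

(** The (1,0) fields are those that annihilate the conjugates of the ambient
    coordinates, and the bracket of two fields annihilating a function
    annihilates it too. *)
Lemma calH_involutive x V W : local_section (calH M) x V -> local_section (calH M) x W ->
  calH M x (lie_bracket V W x).
Proof.
move=> [B1 [oB1 B1x] [sV hV]] [B2 [oB2 B2x] [sW hW]].
have dx := calH_dom (hV x B1x).
apply/calHP; split=> // f hf.
rewrite (dir_lie dom_open (cr_CK 1 hf) dx); first last.
- by move=> j; apply: CK_cdiff (CK_smooth 0 (sW j)) B2x.
- by move=> j; apply: CK_cdiff (CK_smooth 0 (sV j)) B1x.
rewrite (@near_eq_dir _ _ (fun y => dir (fun y0 => (f y0)^*) y (W y)) (fun=> 0)); last first.
  apply: filterS (open_nbhs_nbhs (conj oB2 B2x)) => y By.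
  by have /calHP[_ ->] := hW y By.
rewrite (@near_eq_dir _ _ (fun y => dir (fun y0 => (f y0)^*) y (V y)) (fun=> 0)); last first.
  apply: filterS (open_nbhs_nbhs (conj oB1 B1x)) => y By.
  by have /calHP[_ ->] := hV y By.
by rewrite !dir_cst subrr.
Qed.

(** Differentiating the linear equations of the bundle at a zero of the section, only
    the term in which the section is differentiated survives. *)
Lemma calH_deriv x V X : local_section (calH M) x V -> V x = 0 ->
  calH M x (\row_k dir (fun y => V y 0 k) x X).
Proof.
move=> [B [oB Bx] [sV hV]] V0; have dx := calH_dom (hV x Bx).
apply/calHP; split=> // f hf.
have := @near_eq_dir _ _ (fun y => dir (fun y0 => (f y0)^*) y (V y)) (fun=> 0) x X.
rewrite dir_cst => E; rewrite -[RHS]E; last first.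
  apply: filterS (open_nbhs_nbhs (conj oB Bx)) => y By.
  by have /calHP[_ ->] := hV y By.
have dV j : cdiff (fun y => V y 0 j) x by apply: CK_cdiff (CK_smooth 0 (sV j)) Bx.
have df j : cdiff (fun y => cpartial (fun y0 => (f y0)^*) y j) x.
  exact: CK_cdiff (CK_cpartial j (cr_CK 1 hf)) dx.
rewrite [RHS]dir_sum; last by move=> j; apply: cdiffM.
apply: eq_bigr => j _; rewrite dirM // V0 !mxE mul0r addr0.
by [].
Qed.

End Model.

(** * The local quotient by the Levi foliation *)

Section Quotient.
Context {R : realType} {s m : nat}.
Local Notation C := R[i].
Local Notation pt := 'rV[R]_(dimM s m).
Local Notation vec := 'rV[C]_(dimM s m).
Local Notation nvec := 'rV[C]_(1 + (s + s)).
Variable M : graph R s m.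
Hypothesis hM : two_nondegenerate_model M.
Variable pi : pt -> 'rV[R]_(1 + (s + s)).
Hypothesis hpi : local_quotient M pi.
Let oM := dom_open hM.

Definition picoord (k : 'I_(1 + (s + s))) (y : pt) : C := (pi y 0 k)%:C.

Lemma picoord_CK n k : CK (dom M) n (picoord k).
Proof. by case: hpi => h _ _ _; apply: CK_smooth; apply: smooth_real. Qed.

Lemma dpiE x X k : dpi pi x X 0 k = dir (picoord k) x X.
Proof. by rewrite mxE. Qed.

Lemma dpi_lin x (a : C) X Y : dpi pi x (a *: X + Y) = a *: dpi pi x X + dpi pi x Y.
Proof. by apply/rowP => k; rewrite !mxE dir_lin. Qed.

Lemma dpi0 x : dpi pi x 0 = 0.
Proof. by apply/rowP => k; rewrite !mxE dir0. Qed.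

Lemma dpiD x X Y : dpi pi x (X + Y) = dpi pi x X + dpi pi x Y.
Proof. by rewrite -[X]scale1r dpi_lin !scale1r. Qed.

Lemma dpiZ x a X : dpi pi x (a *: X) = a *: dpi pi x X.
Proof. by rewrite -[_ *: X]addr0 dpi_lin dpi0 addr0. Qed.

Lemma dpiB x X Y : dpi pi x (X - Y) = dpi pi x X - dpi pi x Y.
Proof. by rewrite dpiD -scaleN1r dpiZ scaleN1r. Qed.

Lemma dpi_sum x (n : nat) (F : 'I_n -> vec) : dpi pi x (\sum_i F i) = \sum_i dpi pi x (F i).
Proof.
elim: n F => [|n IH] F; first by rewrite !big_ord0 dpi0.
by rewrite !big_ord_recl dpiD IH.
Qed.

Lemma dpi_conj x X : dom M x -> dpi pi x (conjv X) = conjv (dpi pi x X).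
Proof.
move=> dx; apply/rowP => k; rewrite !mxE.
rewrite -[X in _ = (dir _ _ X)^*]conjvK -dir_conj; last exact: CK_cdiff (picoord_CK 0 k) dx.
by apply: eq_dir => y; rewrite /= oppr0.
Qed.

Lemma dpi_real x v : dom M x -> dpi pi x (complexify v) = complexify (Dmap pi x v).
Proof.
move=> dx; apply/rowP => k; rewrite !mxE dir_complexify; last exact: CK_cdiff (picoord_CK 0 k) dx.
congr (_ +i* _); rewrite (_ : (fun y => _) = cst 0) //.
by rewrite diff_cst.
Qed.

Lemma complexify0 n (v : 'rV[R]_n) : complexify v = 0 -> v = 0.
Proof. by move=> /rowP H; apply/rowP => j; have := H j; rewrite !mxE => -[]. Qed.

Lemma complexifyE_Re n (X : 'rV[C]_n) :
  complexify (map_mx (@complex.Re R) X) = 2^-1 *: (X + conjv X).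
Proof.
by apply/rowP => j; rewrite !mxE; case: (X 0 j) => a b; apply: complex_eq; rewrite ?ReM ?ImM /=; field.
Qed.

Lemma complexifyE_Im n (X : 'rV[C]_n) :
  complexify (map_mx (@complex.Im R) X) = (- ('i : C) / 2) *: (X - conjv X).
Proof.
apply/rowP => j; rewrite !mxE; case: (X 0 j) => a b; rewrite imE.
by apply: complex_eq; rewrite ?ReM ?ImM /=; field.
Qed.

Lemma sum_dist_K2 x v : K2 M x v ->
  sum_dist (K2 M) (conj_dist (K2 M)) x (complexify (map_mx (@complex.Re R) v)) /\
  sum_dist (K2 M) (conj_dist (K2 M)) x (complexify (map_mx (@complex.Im R) v)).
Proof.
move=> hv; split.
  exists (2^-1 *: v), (2^-1 *: conjv v); split; first exact: K2Z.
    by rewrite /conj_dist /= conjvZ conjvK; exact: K2Z.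
  by rewrite complexifyE_Re scalerDr.
exists ((- ('i : C) / 2) *: v), (- ((- ('i : C) / 2) *: conjv v)); split; first exact: K2Z.
  by rewrite /conj_dist /= conjvN conjvZ conjvK -scaleNr; exact: K2Z.
by rewrite complexifyE_Im scalerBr.
Qed.

Lemma dpi_K2 x v : K2 M x v -> dpi pi x v = 0.
Proof.
move=> hv; have dx := K2_dom hv; case: hpi => _ _ H _; have [h1 h2] := sum_dist_K2 hv.
by rewrite [v]ReIm_vec dpiD dpiZ (H x dx _).2 // (H x dx _).2 // scaler0 addr0.
Qed.

Lemma dpi_K2bar x v : K2 M x v -> dpi pi x (conjv v) = 0.
Proof. by move=> hv; rewrite dpi_conj ?dpi_K2 ?conjv0 //; exact: K2_dom hv. Qed.

Lemma dpi_ReIm x X : dom M x -> dpi pi x X = 0 ->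
  Dmap pi x (map_mx (@complex.Re R) X) = 0 /\ Dmap pi x (map_mx (@complex.Im R) X) = 0.
Proof.
move=> dx h; have h' : dpi pi x (conjv X) = 0 by rewrite dpi_conj // h conjv0.
split; apply: complexify0; rewrite -dpi_real //.
  by rewrite complexifyE_Re dpiZ dpiD h h' addr0 scaler0.
by rewrite complexifyE_Im dpiZ dpiB h h' subrr scaler0.
Qed.

(** The definition of the quotient characterizes real kernel vectors; a complex one is
    treated through its real and imaginary parts. *)
Lemma dpi_ker x X : dom M x -> dpi pi x X = 0 ->
  exists Y Z, [/\ K2 M x Y, K2 M x Z & X = Y + conjv Z].
Proof.
move=> dx h; have [h1 h2] := dpi_ReIm dx h; case: hpi => _ _ H _.
have [Y1 [Z1 [hY1 hZ1 E1]]] : sum_dist (K2 M) (conj_dist (K2 M)) x (complexify (map_mx (@complex.Re R) X)).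
  by apply/H => //; rewrite dpi_real // h1; apply/rowP => j; rewrite !mxE.
have [Y2 [Z2 [hY2 hZ2 E2]]] : sum_dist (K2 M) (conj_dist (K2 M)) x (complexify (map_mx (@complex.Im R) X)).
  by apply/H => //; rewrite dpi_real // h2; apply/rowP => j; rewrite !mxE.
exists (('i : C) *: Y2 + Y1), (conjv (('i : C) *: Z2 + Z1)); split.
- exact: K2_lin.
- rewrite conjvD conjvZ; apply: K2_lin => //; exact: hZ2.
- rewrite conjvK {1}[X]ReIm_vec E1 E2; apply/rowP => j; rewrite !mxE.
  by ring.
Qed.

Lemma dpi_surj x (c : nvec) : dom M x -> exists X, dpi pi x X = c.
Proof.
move=> dx; case: hpi => _ H _ _.
have [v1 E1] := H x dx (map_mx (@complex.Re R) c).
have [v2 E2] := H x dx (map_mx (@complex.Im R) c).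
exists (complexify v1 + ('i : C) *: complexify v2).
by rewrite dpiD dpiZ E1 E2 -ReIm_vec.
Qed.

Lemma Dmap_section x : dom M x ->
  exists A : 'M[R]_(1 + (s + s), dimM s m), forall k, Dmap pi x (k *m A) = k.
Proof.
move=> dx; case: hpi => sm H _ _.
have H' (i : 'I_(1 + (s + s))) : exists v : pt, Dmap pi x v = delta_mx 0 i.
  have [v E] := H x dx (delta_mx 0 i); exists v.
  move: E; rewrite dpi_real // => E; apply/rowP => j.
  by move/rowP/(_ j): E; rewrite !mxE => -[].
have [v Hv] := choice H'.
exists (\matrix_i v i) => k.
have [J HJ] := Dmap_lin pi x; have {}HJ : forall w, Dmap pi x w = w *m J.
  by apply: HJ => i; exact: (sm i [::] x dx).
have VJ : (\matrix_i v i) *m J = 1%:M.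
  by apply/row_matrixP => i; rewrite row_mul rowK -HJ Hv row1.
by rewrite HJ -mulmxA VJ mulmx1.
Qed.

Lemma pi_regular p : dom M p ->
  (\forall x \near p, forall k, differentiable (fun y => pi y 0 k) x) /\
  (forall k j, {for p, continuous (fun x => 'D_(delta_mx 0 j) (fun y => pi y 0 k) x)}).
Proof.
move=> dp; case: hpi => sm _ _ _; split.
  by apply: filterS (open_nbhs_nbhs (conj oM dp)) => x dx k; exact: (sm k [::] x dx).
move=> k j; apply: differentiable_continuous.
exact: (sm k [:: delta_mx 0 j] p dp).
Qed.

Lemma leaf_curve p v : dom M p -> Dmap pi p v = 0 -> exists c, curve_in (leaf M pi p) p v c.
Proof.
move=> dp Dv; have [h1 h2] := pi_regular dp; have [A HA] := Dmap_section dp.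
have [c [c0 cP dc]] := level_curve h1 h2 HA Dv.
exists c; split => //.
have nd : \forall t \near (0 : R), dom M (c t).
  apply: (curve_continuous dc); rewrite c0; exact: open_nbhs_nbhs.
by apply: filterS2 cP nd => t.
Qed.

(** The real and imaginary parts of a complex kernel vector are again in the kernel of
    the real differential, hence are velocities of curves in the leaf. *)
Lemma leaf_deriv_K2 p f f' X d : dom M p -> dpi pi p X = 0 -> cdiff f' p ->
  (\forall y \near p, leaf M pi p y -> f y = f' y) ->
  is_leaf_deriv (leaf M pi p) f p X d <-> d = dir f' p X.
Proof.
move=> dp dX df ff'; have [h1 h2] := dpi_ReIm dp dX.
by apply: leaf_derivP => //; apply: leaf_curve.
Qed.

(** The zero function is another extension of the same function on the leaf. *)
Lemma leaf_dir0 p f X : dom M p -> dpi pi p X = 0 -> cdiff f p ->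
  (\forall y \near p, leaf M pi p y -> f y = 0) -> dir f p X = 0.
Proof.
move=> dp dX df f0.
have ff : \forall y \near p, leaf M pi p y -> f y = f y by apply: filterS f0.
have E := (leaf_deriv_K2 _ dp dX df ff).2 erefl.
by rewrite ((leaf_deriv_K2 _ dp dX (cdiff_cst 0 p) f0).1 E) dir_cst.
Qed.

(** The Levi kernel and its conjugate span the complexified tangent space of the leaf,
    so the real and imaginary parts fall under [level_const]. *)
Lemma leaf_const p f : dom M p ->
  (\forall y \near p, leaf M pi p y -> cdiff f y /\ forall v, K2 M y v ->
     dir f y v = 0 /\ dir f y (conjv v) = 0) ->
  \forall y \near p, leaf M pi p y -> f y = f p.
Proof.
move=> dp Hf; have [h1 h2] := pi_regular dp; have [A HA] := Dmap_section dp.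
have [r0 r00 Hr] := near_ballN (filterI Hf (open_nbhs_nbhs (conj oM dp))).
have sm : forall k, smooth_on (dom M) (fun x => pi x 0 k) by case: hpi.
have tang y v : dom M y -> leaf M pi p y -> `|y - p| < r0 -> Dmap pi y v = 0 ->
    dir f y (complexify v) = 0.
  move=> dy ly yr Dv; have [/(_ ly) [df H0] _] := Hr y yr.
  have [|Y [Z [hY hZ ->]]] := @dpi_ker y (complexify v) dy.
    by rewrite dpi_real // Dv; apply/rowP => j; rewrite !mxE.
  rewrite -[Y]scale1r dir_lin (H0 _ hY).1 (H0 _ hZ).2 mulr0 addr0 //.
have part (g : pt -> R) : (forall y, `|y - p| < r0 -> leaf M pi p y ->
     differentiable g y /\ forall v, Dmap pi y v = 0 -> 'd g y v = 0) ->
   exists2 r : R, 0 < r & forall y : pt, `|y - p| < r -> leaf M pi p y -> g y = g p.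
  move=> Hg; have [|r r_0 H] := @level_const _ _ _ pi p A h1 h2 HA g r0 r00.
    move=> y yr Py; have [_ dy] := Hr y yr; have [dg H0] := Hg y yr (conj dy Py).
    by split=> // [k|]; [exact: (sm k [::] y dy)|exact: Dmap_section].
  by exists r => // y yr [_ Py]; apply: H.
have [r1 r10 H1] : exists2 r : R, 0 < r & forall y : pt, `|y - p| < r -> leaf M pi p y ->
    complex.Re (f y) = complex.Re (f p).
  apply: part => y yr ly; have [/(_ ly) [[d1 d2] H0] dy] := Hr y yr; split=> // v Dv.
  by have := tang y v dy ly yr Dv; rewrite dir_complexify // => -[].
have [r2 r20 H2] : exists2 r : R, 0 < r & forall y : pt, `|y - p| < r -> leaf M pi p y ->
    complex.Im (f y) = complex.Im (f p).
  apply: part => y yr ly; have [/(_ ly) [[d1 d2] H0] dy] := Hr y yr; split=> // v Dv.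
  by have := tang y v dy ly yr Dv; rewrite dir_complexify // => -[].
apply: (@ballN_near _ _ _ _ (Num.min r1 r2)); first by rewrite lt_min r10.
move=> y; rewrite lt_min => /andP[y1 y2] ly; apply: complex_eq; [exact: H1|exact: H2].
Qed.

End Quotient.

(** * Moving frames along a leaf *)

Section Frame.
Context {R : realType} {s m : nat}.
Local Notation C := R[i].
Local Notation pt := 'rV[R]_(dimM s m).
Local Notation vec := 'rV[C]_(dimM s m).
Local Notation d := (1 + (s + s))%N.
Variable M : graph R s m.
Hypothesis hM : two_nondegenerate_model M.
Variable pi : pt -> 'rV[R]_d.
Hypothesis hpi : local_quotient M pi.
Variable e : 'I_m -> field R (dimM s m).
Hypothesis he : kernel_frame M e.
Let oM := dom_open hM.

Lemma e_K2 y b : dom M y -> K2 M y (e b y).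
Proof.
move=> dy; case: he => _ /(_ y dy) [_ H]; apply/H.
by rewrite -[e b y](rowK (fun a => e a y)); exact: row_sub.
Qed.

Lemma K2_coords y v : K2 M y v -> exists t : 'I_m -> C, v = \sum_b t b *: e b y.
Proof.
move=> hv; case: he => _ /(_ y (K2_dom hv)) [_ H].
have /submxP [D ->] := (H v).1 hv; exists (fun b => D 0 b).
by rewrite mulmx_sum_row; apply: eq_bigr => b _; rewrite rowK.
Qed.

Lemma K2_section y v : K2 M y v ->
  exists V : field R (dimM s m), [/\ local_section (K2 M) y V, V y = v & field_smooth_on (dom M) V].
Proof.
move=> hv; have [t E] := K2_coords hv; have dy := K2_dom hv.
have sm : field_smooth_on (dom M) (fun x => \sum_b t b *: e b x).
  by apply: (field_smooth_sum oM) => b; case: he.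
exists (fun x => \sum_b t b *: e b x); split => //.
exists (dom M) => //; split=> // x dx.
by apply: (K2_sum hM) => // b; apply: (K2Z hM); apply: e_K2.
Qed.

(** Sections of the Levi kernel are tangent to the leaves, so V annihilates the
    components of pi, and of the two terms of the bracket of derivations
    [dir_lie] only the one that differentiates W remains. *)
Lemma dpi_bracket y (V W : field R (dimM s m)) k : dom M y -> local_section (K2 M) y V ->
  (forall j, cdiff (fun x => W x 0 j) y) ->
  dpi pi y (lie_bracket V W y) 0 k = dir (fun x => dpi pi x (W x) 0 k) y (V y).
Proof.
move=> dy [B [oB By] [sV hV]] dW; rewrite dpiE.
rewrite (dir_lie oM (picoord_CK hpi 1 k) dy); [|by move=> j; apply: CK_cdiff (CK_smooth 0 (sV j)) By|exact: dW].
rewrite (@near_eq_dir _ _ (fun x => dir (picoord pi k) x (V x)) (fun=> 0)); last first.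
  apply: filterS (open_nbhs_nbhs (conj oB By)) => x Bx.
  by rewrite -dpiE (dpi_K2 hM hpi (hV x Bx)) mxE.
by rewrite dir_cst subr0; apply: eq_dir => x; rewrite dpiE.
Qed.

Variables (p : pt) (phi : pt -> symmap R s m).
Hypothesis dp : dom M p.
Local Notation L := (leaf M pi p).
Hypothesis phiF : forall y, L y -> isF M y (phi y).
Variables (B : set pt) (g : field R (dimM s m)) (f : 'I_s -> field R (dimM s m)).
Hypothesis oB : open B.
Hypothesis Bp : B p.
Hypothesis Bdom : B `<=` dom M.
Hypothesis smg : field_smooth_on B g.
Hypothesis smf : forall j, field_smooth_on B (f j).
Hypothesis fH : forall y j, B y -> calH M y (f j y).
Hypothesis fphi : forall y, B y -> L y ->
  s20 (phi y) (g y) = 1 /\ rep_basis M y (phi y) (f ^~ y).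

Lemma Lp : L p.
Proof. by []. Qed.

Lemma sec_f y j : B y -> local_section (calH M) y (f j).
Proof. by move=> By; exists B => //; split=> // x Bx; apply: fH. Qed.

Lemma sec_fb y j : B y -> local_section (conj_dist (calH M)) y (fun x => conjv (f j x)).
Proof.
move=> By; exists B => //; split; first exact: field_smooth_conj.
by move=> x Bx; rewrite /conj_dist /= conjvK; apply: fH.
Qed.

Lemma section_cdiff y (D : pt -> set vec) (V : field R (dimM s m)) j :
  local_section D y V -> cdiff (fun x => V x 0 j) y.
Proof. by move=> [A [oA Ay] [sV _]]; apply: CK_cdiff (CK_smooth 0 (sV j)) Ay. Qed.

(** The rows of [U10], [U01] and [G] represent on the quotient the bases of g_{-1,1},
    g_{-1,-1} and g_{-2,0} given by the adapted frame; on the leaf, [T] is invertible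
    and components in CTN are read with its inverse. *)
Definition U10 y : 'M[C]_(s, d) := \matrix_j dpi pi y (f j y).
Definition U01 y : 'M[C]_(s, d) := conjv (U10 y).
Definition G y : 'rV[C]_d := dpi pi y (g y).
Definition T y : 'M[C]_d := col_mx (G y) (col_mx (U10 y) (U01 y)).

Lemma row_U01 y j : B y -> row j (U01 y) = dpi pi y (conjv (f j y)).
Proof.
move=> /Bdom dy; rewrite (dpi_conj hpi) //; apply/rowP => k; rewrite !mxE; congr (_^*).
Qed.

Lemma U10_CK n j k : CK B n (fun y => U10 y j k).
Proof.
apply: (@CK_congr _ _ _ oB n (fun y => dir (picoord pi k) y (f j y))).
  by move=> y _; rewrite !mxE.
apply: (CK_dir oB); first exact: CK_sub Bdom (picoord_CK hpi _ k).
by move=> i; apply: CK_smooth; exact: smf.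
Qed.

Lemma U01_CK n j k : CK B n (fun y => U01 y j k).
Proof.
apply: (@CK_congr _ _ _ oB n (fun y => (U10 y j k)^*)); first by move=> y _; rewrite [RHS]mxE.
by apply: (CK_conj oB); exact: U10_CK.
Qed.

Lemma G_CK n i k : CK B n (fun y => G y i k).
Proof.
apply: (@CK_congr _ _ _ oB n (fun y => dir (picoord pi k) y (g y))).
  by move=> y _; rewrite ord1 !mxE.
apply: (CK_dir oB); first exact: CK_sub Bdom (picoord_CK hpi _ k).
by move=> j; apply: CK_smooth.
Qed.

Lemma U10_diff y : B y -> mcdiff U10 y.
Proof. by move=> By i j; exact: CK_cdiff (U10_CK 0 i j) By. Qed.

Lemma U01_diff y : B y -> mcdiff U01 y.
Proof. by move=> By i j; exact: CK_cdiff (U01_CK 0 i j) By. Qed.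

Lemma T_diff y : B y -> mcdiff T y.
Proof.
move=> By; apply: mcdiff_col; first by move=> i j; exact: CK_cdiff (G_CK 0 i j) By.
by apply: mcdiff_col; [exact: U10_diff|exact: U01_diff].
Qed.

Lemma mulT k (z : 'M[C]_(k, 1)) (a b : 'M[C]_(k, s)) y :
  row_mx z (row_mx a b) *m T y = z *m G y + (a *m U10 y + b *m U01 y).
Proof. by rewrite /T !mul_row_col. Qed.

(** ** Values of the graded isomorphisms *)
Section Pointwise.
Variable y : pt.
Hypothesis By : B y.
Hypothesis Ly : L y.
Local Notation ph := (phi y).

Let dy : dom M y := Bdom By.

Lemma s11_lin (a : C) v w : calH M y v -> calH M y w -> s11 ph (a *: v + w) = a *: s11 ph v + s11 ph w.
Proof. by case: (phiF Ly) => _ [H _ _ _] _ _; apply: H. Qed.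

Lemma s11_K2 v : calH M y v -> s11 ph v = 0 <-> K2 M y v.
Proof. by case: (phiF Ly) => _ [_ _ H _] _ _; apply: H. Qed.

Lemma s1m_lin (a : C) v w : conj_dist (calH M) y v -> conj_dist (calH M) y w ->
  s1m ph (a *: v + w) = a *: s1m ph v + s1m ph w.
Proof. by case: (phiF Ly) => _ _ [H _ _ _] _; apply: H. Qed.

Lemma s1m_K2 v : conj_dist (calH M) y v -> s1m ph v = 0 <-> conj_dist (K2 M) y v.
Proof. by case: (phiF Ly) => _ _ [_ _ H _] _; apply: H. Qed.

Lemma Hbar_lin (a : C) v w : conj_dist (calH M) y v -> conj_dist (calH M) y w ->
  conj_dist (calH M) y (a *: v + w).
Proof. by rewrite /conj_dist /= conjvD conjvZ; exact: calH_lin. Qed.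

Lemma Hbar0 : conj_dist (calH M) y 0.
Proof. by rewrite /conj_dist /= conjv0; exact: calH0. Qed.

Lemma f_Hbar j : conj_dist (calH M) y (conjv (f j y)).
Proof. by rewrite /conj_dist /= conjvK; exact: fH. Qed.

Definition fcomb (c : 'cV[C]_s) : vec := \sum_j c j 0 *: f j y.

Lemma fcomb_calH c : calH M y (fcomb c).
Proof. by apply: calH_sum => // j; apply: calHZ; apply: fH. Qed.

Lemma s11_fcomb c : s11 ph (fcomb c) = c.
Proof.
have H (r : seq 'I_s) : calH M y (\sum_(j <- r) c j 0 *: f j y) /\
    s11 ph (\sum_(j <- r) c j 0 *: f j y) = \sum_(j <- r) c j 0 *: delta_mx j 0.
  elim: r => [|j r [IH1 IH2]].
    rewrite !big_nil; split; first exact: calH0.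
    by apply/(s11_K2 (calH0 dy)); exact: (K20 hM).
  rewrite !big_cons; split; first by apply: calH_lin => //; exact: fH.
  by rewrite s11_lin ?IH2 //; [congr (_ *: _ + _); case: (fphi By Ly) => _ /(_ j) []|exact: fH].
rewrite /fcomb (H _).2 [RHS]matrix_sum_delta; apply: eq_bigr => j _.
by rewrite big_ord1.
Qed.

Lemma calH_split v : calH M y v -> K2 M y (v - fcomb (s11 ph v)).
Proof.
move=> hv; have hc := fcomb_calH (s11 ph v).
apply/s11_K2; first exact: calHB.
by rewrite addrC -scaleN1r s11_lin // s11_fcomb scaleN1r addNr.
Qed.

Lemma dpi_fcomb c : dpi pi y (fcomb c) = c^T *m U10 y.
Proof.
rewrite /fcomb dpi_sum mulmx_sum_row; apply: eq_bigr => j _.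
by rewrite dpiZ mxE rowK.
Qed.

Lemma dpi_calH v : calH M y v -> dpi pi y v = (s11 ph v)^T *m U10 y.
Proof.
move=> hv; have h := dpi_K2 hM hpi (calH_split hv).
by move: h; rewrite dpiB dpi_fcomb => /eqP; rewrite subr_eq0 => /eqP.
Qed.

Lemma dpi_Hbar w : conj_dist (calH M) y w -> dpi pi y w = (conjv (s11 ph (conjv w)))^T *m U01 y.
Proof.
move=> hw; rewrite -[w in LHS]conjvK (dpi_conj hpi) // (dpi_calH hw).
by rewrite conjvM conjv_tr.
Qed.

Definition levi : 'M[C]_s := \matrix_j (s1m ph (conjv (f j y)))^T.

(** The component of an element of F on g_{-1,-1} is determined by its values on the
    conjugate frame, that is by the matrix [levi] of the Levi form. *)
Lemma s1m_Hbar w : conj_dist (calH M) y w -> s1m ph w = levi^T *m conjv (s11 ph (conjv w)).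
Proof.
move=> hw; set c := s11 ph (conjv w).
have H (r : seq 'I_s) : conj_dist (calH M) y (\sum_(j <- r) (conjv c) j 0 *: conjv (f j y)) /\
    s1m ph (\sum_(j <- r) (conjv c) j 0 *: conjv (f j y)) =
    \sum_(j <- r) (conjv c) j 0 *: s1m ph (conjv (f j y)).
  elim: r => [|j r [IH1 IH2]].
    rewrite !big_nil; split; first exact: Hbar0.
    apply/(s1m_K2 Hbar0); rewrite /conj_dist /= conjv0; exact: (K20 hM).
  rewrite !big_cons; split; first by apply: Hbar_lin => //; exact: f_Hbar.
  by rewrite s1m_lin ?IH2 //; exact: f_Hbar.
have [h1 h2] := H (index_enum 'I_s).
have E : conjv (fcomb c) = \sum_j (conjv c) j 0 *: conjv (f j y).
  by rewrite /fcomb conjv_sum; apply: eq_bigr => j _; rewrite conjvZ !mxE.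
have hk : conj_dist (calH M) y (-1 *: conjv (fcomb c) + w).
  by apply: Hbar_lin => //; rewrite E.
have : s1m ph (-1 *: conjv (fcomb c) + w) = 0.
  apply/(s1m_K2 hk); rewrite /conj_dist /= conjvD conjvZ conjvK.
  have -> : conjc (-1 : C) = -1 by apply: complex_eq => /=; rewrite ?oppr0.
  by rewrite scaleN1r addrC; exact: calH_split.
rewrite s1m_lin ?E // scaleN1r => /eqP; rewrite addrC subr_eq0 => /eqP ->; rewrite h2.
apply/colP => i; rewrite summxE [RHS]mxE; apply: eq_bigr => j _.
by rewrite !mxE mulrC.
Qed.

(** Nondegeneracy of the Levi form on the quotient by its kernel is contained in the
    surjectivity of the component on g_{-1,-1}. *)
Lemma levi_unit : levi \in unitmx.
Proof.
rewrite -row_full_unit -sub1mx; apply/row_subP => i.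
have [w hw E] : exists2 w, conj_dist (calH M) y w & s1m ph w = (row i 1%:M)^T.
  by case: (phiF Ly) => _ _ [_ H _ _] _; exact: H.
have := s1m_Hbar hw; rewrite E => /(congr1 trmx); rewrite trmxK trmx_mul trmxK => ->.
exact: submxMl.
Qed.

Lemma dpi_Hbar_s1m w : conj_dist (calH M) y w -> dpi pi y w = (s1m ph w)^T *m invmx levi *m U01 y.
Proof.
move=> hw; rewrite dpi_Hbar // s1m_Hbar // trmx_mul trmxK mulmxK //.
exact: levi_unit.
Qed.

Lemma sum_dist_dpi v : sum_dist (calH M) (conj_dist (calH M)) y v ->
  exists a b : 'rV[C]_s, dpi pi y v = a *m U10 y + b *m U01 y.
Proof.
move=> [Y [Z [hY hZ ->]]]; exists (s11 ph Y)^T, ((s1m ph Z)^T *m invmx levi).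
by rewrite dpiD dpi_calH // dpi_Hbar_s1m.
Qed.

Lemma s20_lin (a : C) v w : s20 ph (a *: v + w) = a * s20 ph v + s20 ph w.
Proof. by case: (phiF Ly) => [[H _ _]] _ _ _; apply: H. Qed.

Lemma dpi_s20 t : exists a b : 'rV[C]_s, dpi pi y t = s20 ph t *: G y + (a *m U10 y + b *m U01 y).
Proof.
have [|a [b E]] := @sum_dist_dpi (- s20 ph t *: g y + t).
  case: (phiF Ly) => [[_ _ H]] _ _ _; apply/H.
  by rewrite s20_lin (fphi By Ly).1 mulr1 addNr.
by exists a, b; rewrite -E dpi_lin scaleNr addrA subrr add0r.
Qed.

(** On the leaf the frame spans CTN: pi is a submersion, and s20 splits off the
    component transversal to the image of the CR structure. *)
Lemma T_unit : T y \in unitmx.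
Proof.
rewrite -row_full_unit -sub1mx; apply/row_subP => i.
have [t <-] := dpi_surj hpi (row i 1%:M) dy; have [a [b ->]] := dpi_s20 t.
have -> : s20 ph t *: G y = (s20 ph t)%:M *m G y by rewrite mul_scalar_mx.
by rewrite -mulT; exact: submxMl.
Qed.

Lemma comb_unique k (z1 z2 : 'M[C]_(k, 1)) (a1 b1 a2 b2 : 'M[C]_(k, s)) :
  z1 *m G y + (a1 *m U10 y + b1 *m U01 y) = z2 *m G y + (a2 *m U10 y + b2 *m U01 y) ->
  [/\ z1 = z2, a1 = a2 & b1 = b2].
Proof.
rewrite -!mulT => /(congr1 (fun X => X *m invmx (T y))); rewrite !mulmxK ?T_unit //.
by case/eq_row_mx => -> /eq_row_mx[-> ->].
Qed.

Lemma comb_unique2 k (a1 b1 a2 b2 : 'M[C]_(k, s)) :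
  a1 *m U10 y + b1 *m U01 y = a2 *m U10 y + b2 *m U01 y -> a1 = a2 /\ b1 = b2.
Proof.
move=> E; have [|_ -> ->] := @comb_unique k 0 0 a1 b1 a2 b2; last by [].
by rewrite !mul0mx !add0r.
Qed.

Lemma comb_coef k (a b : 'M[C]_(k, s)) :
  (a *m U10 y + b *m U01 y) *m invmx (T y) = row_mx 0 (row_mx a b).
Proof.
rewrite -[RHS](mulmxK T_unit) mulT; congr (_ *m _).
by rewrite mul0mx add0r.
Qed.

(** Brackets of a kernel vector with the frame, read on the quotient: [iota10] is the
    matrix of iota, while [conn01] and [conn10] depend on the frame and behave as
    connection coefficients. *)
Definition iota10 v : 'M[C]_s := lsubmx (rsubmx (mdir U01 y v *m invmx (T y))).
Definition conn01 v : 'M[C]_s := rsubmx (rsubmx (mdir U01 y v *m invmx (T y))).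
Definition conn10 v : 'M[C]_s := lsubmx (rsubmx (mdir U10 y v *m invmx (T y))).

Lemma coef_U01 v (a b : 'M[C]_s) : mdir U01 y v = a *m U10 y + b *m U01 y -> iota10 v = a /\ conn01 v = b.
Proof.
move=> E; rewrite /iota10 /conn01 E -[a *m _ + _]add0r -(mul0mx _ (G y)) -mulT mulmxK ?T_unit //.
by rewrite !row_mxKr row_mxKl.
Qed.

Lemma coef_U10 v (a : 'M[C]_s) : mdir U10 y v = a *m U10 y -> conn10 v = a.
Proof.
move=> E; rewrite /conn10 E -[a *m _]addr0 -(mul0mx _ (U01 y)) -[_ + _]add0r -(mul0mx _ (G y)) -mulT.
by rewrite mulmxK ?T_unit // row_mxKr row_mxKl.
Qed.

(** A kernel field annihilates the Levi form, so its bracket with a (0,1) field has no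
    component along [G]. *)
Lemma bracket_U01 V j : local_section (K2 M) y V ->
  exists Y Z, [/\ calH M y Y, conj_dist (calH M) y Z,
    lie_bracket V (fun x => conjv (f j x)) y = Y + Z &
    row j (mdir U01 y (V y)) = dpi pi y Y + dpi pi y Z].
Proof.
move=> sV; have K2V : K2 M y (V y) by case: sV => A [_ Ay] [_ h]; apply: h.
have sVH : local_section (calH M) y V.
  case: sV => A [oA Ay] [sV hV]; exists A => //; split=> // x Ax; exact: K2_calH (hV x Ax).
have [_ /(_ V _ sVH (sec_fb j By) erefl) [Y [Z [hY hZ E]]]] := K2V.
exists Y, Z; split => //; rewrite -dpiD -E; apply/rowP => k.
rewrite dpi_bracket //; last by move=> i; exact: section_cdiff (sec_fb j By).
rewrite !mxE; apply: near_eq_dir.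
by apply: filterS (open_nbhs_nbhs (conj oB By)) => x Bx; rewrite -row_U01 // [RHS]mxE.
Qed.

Lemma mdir_U01 v : K2 M y v -> mdir U01 y v = iota10 v *m U10 y + conn01 v *m U01 y.
Proof.
move=> hv; have [V [sV Vy _]] := K2_section hv.
have H j : exists ab : 'rV[C]_s * 'rV[C]_s, row j (mdir U01 y v) = ab.1 *m U10 y + ab.2 *m U01 y.
  have [Y [Z [hY hZ _]]] := bracket_U01 j sV; rewrite Vy => ->.
  by exists ((s11 ph Y)^T, (s1m ph Z)^T *m invmx levi); rewrite dpi_calH // dpi_Hbar_s1m.
have [ab Hab] := choice H.
have E : mdir U01 y v = (\matrix_j (ab j).1) *m U10 y + (\matrix_j (ab j).2) *m U01 y.
  by apply/row_matrixP => j; rewrite Hab raddfD /= !row_mul !rowK.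
by have [-> ->] := coef_U01 E.
Qed.

(** Since (1,0) fields are closed under brackets, only [U10] occurs. *)
Lemma mdir_U10 v : K2 M y v -> mdir U10 y v = conn10 v *m U10 y.
Proof.
move=> hv; have [V [sV Vy _]] := K2_section hv.
have sVH : local_section (calH M) y V.
  case: sV => A [oA Ay] [sV hV]; exists A => //; split=> // x Ax; exact: K2_calH (hV x Ax).
have H j : exists a : 'rV[C]_s, row j (mdir U10 y v) = a *m U10 y.
  have hb := calH_involutive hM sVH (sec_f j By).
  exists (s11 ph (lie_bracket V (f j) y))^T; rewrite -dpi_calH //; apply/rowP => k.
  rewrite dpi_bracket //; last by move=> i; exact: section_cdiff (sec_f j By).
  by rewrite !mxE Vy; apply: eq_dir => x; rewrite !mxE.
have [a Ha] := choice H.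
have E : mdir U10 y v = (\matrix_j a j) *m U10 y.
  by apply/row_matrixP => j; rewrite Ha row_mul rowK.
by rewrite (coef_U10 E).
Qed.

Lemma iota_exists v j : K2 M y v -> exists u, iota_val M y v (conjv (f j y)) u.
Proof.
move=> hv; have [V [sV Vy _]] := K2_section hv.
have [Y [Z [hY hZ E _]]] := bracket_U01 j sV.
exists Y, V, (fun x => conjv (f j x)); split=> //; first exact: sec_fb.
split=> //; exists 0, Z; split=> //; first exact: (K20 hM).
by rewrite E addrAC subrr.
Qed.

(** The sections in the definition of iota are arbitrary. The section W is compared
    with the combination W0 of the frame that has the same value at the point: the
    difference vanishes there, so differentiating it along v gives a (0,1) vector by
    [calH_deriv], and such a vector does not contribute to the component along
    [U10]. *)
Lemma iota_coef v w u : K2 M y v -> iota_val M y v w u ->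
  (s11 ph u)^T = (conjv (s11 ph (conjv w)))^T *m iota10 v.
Proof.
move=> hv [V [W [sV sW Vy Wy [hu [k [h [hk hh E]]]]]]].
set c := conjv (s11 ph (conjv w)).
have hw : conj_dist (calH M) y w.
  by case: sW => A [_ Ay] [_ hW]; rewrite -Wy; exact: hW.
have [t Et] := K2_coords (calH_split hw).
(* a combination of frame fields with the same value as W at y *)
pose W0 : field R (dimM s m) := fun x => \sum_j c j 0 *: conjv (f j x) + \sum_b conjc (t b) *: conjv (e b x).
pose W1 : field R (dimM s m) := fun x => -1 *: W0 x + W x.
have W0y : W0 y = w.
  rewrite /W0 -[RHS]conjvK -[conjv w](subrK (fcomb (s11 ph (conjv w)))) Et conjvD addrC; congr (_ + _).
    by rewrite conjv_sum; apply: eq_bigr => b _; rewrite conjvZ.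
  by rewrite /fcomb conjv_sum; apply: eq_bigr => j _; rewrite conjvZ /c !mxE.
case: sW => A [oA Ay] [smW hW].
have oD : open (A `&` B) by exact: openI.
have smW0 : field_smooth_on (A `&` B) W0.
  have h1 : field_smooth_on (A `&` B) (fun x => \sum_j c j 0 *: conjv (f j x)).
    apply: (field_smooth_sum oD) => i; apply: (field_smooth_conj oD).
    by apply: field_smooth_sub (smf i) => x [].
  have h2 : field_smooth_on (A `&` B) (fun x => \sum_b conjc (t b) *: conjv (e b x)).
    apply: (field_smooth_sum oD) => i; apply: (field_smooth_conj oD).
    by case: he => se _; apply: field_smooth_sub (se i) => x [_ /Bdom].
  have -> : W0 = (fun x => 1 *: (\sum_j c j 0 *: conjv (f j x)) +
      \sum_b conjc (t b) *: conjv (e b x)) by apply/funext => x; rewrite scale1r.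
  exact: field_smooth_lin.
have smW1 : field_smooth_on (A `&` B) W1.
  by apply: (field_smooth_lin oD) => //; apply: field_smooth_sub smW => x [].
have hW0 x : (A `&` B) x -> conj_dist (calH M) x (W0 x).
  move=> [_ Bx]; rewrite /conj_dist /= /W0 conjvD !conjv_sum; apply: calHD.
    apply: calH_sum; first exact: Bdom.
    by move=> j; rewrite conjvZ conjvK; apply: calHZ; exact: fH.
  apply: calH_sum; first exact: Bdom.
  by move=> b; rewrite conjvZ conjvK; apply: calHZ; apply: K2_calH; apply: e_K2; exact: Bdom.
have sW1c : local_section (calH M) y (fun x => conjv (W1 x)).
  exists (A `&` B) => //; split; first exact: field_smooth_conj.
  move=> x Dx; rewrite /W1 conjvD conjvZ; apply: calH_lin; first exact: hW0.
  by case: Dx => Ax _; exact: hW.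
have W1y : W1 y = 0 by rewrite /W1 W0y Wy scaleN1r addNr.
have dW j : cdiff (fun x => W x 0 j) y by exact: CK_cdiff (CK_smooth 0 (smW j)) Ay.
have dW0 j : cdiff (fun x => W0 x 0 j) y by exact: CK_cdiff (CK_smooth 0 (smW0 j)) (conj Ay By).
have dW1 j : cdiff (fun x => W1 x 0 j) y by exact: CK_cdiff (CK_smooth 0 (smW1 j)) (conj Ay By).
have dpic k0 i : cdiff (fun x => cpartial (picoord pi k0) x i) y.
  exact: CK_cdiff (CK_cpartial i (picoord_CK hpi 1 k0)) dy.
have dpiW (X : field R (dimM s m)) k0 : (forall j, cdiff (fun x => X x 0 j) y) ->
    cdiff (fun x => dpi pi x (X x) 0 k0) y.
  move=> dX; rewrite (_ : (fun x => _) = (fun x => dir (picoord pi k0) x (X x))).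
    by apply: cdiff_sum => i; apply: cdiffM.
  by apply/funext => x; rewrite dpiE.
have D0 k0 : dir (fun x => dpi pi x (W0 x) 0 k0) y v = (c^T *m mdir U01 y v) 0 k0.
  rewrite -mdirMl; last exact: U01_diff.
  rewrite [RHS]mxE; apply: near_eq_dir.
  apply: filterS (open_nbhs_nbhs (conj oB By)) => x Bx.
  rewrite /W0 dpiD dpi_sum (_ : dpi pi x (\sum_b _) = 0) ?addr0; last first.
    rewrite dpi_sum big1 // => b _; rewrite dpiZ (dpi_K2bar hM hpi) ?scaler0 //.
    by apply: e_K2; exact: Bdom.
  congr (fun_of_matrix _ 0 k0); rewrite mulmx_sum_row; apply: eq_bigr => j _.
  by rewrite dpiZ row_U01 // [c^T 0 j]mxE.
pose h1 : vec := \row_i dir (fun x => W1 x 0 i) y v.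
have hh1 : conj_dist (calH M) y h1.
  rewrite /conj_dist /=.
  have -> : conjv h1 = \row_i dir (fun x => (conjv (W1 x)) 0 i) y (conjv v).
    apply/rowP => i; rewrite !mxE -[X in dir _ _ X]conjvK -dir_conj; last exact: dW1.
    by apply: eq_dir => x; rewrite [RHS]mxE.
  by apply: (calH_deriv hM (conjv v) sW1c); rewrite W1y conjv0.
have D1 k0 : dir (fun x => dpi pi x (W1 x) 0 k0) y v = dpi pi y h1 0 k0.
  rewrite (@eq_dir _ _ _ (fun x => \sum_i W1 x 0 i * cpartial (picoord pi k0) x i)); last first.
    by move=> x; rewrite dpiE.
  rewrite dir_sum; last by move=> i; apply: cdiffM.
  rewrite dpiE; apply: eq_bigr => i _.
  by rewrite dirM // W1y [(0 : vec) 0 i]mxE mul0r addr0 mxE.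
have E1 : dpi pi y (lie_bracket V W y) = c^T *m mdir U01 y v + dpi pi y h1.
  apply/rowP => k0; rewrite dpi_bracket // Vy [RHS]mxE -D0 -D1 -dirD; [|exact: dpiW..].
  apply: eq_dir => x; rewrite /W1 dpi_lin !mxE; ring.
have E2 : dpi pi y (lie_bracket V W y) = dpi pi y u + dpi pi y h.
  by rewrite -dpiD -[lie_bracket V W y](subrK u) E dpiD addrC dpiD [dpi pi y (k + h)]dpiD
     (dpi_K2 hM hpi hk) add0r.
move: E2; rewrite E1 (mdir_U01 hv) (dpi_calH hu) (dpi_Hbar_s1m hh1) (dpi_Hbar_s1m hh) mulmxDr !mulmxA -addrA -mulmxDl.
by case/comb_unique2.
Qed.

Lemma iota_Hbar v w u : iota_val M y v w u -> conj_dist (calH M) y w /\ calH M y u.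
Proof.
by move=> [V [W [_ [A [_ Ay] [_ hW]] _ Wy [hu _]]]]; split=> //; rewrite -Wy; exact: hW.
Qed.

(** [iota_coef] shows that this matrix has the defining property; it is the only one
    because iota is defined on the whole conjugate frame, on which s1m is given by the
    invertible matrix [levi]. *)
Lemma Smat_trueE v : K2 M y v -> Smat M true y ph v = (invmx levi *m iota10 v)^T.
Proof.
move=> hv.
have P0 w u : iota_val M y v w u -> s11 ph u = (invmx levi *m iota10 v)^T *m s1m ph w.
  move=> hi; have [hw hu] := iota_Hbar hi.
  apply: trmx_inj; rewrite (iota_coef hv hi) trmx_mul trmxK s1m_Hbar // trmx_mul trmxK.
  by rewrite -mulmxA mulKVmx // levi_unit.
apply: xget_unique => //= S HS.
have KT : levi^T \in unitmx by rewrite unitmx_tr levi_unit.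
rewrite -[S](mulmxK KT) -[RHS](mulmxK KT); congr (_ *m _).
apply/trmx_inj/row_matrixP => j; apply: trmx_inj.
have [u hu] := iota_exists j hv.
have := HS _ _ hu; rewrite (P0 _ _ hu).
have -> : s1m ph (conjv (f j y)) = col j levi^T by apply/colP => i; rewrite !mxE.
by rewrite !tr_row !trmxK !colE !mulmxA => ->.
Qed.

Lemma s11_f j : s11 ph (f j y) = delta_mx j 0.
Proof. by case: (fphi By Ly) => _ /(_ j) []. Qed.

Lemma Smat_falseE v : K2 M y v -> Smat M false y ph v = (conjv (iota10 v) *m levi)^T.
Proof.
move=> hv.
have P0 w u : iota_val M y v w u -> s1m ph (conjv u) = (conjv (iota10 v) *m levi)^T *m s11 ph (conjv w).
  move=> hi; have [hw hu] := iota_Hbar hi.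
  have hu' : conj_dist (calH M) y (conjv u) by rewrite /conj_dist /= conjvK.
  rewrite s1m_Hbar // conjvK -[s11 ph u]trmxK (iota_coef hv hi) trmx_mul trmxK conjvM conjvK.
  by rewrite trmx_mul conjv_tr mulmxA.
apply: xget_unique => //= S HS.
apply/trmx_inj/row_matrixP => j; apply: trmx_inj.
have [u hu] := iota_exists j hv.
have := HS _ _ hu; rewrite (P0 _ _ hu) conjvK s11_f.
by rewrite -!colE !tr_row !trmxK => ->.
Qed.

Lemma is_Xi_iota10 v Xi : K2 M y v -> is_Xi M y ph v Xi -> iota10 v = Xi^T.
Proof.
move=> hv hXi; apply/row_matrixP => j; have [u hu] := iota_exists j hv.
have [_ hb] := fphi By Ly; have [_ hHu] := iota_Hbar hu.
have hk := hXi _ hb j u hu.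
have E : \sum_l Xi l j *: f l y = fcomb (col j Xi).
  by apply: eq_bigr => l _; rewrite mxE.
rewrite E in hk.
have := iota_coef hv hu; rewrite conjvK s11_f.
have -> : s11 ph u = col j Xi.
  have h0 := (s11_K2 (calHB hHu (fcomb_calH (col j Xi)))).2 hk.
  have := s11_lin 1 (calHB hHu (fcomb_calH (col j Xi))) (fcomb_calH (col j Xi)).
  by rewrite scale1r subrK h0 scaler0 add0r s11_fcomb.
have -> : conjv (delta_mx j 0 : 'cV[C]_s) = delta_mx j 0.
  by apply/matrixP => a b; rewrite !mxE; case: (_ && _); apply: complex_eq => /=; rewrite ?oppr0.
by rewrite trmx_delta -rowE tr_col => <-.
Qed.

Lemma is_Hmat_levi h Hp : is_Hmat M y ph h Hp -> levi = expi h *: Hp^T.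
Proof.
move=> [_ HH]; have [_ hb] := fphi By Ly.
by apply/row_matrixP => j; rewrite rowK (HH _ hb j) !linearZ /= tr_col; congr (_ *: _); rewrite trmxK.
Qed.

(** Compatibility of an element of F with the bracket of the Heisenberg algebra
    identifies [levi] with a derivative of the frame, hence as a function with a smooth
    extension off the leaf. *)
Lemma s20_bracket i j :
  s20 ph (lie_bracket (f i) (fun x => conjv (f j x)) y) = 2 * ('i : C) * levi j i.
Proof.
have sec0 : local_section (calH M) y (fun=> 0).
  exists B => //; split; first exact: (field_smooth0 oB).
  by move=> x Bx; exact: calH0 (Bdom Bx).
have sec0b : local_section (conj_dist (calH M)) y (fun=> 0).
  exists B => //; split; first exact: (field_smooth0 oB).
  by move=> x Bx; rewrite /conj_dist /= conjv0; exact: calH0 (Bdom Bx).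
have s110 : s11 ph 0 = 0 by apply/(s11_K2 (calH0 dy)); exact: (K20 hM).
have s1m0 : s1m ph 0 = 0.
  by apply/(s1m_K2 Hbar0); rewrite /conj_dist /= conjv0; exact: (K20 hM).
case: (phiF Ly) => _ _ _ H.
have := H _ _ _ _ (sec_f i By) sec0b sec0 (sec_fb j By).
have -> : (f i \+ (fun=> 0)) = f i by apply/funext => x; rewrite /= addr0.
have -> : ((fun=> 0) \+ (fun x => conjv (f j x))) = (fun x => conjv (f j x)).
  by apply/funext => x; rewrite /= add0r.
rewrite s110 s1m0 commutator_gminus s11_f => /alg_mx_inj[[_ -> _ _] _].
congr (_ * _); rewrite trmx_delta -rowE !mxE.
by [].
Qed.

End Pointwise.

(** ** Differentiable extensions of the frame data *)

Lemma nearB : \forall y \near p, B y.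
Proof. exact: open_nbhs_nbhs. Qed.

Lemma Tp_unit : T p \in unitmx.
Proof. exact: T_unit Bp Lp. Qed.

Lemma Ti_diff : mcdiff (fun y => invmx (T y)) p.
Proof. exact: mcdiff_inv (T_diff Bp) Tp_unit. Qed.

Lemma near_T : \forall y \near p, B y /\ T y \in unitmx.
Proof. exact: filterI nearB (near_unitmx (T_diff Bp) Tp_unit). Qed.

Lemma mdir_field_diff n (F : pt -> 'M[C]_(n, d)) (V : field R (dimM s m)) :
  (forall k i j, CK B k (fun y => F y i j)) -> field_smooth_on B V ->
  mcdiff (fun y => mdir F y (V y)) p.
Proof.
move=> HF sV i j; rewrite (_ : (fun y => _) = (fun y => dir (fun x => F x i j) y (V y))).
  by apply: CK_cdiff (CK_dir oB (HF 1 i j) _) Bp => k; exact: CK_smooth.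
by apply/funext => y; rewrite mxE.
Qed.

Section KernelField.
Variable V : field R (dimM s m).
Hypothesis smV : field_smooth_on B V.
Hypothesis KV : forall y, B y -> K2 M y (V y).

Lemma iota10_diff : mcdiff (fun y => iota10 y (V y)) p.
Proof.
apply: mcdiff_lsub; apply: mcdiff_rsub; apply: mcdiffM; last exact: Ti_diff.
by apply: mdir_field_diff => // k; exact: U01_CK.
Qed.

Lemma conn01_diff : mcdiff (fun y => conn01 y (V y)) p.
Proof.
apply: mcdiff_rsub; apply: mcdiff_rsub; apply: mcdiffM; last exact: Ti_diff.
by apply: mdir_field_diff => // k; exact: U01_CK.
Qed.

Lemma conn10_diff : mcdiff (fun y => conn10 y (V y)) p.
Proof.
apply: mcdiff_lsub; apply: mcdiff_rsub; apply: mcdiffM; last exact: Ti_diff.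
by apply: mdir_field_diff => // k; exact: U10_CK.
Qed.

(** These coefficients vanish on the leaf, but they are defined near p, where they have
    to be differentiated before the relation is restricted to the leaf. *)
Definition coefG01 y : 'M[C]_(s, 1) := lsubmx (mdir U01 y (V y) *m invmx (T y)).
Definition coefG10 y : 'M[C]_(s, 1) := lsubmx (mdir U10 y (V y) *m invmx (T y)).
Definition coef01_10 y : 'M[C]_s := rsubmx (rsubmx (mdir U10 y (V y) *m invmx (T y))).

Lemma coefG01_diff : mcdiff coefG01 p.
Proof.
apply: mcdiff_lsub; apply: mcdiffM; last exact: Ti_diff.
by apply: mdir_field_diff => // k; exact: U01_CK.
Qed.

Lemma coefG10_diff : mcdiff coefG10 p.
Proof.
apply: mcdiff_lsub; apply: mcdiffM; last exact: Ti_diff.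
by apply: mdir_field_diff => // k; exact: U10_CK.
Qed.

Lemma coef01_10_diff : mcdiff coef01_10 p.
Proof.
apply: mcdiff_rsub; apply: mcdiff_rsub; apply: mcdiffM; last exact: Ti_diff.
by apply: mdir_field_diff => // k; exact: U10_CK.
Qed.

Lemma leaf_coefs y : B y -> L y -> [/\ coefG01 y = 0, coefG10 y = 0 & coef01_10 y = 0].
Proof.
move=> By Ly; have hv := KV By; have hT := T_unit By Ly.
rewrite /coefG01 /coefG10 /coef01_10 (mdir_U01 By Ly hv) (mdir_U10 By Ly hv).
have E := comb_coef By Ly (conn10 y (V y)) 0; rewrite mul0mx addr0 in E.
by rewrite E (comb_coef By Ly) !row_mxKl !row_mxKr.
Qed.

Lemma mdir_leaf0 n k (F : pt -> 'M[C]_(n, k)) X : dpi pi p X = 0 -> mcdiff F p ->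
  (forall y, B y -> L y -> F y = 0) -> mdir F p X = 0.
Proof.
move=> dX dF F0; apply/matrixP => i j; rewrite !mxE.
apply: (leaf_dir0 hM hpi dp dX (dF i j)).
by apply: filterS nearB => y By Ly; rewrite F0 // mxE.
Qed.

Lemma dU01_near : \forall y \near p,
  mdir U01 y (V y) = coefG01 y *m G y + (iota10 y (V y) *m U10 y + conn01 y (V y) *m U01 y).
Proof.
by apply: filterS near_T => y [_ hT]; rewrite -mulT /coefG01 /iota10 /conn01 !hsubmxK mulmxKV.
Qed.

Lemma dU10_near : \forall y \near p,
  mdir U10 y (V y) = coefG10 y *m G y + (conn10 y (V y) *m U10 y + coef01_10 y *m U01 y).
Proof.
by apply: filterS near_T => y [_ hT]; rewrite -mulT /coefG10 /conn10 /coef01_10 !hsubmxK mulmxKV.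
Qed.

Lemma G_diff : mcdiff G p.
Proof. by move=> i j; exact: CK_cdiff (G_CK 0 i j) Bp. Qed.

Lemma mdir_comb (z : pt -> 'M[C]_(s, 1)) (a b : pt -> 'M[C]_s) X :
  mcdiff z p -> mcdiff a p -> mcdiff b p -> z p = 0 -> mdir z p X = 0 ->
  mdir (fun y => z y *m G y + (a y *m U10 y + b y *m U01 y)) p X =
  mdir a p X *m U10 p + a p *m mdir U10 p X + (mdir b p X *m U01 p + b p *m mdir U01 p X).
Proof.
move=> dz da db z0 dz0; have dG := G_diff; have dU := U10_diff Bp; have dUb := U01_diff Bp.
rewrite mdirD; [|exact: mcdiffM|by apply: mcdiffD; apply: mcdiffM].
rewrite mdirM // z0 dz0 !mul0mx !add0r mdirD; [|exact: mcdiffM..].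
by rewrite !mdirM.
Qed.

(** The component along [G] vanishes on the leaf together with its derivatives along
    it, so the product rule may be applied as if it were absent. *)
Lemma mdir2_U01 X : dpi pi p X = 0 ->
  mdir (fun y => mdir U01 y (V y)) p X =
  mdir (fun y => iota10 y (V y)) p X *m U10 p + iota10 p (V p) *m mdir U10 p X +
  (mdir (fun y => conn01 y (V y)) p X *m U01 p + conn01 p (V p) *m mdir U01 p X).
Proof.
move=> dX; rewrite (near_eq_mdir X dU01_near) mdir_comb //;
  [exact: coefG01_diff|exact: iota10_diff|exact: conn01_diff|by case: (leaf_coefs Bp Lp)|].
by apply: mdir_leaf0 coefG01_diff _ => // y By Ly; case: (leaf_coefs By Ly).
Qed.

Lemma mdir2_U01_conj X : dpi pi p (conjv X) = 0 ->
  mdir (fun y => conjv (mdir U01 y (V y))) p X =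
  mdir (fun y => conjv (iota10 y (V y))) p X *m U01 p + conjv (iota10 p (V p)) *m mdir U01 p X +
  (mdir (fun y => conjv (conn01 y (V y))) p X *m U10 p + conjv (conn01 p (V p)) *m mdir U10 p X).
Proof.
move=> dX.
have dU2 : mcdiff (fun y => mdir U01 y (V y)) p.
  by apply: mdir_field_diff => // k; exact: U01_CK.
have -> := mdir_conj X dU2; have -> := mdir2_U01 dX.
have -> := mdir_conj X iota10_diff; have -> := mdir_conj X conn01_diff.
have EU : mdir U01 p X = conjv (mdir U10 p (conjv X)) by exact: mdir_conj X (U10_diff Bp).
have EV : mdir U10 p X = conjv (mdir U01 p (conjv X)).
  rewrite -(mdir_conj X (U01_diff Bp)); apply: near_eq_mdir.
  by apply: filterS nearB => y _; rewrite /U01 conjvK.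
have EW : U10 p = conjv (U01 p) by rewrite /U01 conjvK.
rewrite EU EV {2}EW conjvD; congr (_ + _); rewrite conjvD; congr (_ + _); exact: conjvM.
Qed.

Lemma mdir2_U10 X : dpi pi p X = 0 ->
  mdir (fun y => mdir U10 y (V y)) p X =
  mdir (fun y => conn10 y (V y)) p X *m U10 p + conn10 p (V p) *m mdir U10 p X.
Proof.
move=> dX; rewrite (near_eq_mdir X dU10_near) mdir_comb //;
  [|exact: coefG10_diff|exact: conn10_diff|exact: coef01_10_diff|by case: (leaf_coefs Bp Lp)|]; last first.
  by apply: mdir_leaf0 coefG10_diff _ => // y By Ly; case: (leaf_coefs By Ly).
have -> : coef01_10 p = 0 by case: (leaf_coefs Bp Lp).
rewrite (_ : mdir coef01_10 p X = 0) ?mul0mx ?addr0 //.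
by apply: mdir_leaf0 coef01_10_diff _ => // y By Ly; case: (leaf_coefs By Ly).
Qed.

End KernelField.

Lemma mdir_U01_conj y X : B y -> mdir U01 y X = conjv (mdir U10 y (conjv X)).
Proof. by move=> By; rewrite -mdir_conj //; exact: U10_diff. Qed.

Lemma mdir_U10_conj y X : B y -> mdir U10 y X = conjv (mdir U01 y (conjv X)).
Proof. by move=> By; rewrite mdir_U01_conj // !conjvK. Qed.

Section TwoFields.
Variables V W : field R (dimM s m).
Hypothesis smV : field_smooth_on B V.
Hypothesis smW : field_smooth_on B W.
Hypothesis KV : forall y, B y -> K2 M y (V y).
Hypothesis KW : forall y, B y -> K2 M y (W y).

Let sKV : local_section (K2 M) p V.
Proof. by exists B => //. Qed.

Lemma lie_tangent (Z : field R (dimM s m)) : field_smooth_on B Z ->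
  (forall y, B y -> dpi pi y (Z y) = 0) -> dpi pi p (lie_bracket V Z p) = 0.
Proof.
move=> smZ hZ; apply/rowP => k; rewrite dpi_bracket //; last first.
  by move=> j; apply: CK_cdiff (CK_smooth 0 (smZ j)) Bp.
rewrite (@near_eq_dir _ _ _ (fun=> 0)) ?dir_cst ?mxE //.
by apply: filterS nearB => y By; rewrite hZ // mxE.
Qed.

Lemma mdir_lie n (F : pt -> 'M[C]_(n, d)) (Z : field R (dimM s m)) :
  (forall k i j, CK B k (fun y => F y i j)) -> field_smooth_on B Z ->
  mdir F p (lie_bracket V Z p) =
  mdir (fun y => mdir F y (Z y)) p (V p) - mdir (fun y => mdir F y (V y)) p (Z p).
Proof.
move=> HF smZ; apply/matrixP => i j; rewrite !mxE (dir_lie oB (HF 1 i j) Bp); first last.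
- by move=> k; apply: CK_cdiff (CK_smooth 0 (smZ k)) Bp.
- by move=> k; apply: CK_cdiff (CK_smooth 0 (smV k)) Bp.
by congr (_ - _); apply: eq_dir => y; rewrite mxE.
Qed.

Let dVp : dpi pi p (V p) = 0.
Proof. by apply: (dpi_K2 hM hpi); exact: KV. Qed.

Let dWp : dpi pi p (W p) = 0.
Proof. by apply: (dpi_K2 hM hpi); exact: KW. Qed.

(** The Jacobi identity for V, W and the conjugate frame: the bracket of V and W is
    tangent to the leaves, and only the kernel part Y of its value contributes to the
    [U10]-component of its action on [U01]. *)
Lemma jacobi_plus : exists2 Y, K2 M p Y &
  mdir (fun y => iota10 y (W y)) p (V p) + iota10 p (W p) *m conn10 p (V p) + conn01 p (W p) *m iota10 p (V p) -
  (mdir (fun y => iota10 y (V y)) p (W p) + iota10 p (V p) *m conn10 p (W p) + conn01 p (V p) *m iota10 p (W p)) =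
  iota10 p Y.
Proof.
have [Y [Z [hY hZ E]]] := dpi_ker hM hpi dp
  (lie_tangent smW (fun y By => dpi_K2 hM hpi (KW By))).
exists Y => //.
have := mdir_lie (fun k => U01_CK k) smW.
rewrite (mdir2_U01 smW KW dVp) (mdir2_U01 smV KV dWp) E -[Y in LHS]scale1r mdir_lin scale1r.
rewrite (mdir_U01_conj (conjv Z) Bp) conjvK !(mdir_U01 Bp Lp hY, mdir_U10 Bp Lp hZ).
rewrite !(mdir_U01 Bp Lp (KV Bp), mdir_U10 Bp Lp (KV Bp), mdir_U01 Bp Lp (KW Bp), mdir_U10 Bp Lp (KW Bp)).
rewrite conjvM -/(U01 p) => /comb_jacobi H.
by have [->] := comb_unique2 Bp Lp H.
Qed.

(** The Jacobi identity for V, conj W and the frame: in the action of the bracket on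
    [U10], the [U01]-component only sees the conjugate kernel part of its value. *)
Lemma jacobi_mixed : exists2 Z, K2 M p Z &
  mdir (fun y => conjv (iota10 y (W y))) p (V p) + conjv (iota10 p (W p)) *m conn01 p (V p) -
  conn10 p (V p) *m conjv (iota10 p (W p)) = conjv (iota10 p Z).
Proof.
pose Wb y := conjv (W y).
have smWb : field_smooth_on B Wb by exact: (field_smooth_conj oB).
have dWbp : dpi pi p (Wb p) = 0 by apply: (dpi_K2bar hM hpi); exact: KW.
have tWb y : B y -> dpi pi y (Wb y) = 0.
  by move=> By; apply: (dpi_K2bar hM hpi); exact: KW.
have [Y [Z [hY hZ E]]] := dpi_ker hM hpi dp (lie_tangent smWb tWb).
exists Z => //.
have := mdir_lie (fun k => U10_CK k) smWb.
rewrite (mdir2_U10 smV KV dWbp) E -[Y in LHS]scale1r mdir_lin scale1r.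
have -> : mdir (fun y => mdir U10 y (Wb y)) p (V p) = mdir (fun y => conjv (mdir U01 y (W y))) p (V p).
  by apply: near_eq_mdir; apply: filterS nearB => y By; rewrite mdir_U10_conj // conjvK.
have cV : dpi pi p (conjv (V p)) = 0 by apply: (dpi_K2bar hM hpi); exact: KV.
rewrite (mdir2_U01_conj smW KW cV) (mdir_U01 Bp Lp (KV Bp)) (mdir_U10 Bp Lp (KV Bp)).
have -> : mdir U10 p (Wb p) = conjv (iota10 p (W p)) *m U01 p + conjv (conn01 p (W p)) *m U10 p.
  rewrite (mdir_U10_conj _ Bp) /Wb conjvK (mdir_U01 Bp Lp (KW Bp)) conjvD !conjvM.
  by congr (_ + _ *m _); rewrite /U01 conjvK.
have -> : mdir U10 p (conjv Z) = conjv (iota10 p Z) *m U01 p + conjv (conn01 p Z) *m U10 p.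
  rewrite (mdir_U10_conj _ Bp) conjvK (mdir_U01 Bp Lp hZ) conjvD !conjvM.
  by congr (_ + _ *m _); rewrite /U01 conjvK.
rewrite (mdir_U10 Bp Lp hY).
move=> /comb_jacobi_mixed H.
by have [_ ->] := comb_unique2 Bp Lp H.
Qed.

End TwoFields.

(** ** The matrix of the Levi form *)

(** The matrix [levi] is attached to the elements of F and exists on the leaf only; by
    [s20_bracket] this formula extends it to a neighbourhood. *)
Definition leviX y : 'M[C]_s := \matrix_(j, i) ((2 * ('i : C))^-1 *
  (dpi pi y (lie_bracket (f i) (fun x => conjv (f j x)) y) *m invmx (T y)) 0 0).

Lemma lie_CK n (V W : field R (dimM s m)) k : field_smooth_on B V -> field_smooth_on B W ->
  CK B n (fun y => lie_bracket V W y 0 k).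
Proof.
move=> sV sW.
apply: (@CK_congr _ _ _ oB n (fun y => dir (fun z => W z 0 k) y (V y) +
   (-1) * dir (fun z => V z 0 k) y (W y))).
  by move=> y _; rewrite mxE mulN1r.
apply: (CK_add oB); first by apply: (CK_dir oB); [exact: CK_smooth|move=> j; exact: CK_smooth].
apply: (CK_mul oB); first exact: CK_cst.
by apply: (CK_dir oB); [exact: CK_smooth|move=> j; exact: CK_smooth].
Qed.

Lemma leviX_diff : mcdiff leviX p.
Proof.
move=> j i; rewrite (_ : (fun y => _) = (fun y => (2 * ('i : C))^-1 *
  (dpi pi y (lie_bracket (f i) (fun x => conjv (f j x)) y) *m invmx (T y)) 0 0)); last first.
  by apply/funext => y; rewrite mxE.
apply: cdiffM; first exact: cdiff_cst.
apply: (mcdiffM _ Ti_diff) => a k.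
rewrite (_ : (fun y => _) = (fun y => dir (picoord pi k) y
   (lie_bracket (f i) (fun x => conjv (f j x)) y))); last first.
  by apply/funext => y; rewrite ord1 dpiE.
apply: CK_cdiff (CK_dir oB (CK_sub Bdom (picoord_CK hpi 1 k)) _) Bp => l.
apply: lie_CK; first exact: smf.
exact: (field_smooth_conj oB).
Qed.

Lemma leviX_leaf y : B y -> L y -> leviX y = levi y.
Proof.
move=> By Ly; apply/matrixP => j i; rewrite mxE.
have [a [b ->]] := dpi_s20 By Ly (lie_bracket (f i) (fun x => conjv (f j x)) y).
rewrite s20_bracket // -mul_scalar_mx -mulT mulmxK ?T_unit //.
have -> : (0 : 'I_d) = lshift (s + s) (0 : 'I_1) by apply: val_inj.
rewrite row_mxEl mxE eqxx mulr1n mulKf // mulf_neq0 ?i_neq0 //.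
Qed.

Lemma leviXp : leviX p = levi p.
Proof. exact: leviX_leaf Bp Lp. Qed.

Lemma leviXp_unit : leviX p \in unitmx.
Proof. by rewrite leviXp; exact: levi_unit Bp Lp. Qed.

Lemma leviXi_diff : mcdiff (fun y => invmx (leviX y)) p.
Proof. exact: mcdiff_inv leviX_diff leviXp_unit. Qed.

(** ** Constancy of the hyperplane field along the leaf *)

(** The column that annihilates the rows of [U10] and [U01] and equals 1 on [G]. *)
Definition rho y : 'M[C]_(d, 1) := lsubmx (invmx (T y)).

Lemma T_rho y : T y \in unitmx -> [/\ G y *m rho y = 1%:M, U10 y *m rho y = 0 & U01 y *m rho y = 0].
Proof.
move=> hT; have := mulmxV hT => /(congr1 (fun X => lsubmx X)).
rewrite -mulmx_lsub -/(rho y) /T !mul_col_mx (scalar_mx_block 1 (s + s)) block_mxEh row_mxKl.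
have E0 : (0 : 'M[C]_(s + s, 1)) = col_mx 0 0 by rewrite col_mx0.
by case/eq_col_mx => ->; rewrite E0 => /eq_col_mx[-> ->].
Qed.

Lemma mulTi_col y (q : 'M[C]_1) : T y \in unitmx ->
  invmx (T y) *m col_mx q 0 = rho y *m q.
Proof.
move=> hT; have [h1 h2 h3] := T_rho hT.
rewrite -(mulKmx hT (rho y *m q)); congr (_ *m _).
by rewrite mulmxA /T !mul_col_mx h1 h2 h3 !mul0mx mul1mx col_mx0.
Qed.

Lemma mdir_rho y X : B y -> T y \in unitmx ->
  mdir U10 y X *m rho y = 0 -> mdir U01 y X *m rho y = 0 ->
  mdir rho y X = - (rho y *m (mdir G y X *m rho y)).
Proof.
move=> By hT h1 h2; rewrite /rho mdir_lsub (mdir_inv X (T_diff By) hT).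
have E1 : mdir T y X *m rho y = col_mx (mdir G y X *m rho y) 0.
  by rewrite /T !mdir_col !mul_col_mx h1 h2 col_mx0.
by rewrite linearN /= -mulmx_lsub -/(rho y) -mulmxA E1 mulTi_col.
Qed.

Lemma rho_diff y : B y -> T y \in unitmx -> mcdiff rho y.
Proof. by move=> By hT; apply: mcdiff_lsub; exact: mcdiff_inv (T_diff By) hT. Qed.

(** The image of the CR structure is the same hyperplane of CTN at all points of the
    leaf near p. Along the leaf, derivatives of [U10] and [U01] stay in the hyperplane, so
    by [mdir_rho] those of [rho] are multiples of [rho]; the normalization by [G p]
    removes the factor, and the normalized column is constant by [leaf_const]. *)
Lemma leaf_rho : \forall y \near p, L y -> U10 y *m rho p = 0 /\ U01 y *m rho p = 0.
Proof.
pose w y := G p *m rho y.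
have dw y : B y -> T y \in unitmx -> mcdiff w y.
  by move=> By hT; apply: mcdiffM; [exact: mcdiff_cst|exact: rho_diff].
have wp : w p = 1%:M by have [] := T_rho Tp_unit.
have nw : \forall y \near p, (B y /\ T y \in unitmx) /\ w y \in unitmx.
  by apply: filterI near_T (near_unitmx (dw p Bp Tp_unit) _); rewrite wp unitmx1.
pose lam y := rho y *m invmx (w y).
have dlam y X : B y -> T y \in unitmx -> w y \in unitmx ->
    mdir U10 y X *m rho y = 0 -> mdir U01 y X *m rho y = 0 -> mdir lam y X = 0.
  move=> By hT hw h1 h2; rewrite mdirM; [|exact: rho_diff|exact: mcdiff_inv (dw y By hT) hw].
  rewrite (mdir_inv X (dw y By hT) hw) mdirMl; last exact: rho_diff.
  rewrite mdir_rho //; set q := mdir G y X *m rho y.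
  have -> : invmx (w y) *m (G p *m - (rho y *m q)) = - q.
    by rewrite [G p *m _]mulmxN mulmxN [G p *m _]mulmxA mulKmx.
  exact: opp_cancel_mx.
have cdlam y i j : B y -> T y \in unitmx -> w y \in unitmx -> cdiff (fun x => lam x i j) y.
  move=> By hT hw; apply: (@mcdiffM _ _ _ _ _ rho (fun x => invmx (w x)));
    [exact: rho_diff|exact: mcdiff_inv (dw y By hT) hw].
have const i j : \forall y \near p, L y -> lam y i j = lam p i j.
  apply: (leaf_const hM hpi (f := fun x => lam x i j) dp).
  apply: filterS nw => y [[By hT] hw] Ly; split; first exact: cdlam.
  have [t1 t2 t3] := T_rho hT.
  have E X : mdir lam y X = 0 -> dir (fun x => lam x i j) y X = 0.
    by move=> /matrixP/(_ i j); rewrite !mxE.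
  move=> v hv; split; apply: E; apply: dlam => //.
  - by rewrite (mdir_U10 By Ly hv) -mulmxA t2 mulmx0.
  - by rewrite (mdir_U01 By Ly hv) mulmxDl -!mulmxA t2 t3 !mulmx0 addr0.
  - rewrite (mdir_U10_conj _ By) conjvK (mdir_U01 By Ly hv) conjvD !conjvM -/(U01 y).
    have -> : conjv (U01 y) = U10 y by rewrite /U01 conjvK.
    by rewrite mulmxDl -!mulmxA t2 t3 !mulmx0 addr0.
  - rewrite (mdir_U01_conj _ By) conjvK (mdir_U10 By Ly hv) conjvM -/(U01 y).
    by rewrite -mulmxA t3 mulmx0.
have constm : \forall y \near p, L y -> lam y = lam p.
  have c1 : \forall y \near p, forall i : 'I_d, L y -> lam y i 0 = lam p i 0.
    by apply: (@filter_forall _ 'I_d _ _ (nbhs_filter p)) => i; exact: const.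
  apply: filterS c1 => y H Ly; apply/matrixP => i j.
  by rewrite ord1; exact: H.
have lp : lam p = rho p by rewrite /lam wp invmx1 mulmx1.
apply: filterS2 nw constm => y [[By hT] hw] H Ly; have [t1 t2 t3] := T_rho hT.
have <- : lam y = rho p by rewrite (H Ly).
by split; [exact: mulmx_eq0l t2|exact: mulmx_eq0l t3].
Qed.

(** ** The transition maps between the identifications with the leaf space *)

Section Transition.
Variables (u : C) (x1 x2 : 'cV[C]_s).

(** The element of D with components x1, x2 at the point y, and the components at p of
    the element of the graded tangent space of N that has components u, x1, x2 at y. *)
Definition trow y : 'rV[C]_d := x1^T *m U10 y + x2^T *m invmx (leviX y) *m U01 y.
Definition tu y : C := u * (G y *m rho p) 0 0.
Definition ta y : 'cV[C]_s := (lsubmx (rsubmx (trow y *m invmx (T p))))^T.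
Definition tb y : 'cV[C]_s := (rsubmx (rsubmx (trow y *m invmx (T p))) *m levi p)^T.

Lemma rho_annihilates (r : 'rV[C]_d) : r *m rho p = 0 ->
  r = lsubmx (rsubmx (r *m invmx (T p))) *m U10 p + rsubmx (rsubmx (r *m invmx (T p))) *m U01 p.
Proof.
move=> r0; rewrite -[LHS](mulmxKV Tp_unit) -{1}[r *m _]hsubmxK -{1}[rsubmx _]hsubmxK mulT.
by rewrite -mulmx_lsub -/(rho p) r0 mul0mx add0r.
Qed.

Lemma s20_0 y : B y -> L y -> s20 (phi y) 0 = 0.
Proof.
move=> By Ly; have := s20_lin Ly (-1) 0 0.
by rewrite scaler0 addr0 mulN1r addNr.
Qed.

Lemma calI_row y n2 n1 : B y -> L y -> calI M pi phi y n2 n1 (gminus_mx u x1 x2) ->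
  n1 = trow y /\ exists a b : 'rV[C]_s, n2 = u *: G y + (a *m U10 y + b *m U01 y).
Proof.
move=> By Ly [t [v [w [hv hw <- <-]]]] /alg_mx_inj[[_ Eu E1 E2] _]; split.
  rewrite dpiD (dpi_calH By Ly hv) (dpi_Hbar_s1m By Ly hw) -E1 -E2 /trow leviX_leaf //.
by rewrite Eu; exact: dpi_s20.
Qed.

Lemma calI_exists y t (a b : 'rV[C]_s) : B y -> L y ->
  calI M pi phi y (dpi pi y t) (a *m U10 y + b *m U01 y)
    (gminus_mx (s20 (phi y) t) a^T (b *m levi y)^T).
Proof.
move=> By Ly.
have [w hw Ew] : exists2 w, conj_dist (calH M) y w & s1m (phi y) w = (b *m levi y)^T.
  by case: (phiF Ly) => _ _ [_ H _ _] _; exact: H.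
have hf := fcomb_calH By a^T.
exists t, (fcomb y a^T), w; split; [exact: hf|exact: hw|exact: erefl| |].
  rewrite dpiD (dpi_calH By Ly hf) (dpi_Hbar_s1m By Ly hw) (s11_fcomb By Ly) Ew !trmxK.
  by rewrite mulmxK // levi_unit.
by rewrite (s11_fcomb By Ly) Ew.
Qed.

(** The graded component in CTN / D is compared through [rho p], whose kernel is D at
    both points; the component in D, the same subspace at both points, is expanded in
    the frame at p. *)
Lemma transitionE : \forall y \near p, L y ->
  calI_transition M pi phi p y (gminus_mx u x1 x2) = gminus_mx (tu y) (ta y) (tb y).
Proof.
apply: filterS2 nearB leaf_rho => y By hrho Ly; have [hr hb] := hrho Ly.
have [tp1 tp2 tp3] := T_rho Tp_unit.
have rr : trow y *m rho p = 0.
  by rewrite /trow mulmxDl -!mulmxA hr hb !mulmx0 addr0.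
have sb (n2 : 'rV[C]_d) (a b : 'rV[C]_s) : n2 = u *: G y + (a *m U10 y + b *m U01 y) ->
   n2 *m rho p = (tu y)%:M.
  move=> ->; rewrite !mulmxDl -!mulmxA hr hb !mulmx0 !addr0 -scalemxAl /tu.
  by rewrite {1}[G y *m rho p]mx11_scalar scale_scalar_mx.
have st t : dpi pi p t *m rho p = (s20 (phi p) t)%:M.
  have [a [b ->]] := dpi_s20 Bp Lp t.
  by rewrite !mulmxDl -!mulmxA tp2 tp3 !mulmx0 !addr0 -scalemxAl tp1 scale_scalar_mx mulr1.
have sc_inj (a b : C) : a%:M = b%:M :> 'M[C]_1 -> a = b.
  by move=> /matrixP/(_ 0 0); rewrite !mxE eqxx !mulr1n.
apply: xget_unique => /=.
  exists (dpi pi y (u *: g y)), (trow y); split.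
    have := calI_exists (u *: g y) x1^T (x2^T *m invmx (levi y)) By Ly.
    rewrite (mulmxKV (levi_unit By Ly)) !trmxK -(leviX_leaf By Ly) -/(trow y).
    have -> : s20 (phi y) (u *: g y) = u; last by [].
    by rewrite -[u *: g y]addr0 (s20_lin Ly) s20_0 // addr0 (fphi By Ly).1 mulr1.
  have [t' Et'] := dpi_surj hpi (dpi pi y (u *: g y)) dp.
  have := calI_exists t' (lsubmx (rsubmx (trow y *m invmx (T p))))
    (rsubmx (rsubmx (trow y *m invmx (T p)))) Bp Lp.
  rewrite -(rho_annihilates rr) Et' -/(ta y) -/(tb y).
  have -> : s20 (phi p) t' = tu y; last by [].
  by apply: sc_inj; rewrite -st Et' dpiZ -(sb (u *: G y) 0 0) // !mul0mx !addr0.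
move=> A [n2 [n1 [h1 [t [v [w [hv hw Et En ->]]]]]]].
have [E1 [a [b E2]]] := calI_row By Ly h1.
have E3 : s20 (phi p) t = tu y by apply: sc_inj; rewrite -st Et (sb _ a b).
move: En; rewrite E1 dpiD (dpi_calH Bp Lp hv) (dpi_Hbar_s1m Bp Lp hw) [in RHS](rho_annihilates rr).
case/(comb_unique2 Bp Lp) => Ea Eb.
have Ha : s11 (phi p) v = ta y by rewrite /ta -Ea trmxK.
have Hb : s1m (phi p) w = tb y.
  by rewrite /tb -Eb mulmxKV ?trmxK //; exact: levi_unit Bp Lp.
by rewrite E3 Ha Hb.
Qed.

End Transition.

(** ** The modified symbol in terms of the frame *)

(** [tau], [mu] and the transpose of [conn10] are the derivatives of the diagonal blocks
    of the transition maps on g_{-2,0}, g_{-1,-1} and g_{-1,1}. [Splus], [Sminus] and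
    [OmegaL] are the matrices S^{0,2}, S^{0,-2} and Omega of the kernel vector v; the
    scaling component of the modified symbol at v is - tau v / 2. *)
Definition tau v : C := dir (fun y => (G y *m rho p) 0 0) p v.
Definition dlevi v : 'M[C]_s := mdir (fun y => invmx (leviX y)) p v.
Definition mu v : 'M[C]_s := (dlevi v + invmx (levi p) *m conn01 p v) *m levi p.
Definition Splus v : 'M[C]_s := (invmx (levi p) *m iota10 p v)^T.
Definition Sminus v : 'M[C]_s := (conjv (iota10 p v) *m levi p)^T.
Definition OmegaL v : 'M[C]_s := (conn10 p v)^T - (tau v / 2)%:M.

Lemma cdiff_tau : cdiff (fun y => (G y *m rho p) 0 0) p.
Proof. by apply: (mcdiffM (F := G) _ (mcdiff_cst _ _)); exact: G_diff. Qed.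

Lemma trow_diff x1 x2 : mcdiff (trow x1 x2) p.
Proof.
apply: mcdiffD; first by apply: mcdiffM; [exact: mcdiff_cst|exact: U10_diff].
apply: mcdiffM; last exact: U01_diff.
by apply: mcdiffM; [exact: mcdiff_cst|exact: leviXi_diff].
Qed.

Lemma mdir_trow x1 x2 v : K2 M p v -> mdir (trow x1 x2) p v =
  (x1^T *m conn10 p v + x2^T *m (invmx (levi p) *m iota10 p v)) *m U10 p +
  (x2^T *m (dlevi v + invmx (levi p) *m conn01 p v)) *m U01 p.
Proof.
move=> hv; have dU := U10_diff Bp; have dUb := U01_diff Bp.
have dx : mcdiff (fun y => x2^T *m invmx (leviX y)) p.
  by apply: mcdiffM; [exact: mcdiff_cst|exact: leviXi_diff].
have dxU : mcdiff (fun y => x1^T *m U10 y) p by apply: mcdiffM; [exact: mcdiff_cst|].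
rewrite mdirD //; last exact: mcdiffM.
rewrite mdirMl // mdirM // mdirMl; last exact: leviXi_diff.
rewrite -/(dlevi v) leviXp (mdir_U01 Bp Lp hv) (mdir_U10 Bp Lp hv).
exact: regroup_mx.
Qed.

Lemma mdir_ta x1 x2 v : K2 M p v ->
  mdir (ta x1 x2) p v = (conn10 p v)^T *m x1 + Splus v *m x2.
Proof.
move=> hv; rewrite /ta mdir_tr mdir_lsub mdir_rsub mdirMr; last exact: trow_diff.
rewrite mdir_trow // (comb_coef Bp Lp) row_mxKr row_mxKl.
by rewrite linearD /= trmx_mul trmxK (trmx_mul x2^T) trmxK.
Qed.

Lemma mdir_tb x1 x2 v : K2 M p v -> mdir (tb x1 x2) p v = (mu v)^T *m x2.
Proof.
move=> hv; rewrite /tb mdir_tr mdirMr; last first.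
  apply: mcdiff_rsub; apply: mcdiff_rsub; apply: mcdiffM; [exact: trow_diff|exact: mcdiff_cst].
rewrite !mdir_rsub mdirMr; last exact: trow_diff.
rewrite mdir_trow // (comb_coef Bp Lp) !row_mxKr -mulmxA -/(mu v).
by rewrite trmx_mul trmxK.
Qed.

Lemma transition_deriv v (A : 'M[C]_(1 + (s + (s + 1)))) (u : C) (x1 x2 : 'cV[C]_s) : K2 M p v ->
  (forall j k, is_leaf_deriv L
     (fun y => calI_transition M pi phi p y (gminus_mx u x1 x2) j k) p v (A j k)) <->
  A = gminus_mx (u * tau v) ((conn10 p v)^T *m x1 + Splus v *m x2) ((mu v)^T *m x2).
Proof.
move=> hv; have dv := dpi_K2 hM hpi hv.
have du : cdiff (tu u) p by apply: cdiffM; [exact: cdiff_cst|exact: cdiff_tau].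
have da : mcdiff (ta x1 x2) p.
  apply: mcdiff_tr; apply: mcdiff_lsub; apply: mcdiff_rsub.
  by apply: mcdiffM; [exact: trow_diff|exact: mcdiff_cst].
have db : mcdiff (tb x1 x2) p.
  apply: mcdiff_tr; apply: mcdiffM; last exact: mcdiff_cst.
  apply: mcdiff_rsub; apply: mcdiff_rsub.
  by apply: mcdiffM; [exact: trow_diff|exact: mcdiff_cst].
have [dg Eg] := mdir_gminus v du da db.
have Etau : dir (tu u) p v = u * tau v.
  by rewrite /tu dirM; [rewrite dir_cst mul0r add0r|exact: cdiff_cst|exact: cdiff_tau].
have E : mdir (fun y => gminus_mx (tu u y) (ta x1 x2 y) (tb x1 x2 y)) p v =
    gminus_mx (u * tau v) ((conn10 p v)^T *m x1 + Splus v *m x2) ((mu v)^T *m x2).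
  by rewrite Eg Etau (mdir_ta x1 x2 hv) (mdir_tb x1 x2 hv).
have nt j k : \forall y \near p, L y -> calI_transition M pi phi p y (gminus_mx u x1 x2) j k =
    gminus_mx (tu u y) (ta x1 x2 y) (tb x1 x2 y) j k.
  by apply: filterS (transitionE u x1 x2) => y H Ly; rewrite H.
rewrite -E; split=> [H|-> j k].
  apply/matrixP => j k; rewrite mxE.
  exact: ((leaf_deriv_K2 hM hpi _ dp dv (dg j k) (nt j k)).1 (H j k)).
by apply/(leaf_deriv_K2 hM hpi _ dp dv (dg j k) (nt j k)); rewrite mxE.
Qed.

(** The conditions under which the derivative of the transition maps is a derivation of
    the Heisenberg algebra: S^{0,2} is symmetric, and the block on g_{-1,-1} is
    dual to the one on g_{-1,1}. *)
Definition iota_ok v := (Splus v)^T = Splus v /\ mu v = (tau v / 2)%:M - OmegaL v.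
Definition iota_mx v : 'M[C]_(1 + (s + (s + 1))) :=
  alg_mx (- (tau v / 2)) 0 0 0 (OmegaL v) (Splus v) 0.

(** An element of csp is determined by its action on the Heisenberg algebra; comparing
    this action with the derivative of the transition maps on each graded component
    gives the blocks one by one. *)
Lemma iota_modE v A : K2 M p v ->
  is_iota_mod M pi phi p v A <-> iota_ok v /\ A = iota_mx v.
Proof.
move=> hv.
have two (a : C) : a / 2 + a / 2 = a by field.
split.
  move=> [[c [Lc [P [Q [hP hQ ->]]]]] H].
  have H' (u : C) (x1 x2 : 'cV[C]_s) : [/\ - (2 * c) * u = u * tau v,
      Lc *m x1 - c *: x1 + P *m x2 = (conn10 p v)^T *m x1 + Splus v *m x2 &
      Q *m x1 - Lc^T *m x2 - c *: x2 = (mu v)^T *m x2].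
    have hX : gminus (gminus_mx u x1 x2) by exists u, x1, x2.
    have /(transition_deriv _ _ _ _ hv) := H _ hX.
    rewrite (commutator_csp_gminus c u x1 x2 Lc hP hQ) /gminus_mx.
    by case/alg_mx_inj => -[_ E1 E2 E3] _; split.
  have Ec : c = - (tau v / 2).
    have [Hc _ _] := H' 1 0 0; rewrite mulr1 mul1r in Hc.
    by rewrite -Hc; field.
  have EP : P = Splus v.
    apply: cV_eq => x; have [_ + _] := H' 0 0 x.
    by rewrite !mulmx0 scaler0 subr0 !add0r.
  have EQ : Q = 0.
    apply: cV_eq => x; have [_ _] := H' 0 x 0.
    by rewrite !mulmx0 scaler0 !subr0 mul0mx.
  have EL : Lc = OmegaL v.
    apply: cV_eq => x; have [_ + _] := H' 0 x 0.
    rewrite !mulmx0 !addr0 /OmegaL mulmxBl mul_scalar_mx => <-.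
    by rewrite Ec scaleNr opprK addrK.
  split; last by rewrite EP EQ EL Ec.
  split; first by rewrite -EP hP.
  apply: trmx_inj; apply: cV_eq => x; have [_ _] := H' 0 0 x.
  rewrite mulmx0 sub0r => <-; rewrite EL Ec [in RHS]linearB /= tr_scalar_mx [in RHS]mulmxBl mul_scalar_mx.
  by rewrite scaleNr opprK addrC.
move=> [[hP hmu] ->]; split; first by exists (- (tau v / 2)), (OmegaL v), (Splus v), 0; split; rewrite ?trmx0.
move=> X [u [x1 [x2 ->]]]; apply/(transition_deriv _ _ _ _ hv).
rewrite (commutator_csp_gminus _ u x1 x2 _ hP (trmx0 _ _ _)).
have -> : - (2 * - (tau v / 2)) * u = u * tau v by field.
have -> : OmegaL v *m x1 - - (tau v / 2) *: x1 = (conn10 p v)^T *m x1.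
  by rewrite /OmegaL mulmxBl mul_scalar_mx scaleNr opprK subrK.
have -> // : 0 *m x1 - (OmegaL v)^T *m x2 - - (tau v / 2) *: x2 = (mu v)^T *m x2.
by rewrite hmu [in RHS]linearB /= tr_scalar_mx [in RHS]mulmxBl mul_scalar_mx mul0mx sub0r scaleNr opprK addrC.
Qed.

(** ** Linearity in the direction *)

Lemma iota10_lin y a v w : iota10 y (a *: v + w) = a *: iota10 y v + iota10 y w.
Proof. by rewrite /iota10 mdir_lin mulmxDl -scalemxAl !linearP. Qed.

Lemma conn01_lin y a v w : conn01 y (a *: v + w) = a *: conn01 y v + conn01 y w.
Proof. by rewrite /conn01 mdir_lin mulmxDl -scalemxAl !linearP. Qed.

Lemma conn10_lin y a v w : conn10 y (a *: v + w) = a *: conn10 y v + conn10 y w.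
Proof. by rewrite /conn10 mdir_lin mulmxDl -scalemxAl !linearP. Qed.

Lemma tau_lin a v w : tau (a *: v + w) = a * tau v + tau w.
Proof. exact: dir_lin. Qed.

Lemma Splus_lin a v w : Splus (a *: v + w) = a *: Splus v + Splus w.
Proof. by rewrite /Splus iota10_lin mulmxDr -scalemxAr linearP. Qed.

Lemma Sminus_lin a v w : Sminus (a *: v + w) = conjc a *: Sminus v + Sminus w.
Proof. by rewrite /Sminus iota10_lin conjvD conjvZ mulmxDl -scalemxAl linearP. Qed.

Lemma OmegaL_lin a v w : OmegaL (a *: v + w) = a *: OmegaL v + OmegaL w.
Proof.
rewrite /OmegaL conn10_lin tau_lin linearP /= scalerBr scale_scalar_mx mulrDl raddfD /= mulrA opprD.
by rewrite addrACA.
Qed.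

Lemma mu_lin a v w : mu (a *: v + w) = a *: mu v + mu w.
Proof.
rewrite /mu /dlevi mdir_lin conn01_lin mulmxDr -scalemxAr addrACA -scalerDr mulmxDl.
by rewrite -scalemxAl.
Qed.

Lemma iota_ok_sum k (t : 'I_k -> C) (X : 'I_k -> vec) :
  (forall b, iota_ok (X b)) -> iota_ok (\sum_b t b *: X b).
Proof.
move=> H; rewrite /iota_ok (lin_sum t X Splus_lin) (lin_sum t X mu_lin) (lin_sum t X OmegaL_lin).
rewrite (lin_sum (V := C^o) (F := tau) t X tau_lin); split.
  by rewrite linear_sum /=; apply: eq_bigr => b _; rewrite linearZ /= (H b).1.
rewrite mulr_suml raddf_sum -sumrB; apply: eq_bigr => b _.
by rewrite (H b).2 scalerBr scale_scalar_mx mulrA.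
Qed.

(** ** The images of the Levi kernel *)

Lemma g02_true S : phi_g02 M true p (phi p) S <-> exists2 v, K2 M p v & S = Splus v.
Proof.
split=> [[v hv <-]|[v hv ->]]; exists v => //; first exact: (Smat_trueE Bp Lp).
exact: (Smat_trueE Bp Lp).
Qed.

Lemma g02_false S : phi_g02 M false p (phi p) S <-> exists2 v, K2 M p v & S = Sminus v.
Proof.
split=> [[v hv <-]|[v hv ->]]; exists v => //; first exact: (Smat_falseE Bp Lp).
exact: (Smat_falseE Bp Lp).
Qed.

Lemma g02_lin sg a S S' : phi_g02 M sg p (phi p) S -> phi_g02 M sg p (phi p) S' ->
  phi_g02 M sg p (phi p) (a *: S + S').
Proof.
case: sg => [/g02_true[v hv ->] /g02_true[w hw ->]|/g02_false[v hv ->] /g02_false[w hw ->]].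
  by apply/g02_true; exists (a *: v + w); rewrite ?Splus_lin //; exact: K2_lin.
apply/g02_false; exists (conjc a *: v + w); first exact: K2_lin.
by rewrite Sminus_lin conjcK.
Qed.

Lemma g02_0 sg : phi_g02 M sg p (phi p) 0.
Proof.
case: sg; [apply/g02_true|apply/g02_false]; exists 0; try exact: (K20 hM).
  by have := Splus_lin (-1) 0 0; rewrite scaler0 addr0 scaleN1r addNr.
by rewrite /Sminus /iota10 mdir0 mul0mx !linear0 conjv0 mul0mx trmx0.
Qed.

Lemma g02_sum sg (I : finType) (t : I -> C) (S : I -> 'M[C]_s) :
  (forall i, phi_g02 M sg p (phi p) (S i)) -> phi_g02 M sg p (phi p) (\sum_i t i *: S i).
Proof.
move=> H; elim: (index_enum I) => [|i r IH]; first by rewrite big_nil; exact: g02_0.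
by rewrite big_cons; exact: g02_lin.
Qed.

Lemma g02D sg S S' : phi_g02 M sg p (phi p) S -> phi_g02 M sg p (phi p) S' ->
  phi_g02 M sg p (phi p) (S + S').
Proof. by move=> h h'; rewrite -[S]scale1r; exact: g02_lin. Qed.

Lemma g02B sg S S' : phi_g02 M sg p (phi p) S -> phi_g02 M sg p (phi p) S' ->
  phi_g02 M sg p (phi p) (S - S').
Proof. by move=> h h'; rewrite addrC -scaleN1r; exact: g02_lin. Qed.

(** Extensions off the leaf of the matrices [Smat] of a kernel field. *)
Definition Smx sg (W : field R (dimM s m)) y : 'M[C]_s :=
  if sg then (invmx (leviX y) *m iota10 y (W y))^T else (conjv (iota10 y (W y)) *m leviX y)^T.

Lemma mdir_leviX v : mdir leviX p v = - (levi p *m dlevi v *m levi p).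
Proof.
have U := leviXp_unit.
rewrite /dlevi (mdir_inv v leviX_diff U) -leviXp !mulmxN !mulNmx opprK.
by rewrite -!mulmxA mulVmx // mulmx1 mulKVmx.
Qed.

Definition act02 v w := symact (OmegaL v) (Splus w).

Section TwoKernelFields.
Variables V W : field R (dimM s m).
Hypothesis smV : field_smooth_on B V.
Hypothesis smW : field_smooth_on B W.
Hypothesis KV : forall y, B y -> K2 M y (V y).
Hypothesis KW : forall y, B y -> K2 M y (W y).

Lemma Smx_diff sg : mcdiff (Smx sg W) p.
Proof.
have da := iota10_diff smW.
case: sg; apply: mcdiff_tr; apply: mcdiffM => //; first exact: leviXi_diff.
  exact: mcdiff_conj.
exact: leviX_diff.
Qed.

Lemma Smat_deriv sg (D : 'M[C]_s) :
  (forall j k, is_leaf_deriv L (fun y => Smat M sg y (phi y) (W y) j k) p (V p) (D j k)) ->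
  D = mdir (Smx sg W) p (V p).
Proof.
move=> H; apply/matrixP => j k; rewrite mxE.
apply/(leaf_deriv_K2 hM hpi _ dp (dpi_K2 hM hpi (KV Bp)) (Smx_diff sg j k)); last exact: H.
apply: filterS nearB => y By Ly; rewrite /Smx leviX_leaf //.
by case: sg {H}; rewrite ?(Smat_trueE By Ly (KW By)) ?(Smat_falseE By Ly (KW By)).
Qed.

Lemma mdir_Smx_true : mdir (Smx true W) p (V p) =
  (dlevi (V p) *m iota10 p (W p) + invmx (levi p) *m mdir (fun y => iota10 y (W y)) p (V p))^T.
Proof.
rewrite /Smx mdir_tr mdirM; [|exact: leviXi_diff|exact: iota10_diff].
by rewrite leviXp.
Qed.

(** Here the two expressions for Omega are both used: by [conn10] in one term and by
    [mu] in the other. The scaling components cancel. *)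
Lemma act02E : iota_ok (V p) ->
  act02 (V p) (W p) = (invmx (levi p) *m (iota10 p (W p) *m conn10 p (V p) - conn01 p (V p) *m iota10 p (W p))
    - dlevi (V p) *m iota10 p (W p))^T.
Proof.
move=> [_ hmu]; have U := levi_unit Bp Lp.
have EL : OmegaL (V p) = (tau (V p) / 2)%:M - mu (V p) by rewrite hmu opprB addrC subrK.
rewrite /act02 /symact {2}EL {1}/OmegaL; apply: trmx_inj.
rewrite /Splus linearD /= !trmx_mul !trmxK linearB /= tr_scalar_mx !trmxK.
rewrite mulmxBr mulmxBl mul_mx_scalar mul_scalar_mx /mu.
have -> : (dlevi (V p) + invmx (levi p) *m conn01 p (V p)) *m levi p *m (invmx (levi p) *m iota10 p (W p)) =
    dlevi (V p) *m iota10 p (W p) + invmx (levi p) *m (conn01 p (V p) *m iota10 p (W p)).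
  by rewrite -mulmxA mulKVmx // mulmxDl -mulmxA.
exact: symbol_action_mx.
Qed.

End TwoKernelFields.

(** [jacobi_plus] multiplied by the inverse of [levi]: the derivatives of this factor
    cancel against the part of Omega that contains them. *)
Lemma jacobi_Smx_plus (V W : field R (dimM s m)) :
  field_smooth_on B V -> field_smooth_on B W ->
  (forall y, B y -> K2 M y (V y)) -> (forall y, B y -> K2 M y (W y)) ->
  iota_ok (V p) -> iota_ok (W p) ->
  phi_g02 M true p (phi p)
    (mdir (Smx true W) p (V p) - mdir (Smx true V) p (W p) +
     (act02 (V p) (W p) - act02 (W p) (V p))).
Proof.
move=> smV smW KV KW okV okW; apply/g02_true.
have [Y hY E] := jacobi_plus smV smW KV KW.
exists Y; first exact: hY.
rewrite /Splus -E (mdir_Smx_true V smW) (mdir_Smx_true W smV) (act02E W okV) (act02E V okW).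
exact: antisym_mx.
Qed.

(** [jacobi_mixed] multiplied by [levi], with the same cancellation of the derivatives
    of that factor. *)
Lemma jacobi_Smx_minus (V W : field R (dimM s m)) :
  field_smooth_on B V -> field_smooth_on B W ->
  (forall y, B y -> K2 M y (V y)) -> (forall y, B y -> K2 M y (W y)) ->
  iota_ok (V p) ->
  phi_g02 M false p (phi p)
    (mdir (Smx false W) p (V p) - ((OmegaL (V p))^T *m Sminus (W p) + Sminus (W p) *m OmegaL (V p))).
Proof.
move=> smV smW KV KW [_ hmu]; apply/g02_false.
have [Z hZ E] := jacobi_mixed smV smW KV KW.
exists Z => //; rewrite /Sminus -E.
have U := levi_unit Bp Lp.
have EL : OmegaL (V p) = (tau (V p) / 2)%:M - mu (V p) by rewrite hmu opprB addrC subrK.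
have -> : mdir (Smx false W) p (V p) = (mdir (fun y => conjv (iota10 y (W y))) p (V p) *m levi p -
    conjv (iota10 p (W p)) *m (levi p *m dlevi (V p) *m levi p))^T.
  rewrite /Smx mdir_tr mdirM; [|by apply: mcdiff_conj; exact: iota10_diff|exact: leviX_diff].
  by rewrite mdir_leviX mulmxN leviXp.
exact: normal_mx.
Qed.

(** ** Brackets of the elements of the modified symbol *)

Definition bracket02 v w := act02 v w - act02 w v.

Lemma act02_linl u a v w : act02 (a *: v + w) u = a *: act02 v u + act02 w u.
Proof. by rewrite /act02 OmegaL_lin symact_linl. Qed.

Lemma act02_linr u a v w : act02 u (a *: v + w) = a *: act02 u v + act02 u w.
Proof. by rewrite /act02 Splus_lin symact_linr. Qed.

Lemma bracket02_linl u a v w : bracket02 (a *: v + w) u = a *: bracket02 v u + bracket02 w u.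
Proof. by rewrite /bracket02 act02_linl act02_linr opprD scalerBr addrACA. Qed.

Lemma bracket02_linr u a v w : bracket02 u (a *: v + w) = a *: bracket02 u v + bracket02 u w.
Proof. by rewrite /bracket02 act02_linl act02_linr opprD scalerBr addrACA. Qed.

Lemma commutator_iota_mx v w : commutator (iota_mx v) (iota_mx w) =
  alg_mx 0 0 0 0 (OmegaL v *m OmegaL w - OmegaL w *m OmegaL v) (bracket02 v w) 0.
Proof. exact: commutator_csp. Qed.

Let eK2 a y : B y -> K2 M y (e a y).
Proof. by move=> By; exact: e_K2 (Bdom By). Qed.

Let se a : field_smooth_on B (e a).
Proof. by case: he => h _; exact: field_smooth_sub Bdom (h a). Qed.

Hypothesis ok_e : forall a, iota_ok (e a p).

(** The tensor O, evaluated on a basis, is a derivative along the leaf modulo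
    the subspace of the symbol, and that derivative may be taken on the extension. *)
Lemma is_O_basis sg o a b : is_O M pi e sg phi p o ->
  phi_g02 M sg p (phi p)
    (o (e a p) (Smat M sg p (phi p) (e b p)) - mdir (Smx sg (e b)) p (e a p)).
Proof.
move=> hO; have [D [HD Ht]] := hO _ (eK2 a Bp).
have := Ht (fun c => (c == b)%:R).
have pick (F : 'I_m -> 'M[C]_s) : \sum_c (c == b)%:R *: F c = F b.
  rewrite (bigD1 b) //= eqxx scale1r big1 ?addr0 // => c /negbTE ->.
  by rewrite scale0r.
rewrite !pick.
by rewrite -(Smat_deriv (se b) (@eK2 a) (@eK2 b) (HD b)).
Qed.

(** Modulo g_{0,2}, the symmetry of the tensor removes the antisymmetrized derivatives
    from [jacobi_Smx_plus]. *)
Lemma bracket02_basis o a b : is_O M pi e true phi p o ->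
  phi_g02 M true p (phi p) (o (e a p) (Splus (e b p)) - o (e b p) (Splus (e a p))) ->
  phi_g02 M true p (phi p) (bracket02 (e a p) (e b p)).
Proof.
move=> hO hs.
have ha := is_O_basis a b hO; have hb := is_O_basis b a hO.
rewrite (Smat_trueE Bp Lp (eK2 b Bp)) -/(Splus (e b p)) in ha.
rewrite (Smat_trueE Bp Lp (eK2 a Bp)) -/(Splus (e a p)) in hb.
have hj := jacobi_Smx_plus (se a) (se b) (@eK2 a) (@eK2 b) (ok_e a) (ok_e b).
have := g02B (g02D hj (g02B ha hb)) hs; congr (phi_g02 _ _ _ _ _).
rewrite /bracket02.
exact: antisym_sum.
Qed.

(** Modulo g_{0,-2}, the derivative in [jacobi_Smx_minus] is a value of the tensor,
    which is zero. *)
Lemma normalizer_minus o a b : is_O M pi e false phi p o -> is_zero_tensor M false p (phi p) o ->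
  phi_g02 M false p (phi p) (- ((OmegaL (e a p))^T *m Sminus (e b p) + Sminus (e b p) *m OmegaL (e a p))).
Proof.
move=> hO h0; have ha := is_O_basis a b hO.
have hS : phi_g02 M false p (phi p) (Smat M false p (phi p) (e b p)).
  by exists (e b p) => //; exact: eK2.
have hn := jacobi_Smx_minus (se a) (se b) (@eK2 a) (@eK2 b) (ok_e a).
have := g02B (g02D hn ha) (h0 _ _ (eK2 a Bp) hS); congr (phi_g02 _ _ _ _ _).
exact: normal_sum.
Qed.

Lemma normalizer_OmegaL o a S : is_O M pi e false phi p o -> is_zero_tensor M false p (phi p) o ->
  phi_g02 M false p (phi p) S ->
  phi_g02 M false p (phi p) (- ((OmegaL (e a p))^T *m S + S *m OmegaL (e a p))).
Proof.
move=> hO h0 /g02_false[w hw ->]; have [t ->] := K2_coords hw.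
have -> : Sminus (\sum_b t b *: e b p) = \sum_b conjc (t b) *: Sminus (e b p).
  elim: (index_enum _) => [|b r IH]; last by rewrite !big_cons Sminus_lin IH.
  by rewrite !big_nil /Sminus /iota10 mdir0 mul0mx !linear0 conjv0 mul0mx trmx0.
have -> : - ((OmegaL (e a p))^T *m (\sum_b conjc (t b) *: Sminus (e b p)) +
     (\sum_b conjc (t b) *: Sminus (e b p)) *m OmegaL (e a p)) =
    \sum_b conjc (t b) *: (- ((OmegaL (e a p))^T *m Sminus (e b p) + Sminus (e b p) *m OmegaL (e a p))).
  rewrite mulmx_sumr mulmx_suml -big_split -sumrN; apply: eq_bigr => b _.
  by rewrite -scalemxAr -scalemxAl scalerN scalerDr.
by apply: g02_sum => b; exact: normalizer_minus hO h0.
Qed.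

Lemma bracket02_K2 v w : (forall a b, phi_g02 M true p (phi p) (bracket02 (e a p) (e b p))) ->
  K2 M p v -> K2 M p w -> phi_g02 M true p (phi p) (bracket02 v w).
Proof.
move=> H /K2_coords[t ->] /K2_coords[t' ->].
rewrite (lin_sum t (fun a => e a p) (bracket02_linl (\sum_b t' b *: e b p))).
apply: g02_sum => a; rewrite (lin_sum t' (fun b => e b p) (bracket02_linr (e a p))).
by apply: g02_sum => b; exact: H.
Qed.

Lemma iota_ok_K2 v : K2 M p v -> iota_ok v.
Proof. by move=> /K2_coords[t ->]; exact: iota_ok_sum. Qed.

(** [iota_ok] holds on the frame because the Omega_alpha are assumed to exist, and it is
    a linear condition. *)
Lemma gmod_plusE A : gmod_plus M pi phi p A <-> exists2 v, K2 M p v & A = iota_mx v.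
Proof.
split=> [[v hv]|[v hv ->]]; first by move/(iota_modE _ hv) => [_ ->]; exists v.
by exists v => //; apply/(iota_modE _ hv); split=> //; exact: iota_ok_K2.
Qed.

Lemma proj02_bracket A : (forall a b, phi_g02 M true p (phi p) (bracket02 (e a p) (e b p))) ->
  bracket_span (gmod_plus M pi phi p) (gmod_plus M pi phi p) A ->
  exists2 v, K2 M p v & proj02 A = proj02 (iota_mx v).
Proof.
move=> H [k [X [Y [hX hY ->]]]].
have [P hP ->] : exists2 P, phi_g02 M true p (phi p) P &
    proj02 (\sum_j commutator (X j) (Y j)) = inS true P.
  exists (\sum_j (1 : C) *: lsubmx (ursubmx (drsubmx (commutator (X j) (Y j))))).
    apply: g02_sum => j.
    have [v hv ->] := (gmod_plusE _).1 (hX j); have [w hw ->] := (gmod_plusE _).1 (hY j).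
    rewrite commutator_iota_mx /alg_mx block_mxKdr block_mxKur row_mxKl.
    exact: bracket02_K2.
  rewrite /proj02; congr (inS true _); apply/matrixP => i j.
  rewrite !mxE !summxE; apply: eq_bigr => c _.
  by rewrite !mxE mul1r.
have [v hv ->] := (g02_true P).1 hP.
by exists v => //; rewrite proj02_alg_mx.
Qed.

Lemma is_Omega_OmegaL v Om : K2 M p v -> is_Omega M pi phi p v Om -> iota_ok v /\ Om = OmegaL v.
Proof.
move=> hv [c [Sp [Sm /(iota_modE _ hv)[ok]]]]; rewrite /iota_mx => /alg_mx_inj[_ [-> _ _]].
by split.
Qed.

Lemma expiV h : expi h * expi (- h) = 1 :> C.
Proof.
apply: complex_eq; rewrite ?ReM ?ImM /= cosN sinN; last by ring.
by rewrite mulrN opprK -!expr2 cos2Dsin2.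
Qed.

Lemma Splus_Xi v h Hp Xi : K2 M p v -> is_Hmat M p (phi p) h Hp -> is_Xi M p (phi p) v Xi ->
  Splus v = expi (- h) *: (Xi *m invmx Hp).
Proof.
move=> hv hH hXi; have EK := is_Hmat_levi Bp Lp hH; have U := levi_unit Bp Lp.
rewrite /Splus (is_Xi_iota10 Bp Lp hv hXi) trmx_mul trmxK trmx_inv scalemxAr; congr (_ *m _).
have hE : expi h != 0 :> C.
  by apply/eqP => E0; have := expiV h; rewrite E0 mul0r => /eqP; rewrite eq_sym oner_eq0.
have EKT : (levi p)^T = expi h *: Hp by rewrite EK linearZ /= trmxK.
rewrite EKT invmxZ; last by rewrite -EKT unitmx_tr.
by congr (_ *: _); apply: (mulfI hE); rewrite mulfV // expiV.
Qed.

End Frame.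

Theorem lemma2p25 (R : realType) (n s : nat) (le_sn : (s <= n)%N)
    (M : graph R s (n - s)) (hM : two_nondegenerate_model M)
    (pi : 'rV[R]_(dimM s (n - s)) -> 'rV[R]_(1 + (s + s)))
    (hpi : local_quotient M pi)
    (e : 'I_(n - s) -> field R (dimM s (n - s))) (he : kernel_frame M e)
    (ON : 'rV[R]_(dimM s (n - s)) -> symmap R s (n - s) ->
          tensor R s (n - s) * tensor R s (n - s))
    (hON : normalization_condition M pi e ON)
    (p : 'rV[R]_(dimM s (n - s))) (hp : dom M p)
    (* a section through the given point phi p of F which computes the modified
       symbol at phi p with respect to the normalization condition ON *)
    (phi : 'rV[R]_(dimM s (n - s)) -> symmap R s (n - s))
    (hphi : has_O M pi e phi p (ON p (phi p)))
    (h : R) (Hp : 'M[R[i]]_s) (Xi Om : 'I_(n - s) -> 'M[R[i]]_s)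
    (hHp : is_Hmat M p (phi p) h Hp)
    (hXi : forall a, is_Xi M p (phi p) (e a p) (Xi a))
    (hOm : forall a, is_Omega M pi phi p (e a p) (Om a)) :
  let S02 a := expi (- h) *: (Xi a *m invmx Hp) in
  let g02 := phi_g02 M true p (phi p) in
  is_zero_tensor M false p (phi p) (ON p (phi p)).1 ->
  (forall a b, g02 ((ON p (phi p)).2 (e a p) (S02 b) -
                    (ON p (phi p)).2 (e b p) (S02 a))) ->
  [/\ forall a, normalizer00 (inS false @` phi_g02 M false p (phi p)) (inL (Om a)),
      (fun a => inL (Om a)) \in
        [set B : 'I_(n - s) -> 'M[R[i]]_(1 + (s + (s + 1))) |
          (forall a, csp00 (B a)) /\
          forall a b, (inS true @` g02)
            (commutator (B a) (inS true (S02 b)) -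
             commutator (B b) (inS true (S02 a)))] &
      proj02 @` bracket_span (gmod_plus M pi phi p) (gmod_plus M pi phi p) `<=`
      proj02 @` gmod_plus M pi phi p].

Proof.
move=> S02 g02 h0 h1.
have [hs hO0 hO1] := hphi; have [phiF hsec] := hs.
have Lpp : leaf M pi p p by [].
have [B0 [oB0 B0p] [g [f [smg smf fH fphi]]]] := hsec p Lpp.
have oM := dom_open hM.
pose B := B0 `&` dom M.
have oB : open B by exact: openI.
have Bp : B p by [].
have Bdom : B `<=` dom M by move=> x [].
have BB0 : B `<=` B0 by move=> x [].
have smg' : field_smooth_on B g by exact: field_smooth_sub BB0 smg.
have smf' j : field_smooth_on B (f j) by exact: field_smooth_sub BB0 (smf j).
have fH' y j : B y -> calH M y (f j y) by move=> [b1 b2]; exact: fH.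
have fphi' y : B y -> leaf M pi p y ->
   s20 (phi y) (g y) = 1 /\ rep_basis M y (phi y) (f ^~ y) by move=> [b1 b2]; exact: fphi.
have eK2 a : K2 M p (e a p) by exact: (e_K2 he a hp).
pose Omd a := is_Omega_OmegaL hM hpi he hp phiF oB Bp Bdom smg' smf' fH' fphi' (eK2 a) (hOm a).
have ok_e a := (Omd a).1.
have EOm a := (Omd a).2.
have ES a : S02 a = Splus pi p phi g f (e a p).
  by rewrite (Splus_Xi hM hpi he hp phiF oB Bp Bdom smf' fH' fphi' (eK2 a) hHp (hXi a)).
have hbr a b : phi_g02 M true p (phi p) (bracket02 pi p phi g f (e a p) (e b p)).
  apply: (bracket02_basis hM hpi he hp phiF oB Bp Bdom smg' smf' fH' fphi' ok_e hO1).
  by rewrite -!ES; exact: h1.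
split.
- move=> a; split; first by exists 0, (Om a).
  move=> Y [S hS <-]; rewrite commutator_inS_false; exists (- ((Om a)^T *m S + S *m Om a)) => //.
  rewrite EOm.
  exact: (normalizer_OmegaL hM hpi he hp phiF oB Bp Bdom smg' smf' fH' fphi' ok_e a hO0 h0 hS).
- rewrite inE; split=> [a|a b]; first by exists 0, (Om a).
  exists (bracket02 pi p phi g f (e a p) (e b p)); first exact: hbr.
  rewrite !commutator_inS_true !ES !EOm /bracket02 /act02 /inS alg_mxN alg_mxD.
  by rewrite !oppr0 !addr0.
- move=> X [A hA <-].
  have [v hv ->] := proj02_bracket hM hpi he hp phiF oB Bp Bdom smg' smf' fH' fphi' ok_e hbr hA.
  exists (iota_mx pi p phi g f v) => //.
  by apply/(gmod_plusE hM hpi he hp phiF oB Bp Bdom smg' smf' fH' fphi' ok_e); exists v.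
Qed.
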